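(* Let $$A=\int_{\mathbb{R}^3}\|\mathbf{x}\|^2\,\Gamma(\log h,\log h)(\mathbf{x})\,h(\mathbf{x})\,d\mathbf{x}.$$ Then for every $t\geq0$ and every $f\in\mathcal{C}^\infty_c(\mathbb{H})$ (smooth compactly supported real-valued functions on $\mathbb{H}$), one has, pointwise on $\mathbb{H}$, $$\Gamma(P_tf,P_tf)\leq 2(A+4)\,P_t(\Gamma(f,f)).$$
   Context: $\mathbb{H}=\mathbb{R}^3$ is the Heisenberg group with product $(x,y,z)\bullet(x',y',z')=(x+x',y+y',z+z'+\tfrac12(xy'-yx'))$. The left-invariant vector fields are $X=\partial_x-\tfrac y2\partial_z$, $Y=\partial_y+\tfrac x2\partial_z$, $Z=\partial_z=[X,Y]$. Put $L=X^2+Y^2$ and $\Gamma(f,f)=(Xf)^2+(Yf)^2$. The heat semigroup $(P_t)_{t\ge0}=(e^{tL})_{t\geq 0}$ is given by $P_0=\mathrm{Id}$ and, for $t>0$, $P_tf(\mathbf{x})=\int_{\mathbb{R}^3}f(\mathbf{x}\bullet\mathbf{y})\,p_t(\mathbf{y})\,d\mathbf{y}$ ($d\mathbf y$ Lebesgue measure), where, with $r^2=x^2+y^2$, $$p_t(x,y,z)=\frac1{8\pi^2}\int_{-\infty}^{+\infty}e^{i\lambda z}\frac{\lambda}{\sinh\lambda t}\exp\!\Big(-\frac{r^2}{4}\lambda\coth(\lambda t)\Big)d\lambda .$$ The function $h=p_1$ is the (positive) heat kernel density at time $1$ started from $0$. For $\mathbf{x}=(x,y,z)$, $\|\mathbf{x}\|=\sqrt{x^2+y^2}$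 is the Euclidean norm of the horizontal projection. The constant $A$ is finite. *)

(* Defs.v *)
From HB Require Import structures.
From mathcomp Require Import all_boot all_order all_algebra.
From mathcomp Require Import all_classical all_reals all_analysis.
From mathcomp Require Import complex.

Set Implicit Arguments.
Unset Strict Implicit.
Unset Printing Implicit Defensive.

Import Order.TTheory GRing.Theory Num.Theory.
Import numFieldNormedType.Exports.
Local Open Scope classical_set_scope.
Local Open Scope ring_scope.

(* Points of the Heisenberg group are nested pairs ((x, y), z), so that the
   product topology, norm and sigma-algebra of R^3 are inferred. *)
Notation heis R := (R * R * R)%type.

Notation lebesgue3 R :=
  ((@lebesgue_measure R \x @lebesgue_measure R) \x @lebesgue_measure R)%E.

Section HeisenbergGroup.
Variable R : realType.
Implicit Types (p q : heis R) (f g : heis R -> R).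

Definition hmul p q : heis R :=
  let: (x, y, z) := p in
  let: (x', y', z') := q in
  (x + x', y + y', z + z' + (x * y' - y * x') / 2).

Definition basis3 (i : 'I_3) : heis R :=
  ((i == 0)%:R, (i == 1)%:R, (i == 2)%:R).

Definition partial (i : 'I_3) f : heis R -> R := fun p => 'D_(basis3 i) f p.

Definition fieldX f : heis R -> R :=
  fun p => partial 0 f p - p.1.2 / 2 * partial 2 f p.

Definition fieldY f : heis R -> R :=
  fun p => partial 1 f p + p.1.1 / 2 * partial 2 f p.

Definition Gamma f : heis R -> R :=
  fun p => fieldX f p ^+ 2 + fieldY f p ^+ 2.

Definition hnorm p : R := Num.sqrt (p.1.1 ^+ 2 + p.1.2 ^+ 2).

(* Infinite Frechet differentiability: f and its iterated partial derivatives
   of every order are differentiable everywhere. *)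
Definition smooth f : Prop :=
  forall (s : seq 'I_3) p, differentiable (foldr partial f s) p.

Definition compactly_supported f : Prop :=
  compact (closure [set p | f p != 0]).

End HeisenbergGroup.

Section HeatKernel.
Variable R : realType.
Implicit Types (p : heis R) (f : heis R -> R) (t u : R).

Definition sinh u : R := (expR u - expR (- u)) / 2.
Definition cosh u : R := (expR u + expR (- u)) / 2.
Definition coth u : R := cosh u / sinh u.

(* e^{iu} *)
Definition expi u : R[i] := Complex (cos u) (sin u).

Definition Cintegral (F : R -> R[i]) : R[i] :=
  Complex (\int[@lebesgue_measure R]_u complex.Re (F u))
          (\int[@lebesgue_measure R]_u complex.Im (F u)).

(* The integrand at l = 0 takes the value 0 (as 0 / 0 = 0), on a null set.  Its
   imaginary part is odd in l, so that the complex integral is real and taking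
   the real part loses nothing. *)
Definition heat_kernel t p : R :=
  (8 * pi ^+ 2)^-1 *
  complex.Re (Cintegral (fun l : R =>
    expi (l * p.2) *
    real_complex R (l / sinh (l * t) *
      expR (- (hnorm p ^+ 2 / 4 * (l * coth (l * t))))))).

Definition heat_semigroup t f : heis R -> R :=
  fun p => if t == 0 then f p
           else \int[lebesgue3 R]_q (f (hmul p q) * heat_kernel t q).

Definition h : heis R -> R := heat_kernel 1.

(* The integral of a nonnegative function, hence an element of [0, +oo]; it is
   in fact finite.  The real-valued integral would be 0 on divergence. *)
Definition constA : \bar R :=
  (\int[lebesgue3 R]_p
     (hnorm p ^+ 2 * Gamma (fun q => ln (h q)) p * h p)%:E)%E.

End HeatKernel.

(* Main.v *)
Require Import Defs.
From HB Require Import structures.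
From mathcomp Require Import all_boot all_order all_algebra.
From mathcomp Require Import all_classical all_reals all_analysis.
From mathcomp Require Import measurable_realfun ring lra complex.
Set Implicit Arguments.
Unset Strict Implicit.
Unset Printing Implicit Defensive.
Import Order.TTheory GRing.Theory Num.Theory.
Import numFieldNormedType.Exports.
Local Open Scope classical_set_scope.
Local Open Scope ring_scope.

(* Scaling the kernel turns P_t f (p) into the integral of
   f (p . dilation rho q) h q in q, where t = rho^2.  Write a = X P_t f (p) and
   b = Y P_t f (p).  The right-invariant fields, which act under this integral,
   differ from the left-invariant ones by a multiple of Z = [X, Y]; integrating
   that term by parts gives
     Gamma (P_t f) p = int 2 (a U + b V) h + (a y - b x) (U Y h - V X h),
   where U, V are X f and Y f at the dilated point.  By AM-GM the integrand is at
   most, for every s > 0,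
     s (a^2 + b^2) (4 h + |x|^2 Gamma(h) / h) + (U^2 + V^2) h / (2 s),
   and s = 1 / (2 (A + 4)) together with int h <= 1 gives the bound.
   This uses h >= 0 without the strict positivity of the kernel: where h
   vanishes it has a minimum, so its gradient vanishes as well.

   Nonnegativity of h is proved by Fourier analysis.  Call m a multiplier if
   g |-> m g preserves integrable functions with nonnegative cosine transform.
   The functions 1 / (a^2 + u^2) are multipliers, because their cosine transforms
   are nonnegative, and multipliers are stable under sums, products and bounded
   limits.  The inverse pivots p_k in the Gaussian elimination of the tridiagonal
   matrix with entries -1, 2 + u^2 / N^2, -1 are therefore multipliers.  As
   N p_1 ... p_(N-1) tends to u / sinh u and N (1 - p_(N-1)) to u coth u, the heat
   weight (u / sinh u) exp (- c u coth u) is a multiplier. *)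

(** * Functions with nonnegative cosine transform *)

(** The semigroup is convolution on the right, so right-invariant fields commute with it, whereas
    [Gamma] is built from left-invariant ones. The discrepancy is rho Z f times horizontal
    coordinates of the integration variable q. Left-invariant fields pass through q |-> p . dilation
    rho q with one factor rho each, so rho Z f at the dilated point equals X U2 - Y U1 in q, where
    U1, U2 are X f and Y f at that point; every power of rho is then used up and the bound is
    uniform in t. In the integration by parts, the derivatives of the weight a y - b x reproduce a U
    + b V once more: this is the 2 in the integrand, and its square is the 4 of A + 4. Up to the
    factor N^2, the tridiagonal matrix discretises -d^2/dx^2 + u^2 on [0, 1] with Dirichlet
    conditions. This is why its determinant, divided by N, tends to sinh u / u. Finiteness of A is
    not proved. [constA] lives in [0, +oo], and since +oo times 0 is 0, the case A = +oo still
    demands that the gradient of P_t f vanish wherever P_t (Gamma f) does. *)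

Section LaplaceTransform.
Context {R : realType}.
Local Notation mu := (@lebesgue_measure R).

Lemma cvg_expRN_bounded (a C : R) (F : R -> R) : 0 < a ->
  (forall u, `|F u| <= C) -> expR (- (a * u)) * F u @[u --> +oo%R] --> (0:R).
Proof.
move=> a0 FC.
have e0 : expR (- (a * u)) @[u --> +oo%R] --> (0:R).
  have := @cvgr_expR R.
  apply: (@cvg_comp _ _ _ (fun u => a * u)).
  apply/cvgryPge => A; near=> u.
  by rewrite mulrC -ler_pdivrMr//; near: u; apply: nbhs_pinfty_ge; rewrite num_real.
apply/norm_cvg0P.
have h : C * expR (- (a * u)) @[u --> +oo%R] --> (0:R).
  rewrite -[X in _ --> X](mulr0 C); apply: cvgM => //; exact: cvg_cst.
apply: (squeeze_cvgr _ (cvg_cst 0) h).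
near=> u; rewrite normr_ge0/= normrM ger0_norm ?expR_ge0// mulrC.
by rewrite ler_wpM2r// expR_ge0.
Unshelve. all: by end_near.
Qed.

Lemma continuous_is_derive (f g : R -> R) :
  (forall x : R, is_derive x 1 f (g x)) -> continuous f.
Proof.
move=> fg x; apply/differentiable_continuous/derivable1_diffP.
by have [] := fg x.
Qed.

Lemma integralT_even (f F : R -> R) (l : R) :
  (forall x, 0 <= f x) -> f =1 f \o -%R -> continuous f ->
  (forall x : R, is_derive x 1 F (f x)) -> F x @[x --> +oo%R] --> l ->
  (\int[mu]_x (f x)%:E = (2 * (l - F 0))%:E)%E.
Proof.
move=> f0 fe cf dF Fl.
have cF := continuous_is_derive dF.
rewrite ge0_symfun_integralT// (_ : [set x | _] = `[0, +oo[%classic); last first.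
  by apply/seteqP; split => x/=; rewrite in_itv/= andbT.
have -> : (\int[mu]_(x in `[0%R, +oo[) (f x)%:E = l%:E - (F 0)%:E)%E.
  apply: ge0_continuous_FTC2y => //.
  - exact: continuous_subspaceT.
  - exact/cvg_at_right_filter/cF.
  - by move=> x _; rewrite derive1E; case: (dF x).
by rewrite -EFinB -EFinM.
Qed.

(** The primitive is the sum of those of exp (- a u) and exp (- a u) cos (l u). The summand 1 keeps
    the integrand nonnegative, as the fundamental theorem on a half-line requires;
    [Rintegral_expRN_abs_cos] subtracts it again. *)
Lemma is_derive_Laplace_primitive (a l u : R) : 0 < a ->
  is_derive u (1:R) (fun u => - expR (- (a * u)) / a +
     expR (- (a * u)) * ((l * sin (l * u) - a * cos (l * u)) / (a ^+ 2 + l ^+ 2)) : R)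
   (expR (- (a * u)) * (1 + cos (l * u))).
Proof.
move=> a0.
apply: is_derive_eq.
rewrite /GRing.scale /=.
have a2 : a ^+ 2 + l ^+ 2 != 0 by rewrite gt_eqF// ltr_wpDr ?sqr_ge0// exprn_gt0.
field.
by rewrite a2 gt_eqF.
Qed.

Lemma continuous_expRN_abs (a : R) : continuous (fun u : R => expR (- (a * `|u|))).
Proof.
move=> u; apply: (@continuous_comp _ _ _ (fun u => - (a * `|u|)) expR).
  by apply/continuousN/continuousM; [exact: cst_continuous|exact: norm_continuous].
exact: continuous_expR.
Qed.

Lemma continuous_cosM (l : R) : continuous (fun u : R => cos (l * u)).
Proof.
move=> u; apply: (@continuous_comp _ _ _ ( *%R l) cos).
  exact: mulrl_continuous.
exact: continuous_cos.
Qed.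

Lemma ge_cosN1 (x : R) : 0 <= 1 + cos x.
Proof. by rewrite -lerBlDl sub0r cos_geN1. Qed.

Lemma continuous_1cosM (l : R) : continuous (fun u : R => 1 + cos (l * u)).
Proof. by move=> u; apply: cvgD; [exact: cvg_cst|exact: continuous_cosM]. Qed.

Lemma integral_expRN_abs_1cos (a l : R) : 0 < a ->
  (\int[mu]_u (expR (- (a * `|u|)) * (1 + cos (l * u)))%:E
   = (2 / a + 2 * a / (a ^+ 2 + l ^+ 2))%:E)%E.
Proof.
move=> a0.
have a2 : 0 < a ^+ 2 + l ^+ 2 by rewrite ltr_wpDr ?sqr_ge0// exprn_gt0.
have even : (fun u => expR (- (a * `|u|)) * (1 + cos (l * u))) =1
   (fun u => expR (- (a * `|u|)) * (1 + cos (l * u))) \o -%R.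
  by move=> x /=; rewrite normrN mulrN cosN.
have f0 x : 0 <= expR (- (a * `|x|)) * (1 + cos (l * x)).
  by rewrite mulr_ge0 ?expR_ge0 ?ge_cosN1.
rewrite ge0_symfun_integralT//; last first.
  by move=> u; apply: cvgM; [exact: continuous_expRN_abs|exact: continuous_1cosM].
rewrite (_ : [set x | _] = `[0, +oo[%classic); last first.
  by apply/seteqP; split => x/=; rewrite in_itv/= andbT.
under eq_integral => u.
  rewrite inE/= in_itv/= andbT => u0.
  rewrite ger0_norm//; over.
pose F := fun u => - expR (- (a * u)) / a +
     expR (- (a * u)) * ((l * sin (l * u) - a * cos (l * u)) / (a ^+ 2 + l ^+ 2)) : R.
have dF u : is_derive u (1:R) F (expR (- (a * u)) * (1 + cos (l * u))).
  exact: is_derive_Laplace_primitive.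
have cF := continuous_is_derive dF.
transitivity (2%:E * (0%:E - (F 0)%:E))%E; last first.
  rewrite /F !mulr0 oppr0 expR0 sin0 cos0 !mulr0 !mulr1 sub0r.
  rewrite -EFinB -EFinM; congr EFin.
  by field; rewrite !gt_eqF.
congr (_ * _)%E; apply: ge0_continuous_FTC2y => //.
- apply: continuous_subspaceT => u; apply: cvgM; last exact: continuous_1cosM.
  apply: (@continuous_comp _ _ _ (fun u => - (a * u)) expR).
    by apply/continuousN/mulrl_continuous.
  exact: continuous_expR.
- rewrite (_ : F = fun u => expR (- (a * u)) * (- a^-1 +  ((l * sin (l * u) - a * cos (l * u)) / (a ^+ 2 + l ^+ 2)))); last first.
    by apply/funext => u; rewrite /F; field; rewrite !gt_eqF.
  apply: (@cvg_expRN_bounded _ (a^-1 + (`|l| + a) / (a ^+ 2 + l ^+ 2))) => // u.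
  rewrite (le_trans (ler_normD _ _))// lerD//.
    by rewrite normrN ger0_norm// invr_ge0 ltW.
  rewrite normrM [X in _ * X]ger0_norm; last by rewrite invr_ge0 ltW.
  rewrite ler_wpM2r ?invr_ge0 ?(ltW a2)//.
  rewrite (le_trans (ler_normB _ _))// !normrM lerD//.
    by rewrite ler_piMr// ler_norml sin_geN1 sin_le1.
  by rewrite [`|a|]gtr0_norm// ler_piMr// ?(ltW a0)// ler_norml cos_geN1 cos_le1.
- exact/cvg_at_right_filter/cF.
- by move=> x _; rewrite derive1E; case: (dF x).
Qed.

Lemma integral_expRN_abs (a : R) : 0 < a ->
  (\int[mu]_u (expR (- (a * `|u|)))%:E = (2 / a)%:E)%E.
Proof.
move=> a0; have := integral_expRN_abs_1cos 0 a0.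
under eq_integral do rewrite mul0r cos0 mulrC EFinM.
rewrite ge0_integralZl_EFin//; last first.
  by apply/measurable_EFinP; apply: continuous_measurable_fun; exact: continuous_expRN_abs.
have e : 2 / a = (1 + 1)^-1 * (2 / a + 2 * a / (a ^+ 2 + 0 ^+ 2)).
  by field; rewrite gt_eqF.
by move=> I2; rewrite e EFinM -I2 muleA -EFinM mulVf ?mul1e.
Qed.

Lemma integrable_expRN_abs (a : R) : 0 < a ->
  mu.-integrable setT (EFin \o (fun u => expR (- (a * `|u|)))).
Proof.
move=> a0; apply/integrableP; split.
  apply/measurable_EFinP; apply: continuous_measurable_fun; exact: continuous_expRN_abs.
under eq_integral do rewrite /= ger0_norm ?expR_ge0//.
by rewrite integral_expRN_abs// ltry.
Qed.

Lemma integrable_bddM d (T : measurableType d) (m : {measure set T -> \bar R})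
    (f g : T -> R) (C : R) : measurable_fun setT f -> (forall x, `|f x| <= C) ->
  m.-integrable setT (EFin \o g) -> m.-integrable setT (EFin \o (fun x => f x * g x)).
Proof.
move=> mf fC ig.
apply: (@le_integrable _ _ _ _ _ measurableT _ (fun x => C%:E * (EFin \o g) x)%E).
- apply/measurable_EFinP/measurable_funM => //.
  by apply/measurable_EFinP/measurable_int/ig.
- move=> x _; rewrite /= lee_fin !normrM ler_wpM2r//.
  exact: (le_trans (fC _) (ler_norm _)).
- exact: integrableZl.
Qed.

Lemma integrable_scale d (T : measurableType d) (m : {measure set T -> \bar R})
    (c : R) (g : T -> R) : m.-integrable setT (EFin \o g) ->
  m.-integrable setT (EFin \o (fun x => c * g x)).
Proof. exact: integrableZl. Qed.

Lemma integrable_addr d (T : measurableType d) (m : {measure set T -> \bar R})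
    (f g : T -> R) : m.-integrable setT (EFin \o f) -> m.-integrable setT (EFin \o g) ->
  m.-integrable setT (EFin \o (fun x => f x + g x)).
Proof. by move=> fi gi; exact: (integrableD measurableT fi gi). Qed.

Lemma norm_cos_le1 (x : R) : `|cos x| <= 1.
Proof. by rewrite ler_norml cos_geN1 cos_le1. Qed.

Lemma norm_sin_le1 (x : R) : `|sin x| <= 1.
Proof. by rewrite ler_norml sin_geN1 sin_le1. Qed.

Lemma measurable_cosM (l : R) : measurable_fun [set: measurableTypeR R] (fun u : R => cos (l * u)).
Proof. by apply: continuous_measurable_fun; exact: continuous_cosM. Qed.

(** All positivity of the heat kernel comes from this formula. Read from right to left, it writes 1
    / (a^2 + l^2) as an average of cosines with nonnegative weight; read from left to right, it
    shows that the damping factor exp (- a |u|) has a nonnegative cosine transform. *)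
Lemma Rintegral_expRN_abs_cos (a l : R) : 0 < a ->
  \int[mu]_u (cos (l * u) * expR (- (a * `|u|))) = 2 * a / (a ^+ 2 + l ^+ 2).
Proof.
move=> a0.
have i1 := integrable_expRN_abs a0.
have i2 : mu.-integrable setT (EFin \o (fun u => cos (l * u) * expR (- (a * `|u|)))).
  apply: (@integrable_bddM _ _ _ _ _ 1) => //; first exact: measurable_cosM.
  by move=> x; exact: norm_cos_le1.
have := integral_expRN_abs_1cos l a0.
move=> /(congr1 fine) /=.
rewrite -/(Rintegral _ _ _).
under eq_Rintegral do rewrite mulrDr mulr1 [_ * cos _]mulrC.
rewrite RintegralD// {1}/Rintegral integral_expRN_abs//=.
by move/addrI.
Qed.

End LaplaceTransform.

(** * Fubini for real-valued integrals *)

Section ProductMeasure.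
Context {R : realType}.
Context d1 d2 (T1 : measurableType d1) (T2 : measurableType d2).
Variable m1 : {sigma_finite_measure set T1 -> \bar R}.
Variable m2 : {sigma_finite_measure set T2 -> \bar R}.

Lemma EFin_Rintegral d (T : measurableType d) (m : {measure set T -> \bar R}) (f : T -> R) :
  m.-integrable setT (EFin \o f) -> (\int[m]_x (f x)%:E)%E = (\int[m]_x f x)%:E.
Proof. by move=> h; rewrite /Rintegral fineK//; apply: integrable_fin_num. Qed.

Lemma Rintegral_Fubini (f : T1 * T2 -> R) :
  (m1 \x m2)%E.-integrable setT (EFin \o f) ->
  (forall x, m2.-integrable setT (EFin \o (fun y => f (x, y)))) ->
  (forall y, m1.-integrable setT (EFin \o (fun x => f (x, y)))) ->
  \int[m1]_x (\int[m2]_y f (x, y)) = \int[m2]_y (\int[m1]_x f (x, y)).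
Proof.
move=> f12 f2 f1; have := congr1 fine (Fubini f12).
have -> : (\int[m1]_x \int[m2]_y (EFin \o f) (x, y) =
           \int[m1]_x (\int[m2]_y f (x, y))%:E)%E.
  by apply: eq_integral => x _; exact: EFin_Rintegral (f2 _).
have -> // : (\int[m2]_y \int[m1]_x (EFin \o f) (x, y) =
           \int[m2]_y (\int[m1]_x f (x, y))%:E)%E.
by apply: eq_integral => x _; exact: EFin_Rintegral (f1 _).
Qed.

Lemma integrable_prodM (f : T1 -> R) (g : T2 -> R) :
  m1.-integrable setT (EFin \o f) -> m2.-integrable setT (EFin \o g) ->
  (m1 \x m2)%E.-integrable setT (EFin \o (fun z => f z.1 * g z.2)).
Proof.
move=> i1 i2.
have /measurable_EFinP mf := measurable_int _ i1.
have /measurable_EFinP mg := measurable_int _ i2.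
apply/integrable12ltyP.
  apply/measurable_EFinP/measurable_funM.
    exact: (measurableT_comp mf measurable_fst).
  exact: (measurableT_comp mg measurable_snd).
under eq_integral => x _.
  under eq_integral do rewrite /= normrM EFinM.
  rewrite ge0_integralZl//; last first.
    apply/measurable_EFinP; exact: measurableT_comp.
  over.
rewrite ge0_integralZr//; first 1 last.
- by apply/measurable_EFinP; exact: measurableT_comp.
- exact: integral_ge0.
have /integrableP[_ h1] := i1; have /integrableP[_ h2] := i2.
apply: lte_mul_pinfty => //; first exact: integral_ge0.
rewrite ge0_fin_numE//; exact: integral_ge0.
Qed.
End ProductMeasure.

Section PositiveDefiniteMultiplier.
Context {R : realType}.
Local Notation mu := (@lebesgue_measure R).
Local Notation RT := (measurableTypeR R).

Definition cos_transform_ge0 (g : R -> R) :=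
  mu.-integrable setT (EFin \o g) /\ forall z, 0 <= \int[mu]_u (cos (z * u) * g u).

(** Stating positivity as a preservation property makes a product of multipliers a composition, so
    that no convolution of transforms appears, and admits functions that are not integrable, such as
    constants. The bound on [m] keeps [m u * g u] integrable. *)
Definition ge0_multiplier (m : R -> R) := [/\ measurable_fun [set: RT] m,
  exists C, forall u, `|m u| <= C &
  forall g, cos_transform_ge0 g -> cos_transform_ge0 (fun u => m u * g u)].

Lemma integrable_cosM (z : R) (g : R -> R) : mu.-integrable setT (EFin \o g) ->
  mu.-integrable setT (EFin \o (fun u => cos (z * u) * g u)).
Proof.
move=> ig; apply: (integrable_bddM (C := 1)) => //; first exact: measurable_cosM.
by move=> x; exact: norm_cos_le1.
Qed.

Lemma ge0_multiplierP (m : R -> R) (C : R) : measurable_fun [set: RT] m ->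
  (forall u, `|m u| <= C) ->
  (forall g, cos_transform_ge0 g -> forall z, 0 <= \int[mu]_u (cos (z * u) * (m u * g u))) ->
  ge0_multiplier m.
Proof.
move=> mm mC h; split=> // [|g [ig g0]]; first by exists C.
split; first exact: (integrable_bddM mm mC ig).
exact: h.
Qed.

Lemma ge0_multiplier_cst (c : R) : 0 <= c -> ge0_multiplier (fun=> c).
Proof.
move=> c0; apply: (@ge0_multiplierP _ `|c|) => // g [ig g0] z.
under eq_Rintegral do rewrite mulrCA.
rewrite RintegralZl//; last exact: integrable_cosM.
by rewrite mulr_ge0.
Qed.

Lemma ge0_multiplierM (m1 m2 : R -> R) : ge0_multiplier m1 -> ge0_multiplier m2 ->
  ge0_multiplier (fun u => m1 u * m2 u).
Proof.
move=> [mm1 [C1 mC1] h1] [mm2 [C2 mC2] h2]; split.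
- exact: measurable_funM.
- exists (C1 * C2) => u; rewrite normrM ler_pM//.
- by move=> g /h2/h1; under eq_fun do rewrite mulrA.
Qed.

Lemma ge0_multiplierD (m1 m2 : R -> R) : ge0_multiplier m1 -> ge0_multiplier m2 ->
  ge0_multiplier (fun u => m1 u + m2 u).
Proof.
move=> [mm1 [C1 mC1] h1] [mm2 [C2 mC2] h2].
apply: (@ge0_multiplierP _ (C1 + C2)).
- exact: measurable_funD.
- move=> u; rewrite (le_trans (ler_normD _ _))// lerD//.
- move=> g gg z.
  have [i1 g1] := h1 _ gg; have [i2 g2] := h2 _ gg.
  under eq_Rintegral do rewrite mulrDl mulrDr.
  rewrite RintegralD//; [|exact: integrable_cosM..].
  by rewrite addr_ge0.
Qed.

Lemma ge0_multiplierX (m : R -> R) n : ge0_multiplier m ->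
  ge0_multiplier (fun u => m u ^+ n).
Proof.
move=> hm; elim: n => [|n ih].
  under eq_fun do rewrite expr0; exact: ge0_multiplier_cst.
under eq_fun do rewrite exprS; exact: ge0_multiplierM.
Qed.

Lemma ge0_multiplier_sum (m : nat -> R -> R) n : (forall k, ge0_multiplier (m k)) ->
  ge0_multiplier (fun u => \sum_(0 <= k < n) m k u).
Proof.
move=> hm; elim: n => [|n ih].
  under eq_fun do rewrite big_nil; exact: ge0_multiplier_cst.
under eq_fun do rewrite big_nat_recr//=; exact: ge0_multiplierD.
Qed.

Lemma ge0_multiplier_prod (m : nat -> R -> R) a n : (forall k, ge0_multiplier (m k)) ->
  ge0_multiplier (fun u => \prod_(a <= k < n) m k u).
Proof.
move=> hm; elim: n => [|n ih].
  under eq_fun do rewrite big_geq//; exact: ge0_multiplier_cst.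
have [an|na] := leqP a n.
  under eq_fun do rewrite big_nat_recr//=; exact: ge0_multiplierM.
under eq_fun do rewrite big_geq//; exact: ge0_multiplier_cst.
Qed.

(** Limits are needed only off 0: at u = 0 the quotient u / sinh u has the default value 0, whereas
    its approximants are equal to 1 there. *)
Lemma ae_neq0 (P : R -> Prop) : (forall u, u != 0 -> P u) ->
  {ae mu, forall u : RT, P u}.
Proof.
move=> h; exists [set 0]; split; [exact: measurable_set1|exact: lebesgue_measure_set1|].
by move=> u /= Pu; apply: contra_notP Pu => /eqP; exact: h.
Qed.

Lemma cvg_Rintegral_dominated (f_ : nat -> R -> R) (f g : R -> R) :
  (forall n, measurable_fun [set: RT] (f_ n)) -> measurable_fun [set: RT] f ->
  (forall u, u != 0 -> f_ n u @[n --> \oo] --> f u) ->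
  mu.-integrable setT (EFin \o g) ->
  (forall n u, u != 0 -> `|f_ n u| <= g u) ->
  \int[mu]_u f_ n u @[n --> \oo] --> \int[mu]_u f u.
Proof.
move=> mf_ mf ff ig fg.
have [] := @dominated_convergence _ _ R mu _ measurableT
  (fun n => EFin \o f_ n) (EFin \o f) (EFin \o g).
- by move=> n; apply/measurable_EFinP.
- by apply/measurable_EFinP.
- apply: ae_neq0 => u u0 _; apply: cvg_EFin; first exact: nearW.
  exact: ff.
- exact: ig.
- by apply: ae_neq0 => u u0 n _; rewrite lee_fin fg.
move=> intf _ h; apply: fine_cvg; rewrite fineK; first exact: h.
exact: integrable_fin_num intf.
Qed.

Lemma ge0_multiplier_lim (m_ : nat -> R -> R) (m : R -> R) (C : R) :
  (forall n, ge0_multiplier (m_ n)) -> (forall n u, `|m_ n u| <= C) ->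
  measurable_fun [set: RT] m -> (forall u, `|m u| <= C) ->
  (forall u, u != 0 -> m_ n u @[n --> \oo] --> m u) -> ge0_multiplier m.
Proof.
move=> hm mC mm mC' mlim; apply: (ge0_multiplierP mm mC') => g [ig g0] z.
have /measurable_EFinP mg := measurable_int _ ig.
have h : \int[mu]_u (cos (z * u) * (m_ n u * g u)) @[n --> \oo] -->
    \int[mu]_u (cos (z * u) * (m u * g u)); last first.
  apply: (cvgr_to_ge h).
  by apply: nearW => n; have [_ _ /(_ g)[]] := hm n.
apply: (@cvg_Rintegral_dominated _ _ (fun u => C * `|g u|)).
- move=> n; have [mmn _ _] := hm n.
  by apply: measurable_funM; [exact: measurable_cosM|exact: measurable_funM].
- by apply: measurable_funM; [exact: measurable_cosM|exact: measurable_funM].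
- move=> u u0; apply: cvgM; first exact: cvg_cst.
  by apply: cvgM; [exact: mlim|exact: cvg_cst].
- have : mu.-integrable setT (EFin \o (fun u => `|g u|)) by exact: integrable_norm.
  by move=> /(integrableZl measurableT C).
- move=> n u _; rewrite !normrM -[leRHS]mul1r ler_pM//; first exact: norm_cos_le1.
  by rewrite ler_wpM2r.
Qed.

Lemma measurable_Laplace (a : R) : 0 < a ->
  measurable_fun [set: RT] (fun u => (a ^+ 2 + u ^+ 2)^-1).
Proof.
move=> a0; apply: continuous_measurable_fun => u.
apply: cvgV; first by rewrite gt_eqF// ltr_wpDr ?sqr_ge0// exprn_gt0.
by apply: cvgD; [exact: cvg_cst|exact: exprn_continuous].
Qed.

(** The factor 1 / (a^2 + u^2) is an average over w of cos (u w), and cos (z u) cos (u w) is half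
    the sum of cos ((z + w) u) and cos ((z - w) u). After Fubini, the cosine transform of the
    product at z is thus an average of the transform of [g] at z + w and z - w. *)
Lemma ge0_multiplier_Laplace (a : R) : 0 < a ->
  ge0_multiplier (fun u => (a ^+ 2 + u ^+ 2)^-1).
Proof.
move=> a0.
have a2 u : 0 < a ^+ 2 + u ^+ 2 by rewrite ltr_wpDr ?sqr_ge0// exprn_gt0.
have mL := measurable_Laplace a0.
have bL u : `|(a ^+ 2 + u ^+ 2)^-1| <= (a ^+ 2)^-1.
  rewrite ger0_norm ?invr_ge0 ?(ltW (a2 _))//.
  by rewrite lef_pV2 ?posrE ?exprn_gt0// lerDl sqr_ge0.
apply: (ge0_multiplierP mL bL) => g gg z; have [ig g0] := gg.
have /measurable_EFinP mg := measurable_int _ ig.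
have ie := integrable_expRN_abs a0.
pose F := fun p : RT * RT => (cos (z * p.1) * cos (p.1 * p.2)) * (g p.1 * expR (- (a * `|p.2|))).
have mcc : measurable_fun [set: RT * RT] (fun p : RT * RT => cos (z * p.1) * cos (p.1 * p.2)).
  apply: measurable_funM.
    exact: (measurableT_comp (measurable_cosM z) measurable_fst).
  apply: (@measurableT_comp _ _ _ _ _ _ (@cos R) _ (fun p : RT * RT => p.1 * p.2)).
    by apply: continuous_measurable_fun; exact: continuous_cos.
  exact: measurable_funM.
have cc1 (x y : R) : `|cos x * cos y| <= 1.
  by rewrite normrM -(mulr1 1) ler_pM// norm_cos_le1.
have iF : (mu \x mu)%E.-integrable setT (EFin \o F).
  apply: (integrable_bddM mcc (fun p => cc1 (z * p.1) (p.1 * p.2))).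
  exact: (integrable_prodM ig ie).
have iF1 u : mu.-integrable setT (EFin \o (fun w => F (u, w))).
  rewrite (_ : (fun _ => _) = fun w => cos (z * u) * g u * (cos (u * w) * expR (- (a * `|w|)))); last first.
    by apply/funext => w; rewrite /F /=; ring.
  apply: integrable_scale; exact: integrable_cosM.
have iF2 w : mu.-integrable setT (EFin \o (fun u => F (u, w))).
  rewrite (_ : (fun _ => _) = fun u => expR (- (a * `|w|)) * (cos (z * u) * (cos (w * u) * g u))); last first.
    by apply/funext => u; rewrite /F /= (mulrC w u); ring.
  by apply: integrable_scale; do 2 apply: integrable_cosM.
have key : \int[mu]_u (\int[mu]_w F (u, w)) =
   2 * a * \int[mu]_u (cos (z * u) * ((a ^+ 2 + u ^+ 2)^-1 * g u)).
  rewrite -RintegralZl//; last exact: integrable_cosM (integrable_bddM mL bL ig).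
  apply: eq_Rintegral => u _.
  rewrite /F/=; under eq_Rintegral do rewrite mulrACA.
  rewrite RintegralZl//; last exact: integrable_cosM.
  by rewrite Rintegral_expRN_abs_cos//; field; rewrite !gt_eqF.
have {}key : \int[mu]_u (cos (z * u) * ((a ^+ 2 + u ^+ 2)^-1 * g u)) =
   (2 * a)^-1 * \int[mu]_u (\int[mu]_w F (u, w)).
  by rewrite key mulKf// gt_eqF// mulr_gt0.
rewrite key mulr_ge0// ?invr_ge0 ?mulr_ge0 ?(ltW a0)//.
rewrite Rintegral_Fubini//.
apply: Rintegral_ge0 => w _.
have -> : \int[mu]_u F (u, w) =
  expR (- (a * `|w|)) / 2 * (\int[mu]_u (cos ((z + w) * u) * g u) +
   \int[mu]_u (cos ((z - w) * u) * g u)).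
  rewrite -RintegralD//; [|exact: integrable_cosM..].
  rewrite -RintegralZl//; last first.
    by apply: integrable_addr; exact: integrable_cosM.
  apply: eq_Rintegral => u _.
  by rewrite /F/= mulrDl mulrBl cosD cosB (mulrC w u); field.
by rewrite mulr_ge0 ?addr_ge0// mulr_ge0 ?expR_ge0// invr_ge0.
Qed.
End PositiveDefiniteMultiplier.

(** * Discrete approximation of the heat weight *)

Section Pivot.
Context {R : realType}.

(* The pivots, inverted, of the tridiagonal matrix with diagonal 2 + s and
   off-diagonal entries -1. *)
Fixpoint pivot (s : R) k : R := if k is k'.+1 then (2 + s - pivot s k')^-1 else 0.

(** The upper bound is the value at s = 0, where the recursion is solved by k / (k + 1); increasing
    s only increases the denominators. *)
Lemma pivot_bounds (s : R) k : 0 <= s -> 0 <= pivot s k <= k%:R / k.+1%:R.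
Proof.
move=> s0; elim: k => [|k /andP[p0 p1]]; first by rewrite /= mul0r lexx.
have k1 : 0 < k.+1%:R :> R by [].
have k2 : 0 < k.+2%:R :> R by [].
have e : k.+2%:R / k.+1%:R <= 2 + s - pivot s k.
  have -> : k.+2%:R / k.+1%:R = 2 - k%:R / k.+1%:R :> R.
    have -> : k%:R = k.+1%:R - 1 :> R by rewrite -natr1 addrK.
    by rewrite -[k.+2%:R]natr1; field; rewrite gt_eqF.
  by rewrite lerB// lerDl.
have d0 : 0 < k.+2%:R / k.+1%:R :> R by rewrite divr_gt0.
have d1 := lt_le_trans d0 e.
rewrite /= invr_ge0 ltW//= -[leRHS]invrK invf_div lef_pV2//.
Qed.

Lemma pivot_ge0 (s : R) k : 0 <= s -> 0 <= pivot s k.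
Proof. by move=> /(pivot_bounds k)/andP[]. Qed.

Lemma pivot_le1 (s : R) k : 0 <= s -> pivot s k <= 1.
Proof.
move=> /(pivot_bounds k)/andP[_ /le_trans]; apply.
by rewrite ler_pdivrMr// mul1r ler_nat.
Qed.

(** The bounds k / (k + 1) telescope to 1 / (n + 1). *)
Lemma prod_pivot_bounds (s : R) n : 0 <= s ->
  0 <= n.+1%:R * \prod_(1 <= k < n.+1) pivot s k <= 1.
Proof.
move=> s0; elim: n => [|n /andP[p0 p1]]; first by rewrite big_geq// mulr1 ler01 lexx.
rewrite big_nat_recr//= -/(pivot s n.+1); have /andP[q0 q1] := pivot_bounds n.+1 s0.
have n1 : 0 < n.+1%:R :> R by [].
have n2 : 0 < n.+2%:R :> R by [].
have P0 : 0 <= \prod_(1 <= k < n.+1) pivot s k by rewrite -(pmulr_rge0 _ n1).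
rewrite !mulr_ge0//= (le_trans _ p1)//.
rewrite [leRHS]mulrC mulrCA ler_wpM2l//.
by rewrite mulrC -ler_pdivlMr.
Qed.

(** With nonnegative terms the partial sums increase to [m], so the bound on [m] dominates them
    all. *)
Lemma ge0_multiplier_series (c_ : nat -> R -> R) (m : R -> R) (C : R) :
  (forall k, ge0_multiplier (c_ k)) -> (forall k u, 0 <= c_ k u) ->
  (forall u, series (c_ ^~ u) n @[n --> \oo] --> m u) -> (forall u, m u <= C) ->
  ge0_multiplier m.
Proof.
move=> hc c0 cm mC.
have hs n : ge0_multiplier (fun u => series (c_ ^~ u) n).
  by rewrite /series/=; exact: ge0_multiplier_sum.
have s0 n u : 0 <= series (c_ ^~ u) n by exact: sumr_ge0.
have sm n u : series (c_ ^~ u) n <= m u.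
  rewrite -(cvg_lim (@Rhausdorff R) (cm u)); apply: nondecreasing_cvgn_le.
    by apply/nondecreasing_series => k _ _; exact: c0.
  by apply/cvg_ex; exists (m u).
have bC n u : `|series (c_ ^~ u) n| <= C.
  by rewrite ger0_norm// (le_trans (sm _ _)).
apply: (ge0_multiplier_lim hs bC) => //.
- apply: (measurable_fun_cvg (h := fun n u => series (c_ ^~ u) n)) => //.
  by move=> n; have [] := hs n.
- by move=> u; rewrite ger0_norm// (le_trans (s0 0%N u)).
Qed.

Lemma ge0_multiplier_expR (c : R) (m : R -> R) (C : R) : 0 <= c ->
  ge0_multiplier m -> (forall u, 0 <= m u <= C) ->
  ge0_multiplier (fun u => expR (c * m u)).
Proof.
move=> c0 hm mC.
apply: (@ge0_multiplier_series (fun k u => exp_coeff (c * m u) k) _ (expR (c * C))).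
- move=> k; rewrite /exp_coeff/=.
  under eq_fun do rewrite exprMn mulrAC.
  apply: ge0_multiplierM; last exact: ge0_multiplierX.
  by apply: ge0_multiplier_cst; rewrite divr_ge0// exprn_ge0.
- move=> k u; have /andP[m0 _] := mC u.
  by rewrite exp_coeff_ge0// mulr_ge0.
- by move=> u; exact: is_cvg_series_exp_coeff.
- by move=> u; have /andP[_ m1] := mC u; rewrite ler_expR ler_wpM2l.
Qed.

(** With phi = 1 / (2 + s), the next inverse pivot 1 / (2 + s - p) is phi / (1 - phi p), a geometric
    series with positive coefficients in the multipliers phi and p. Its ratio is at most 1/2,
    because phi <= 1/2 and p <= 1. *)
Lemma ge0_multiplier_pivot (N k : nat) : (0 < N)%N ->
  ge0_multiplier (fun u => pivot ((u / N%:R) ^+ 2) k).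
Proof.
move=> N0; elim: k => [|k ih] /=; first exact: ge0_multiplier_cst.
have N1 : 0 < N%:R :> R by rewrite ltr0n.
pose phi (u : R) := (2 + (u / N%:R) ^+ 2)^-1.
have phi0 u : 0 <= phi u by rewrite invr_ge0 addr_ge0// sqr_ge0.
have phi1 u : phi u <= 2^-1 by rewrite lef_pV2 ?posrE ?lerDl ?sqr_ge0// ltr_wpDr ?sqr_ge0.
have hphi : ge0_multiplier phi.
  (* Here 2 + u^2 / N^2 = ((sqrt 2 N)^2 + u^2) / N^2, so phi is a rescaled Laplace multiplier. *)
  have -> : phi = fun u => N%:R ^+ 2 * ((Num.sqrt 2 * N%:R) ^+ 2 + u ^+ 2)^-1.
    apply/funext => u; rewrite /phi [(Num.sqrt 2 * _) ^+ 2]exprMn sqr_sqrtr//.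
    field.
    by rewrite !gt_eqF// ltr_wpDr ?sqr_ge0// mulr_gt0// exprn_gt0.
  apply: ge0_multiplierM; first by apply: ge0_multiplier_cst; rewrite sqr_ge0.
  by apply: ge0_multiplier_Laplace; rewrite mulr_gt0// sqrtr_gt0.
have p0 u := pivot_ge0 k (sqr_ge0 (u / N%:R)).
have p1 u := pivot_le1 k (sqr_ge0 (u / N%:R)).
apply: (@ge0_multiplier_series (fun j u => geometric (phi u) (phi u * pivot ((u / N%:R) ^+ 2) k) j) _ 1).
- move=> j; rewrite /geometric/=; apply: ge0_multiplierM => //.
  by apply: ge0_multiplierX; exact: ge0_multiplierM.
- by move=> j u; rewrite /geometric /= mulr_ge0// exprn_ge0// mulr_ge0.
- move=> u; have -> : (2 + (u / N%:R) ^+ 2 - pivot ((u / N%:R) ^+ 2) k)^-1 =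
      phi u * (1 - phi u * pivot ((u / N%:R) ^+ 2) k)^-1.
    have d : 2 + (u / N%:R) ^+ 2 != 0 by rewrite gt_eqF// ltr_wpDr ?sqr_ge0.
    rewrite -invfM; congr (_^-1); rewrite /phi.
    by rewrite mulrBr mulr1 mulVKf.
  apply: cvg_geometric_series; rewrite ger0_norm ?mulr_ge0//.
  rewrite (le_lt_trans (ler_pM _ _ (phi1 u) (p1 u)))//.
  by rewrite mulr1 invf_lt1// ltr1n.
- move=> u; rewrite invf_le1//; have := p1 u; have := sqr_ge0 (u / N%:R); lra.
Qed.
End Pivot.

Section PivotLimit.
Context {R : realType}.

Lemma subr_inv_gt0 (A : R) : 1 < A -> 0 < A - A^-1.
Proof.
move=> A1; have A0 : 0 < A by rewrite (lt_trans _ A1).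
by rewrite subr_gt0 (lt_trans _ A1)// invf_lt1.
Qed.

(** For 2 + s = r + 1/r, the leading determinants satisfy D_(k+1) = (r + 1/r) D_k - D_(k-1), hence
    D_k = (r^(k+1) - r^-(k+1)) / (r - 1/r). An inverse pivot is the quotient D_(k-1) / D_k, and the
    product of the first n of them telescopes to 1 / D_n. *)
Lemma pivot_closed_form (r : R) k : 1 < r ->
  pivot (r + r^-1 - 2) k = (r ^+ k - r ^- k) / (r ^+ k.+1 - r ^- k.+1).
Proof.
move=> r1; have r0 : 0 < r by rewrite (lt_trans _ r1).
elim: k => [|k ih]; first by rewrite /= expr0 invr1 subrr mul0r.
have A1 : 1 < r ^+ k.+1 by rewrite exprn_egt1.
have A2 : 1 < r ^+ k.+2 by rewrite exprn_egt1.
have := subr_inv_gt0 A1; have := subr_inv_gt0 A2.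
rewrite /= ih [in r ^+ k.+2]exprS.
have -> : r ^+ k = r ^+ k.+1 / r by rewrite exprSr mulfK// gt_eqF.
have : r ^+ k.+1 != 0 by rewrite gt_eqF// (lt_trans _ A1).
move: (r ^+ k.+1) => A An0 D2 D1.
have r0' : r != 0 by rewrite gt_eqF.
rewrite -[RHS]invrK; congr (_^-1); rewrite invf_div.
have E1 : A ^+ 2 - 1 != 0.
  rewrite (_ : _ - _ = A * (A - A^-1)); last by field.
  by rewrite mulf_neq0// gt_eqF.
by rewrite [RHS]invf_div; field; rewrite r0' An0 -expr2 E1.
Qed.

Lemma prod_pivot_closed_form (r : R) n : 1 < r ->
  \prod_(1 <= k < n.+1) pivot (r + r^-1 - 2) k = (r - r^-1) / (r ^+ n.+1 - r ^- n.+1).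
Proof.
move=> r1; have D k : r ^+ k.+1 - r ^- k.+1 != 0.
  by rewrite gt_eqF// subr_inv_gt0// exprn_egt1.
elim: n => [|n ih]; first by rewrite big_geq// divff//; exact: (D 0%N).
rewrite big_nat_recr//= -/(pivot _ n.+1) ih pivot_closed_form//.
rewrite mulrA; congr (_ / _); rewrite mulfVK//.
Qed.

Section Limits.
Variable a : R.
Hypothesis a0 : 0 < a.
(** With N = n + 1, [rho n] is exp (arsinh (x n)), so that rho - 1/rho = 2 x = a / N. Its square r
    then satisfies r + 1/r - 2 = (a / N)^2, the parameter of the pivots. *)
Let x n : R := a / (2 * n.+1%:R).
Let q n : R := Num.sqrt (1 + x n ^+ 2).
Let rho n := q n + x n.

Let x0 n : 0 < x n. Proof. by rewrite /x divr_gt0// mulr_gt0. Qed.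
Let q1 n : 1 <= q n.
Proof. by rewrite /q -[leLHS]sqrtr1 ler_wsqrtr// lerDl sqr_ge0. Qed.
Let qsqr n : q n ^+ 2 = 1 + x n ^+ 2.
Proof. by rewrite sqr_sqrtr// addr_ge0// sqr_ge0. Qed.
Let rho1 n : 1 < rho n. Proof. by rewrite /rho ltr_pwDr. Qed.
Let rhoV n : (rho n)^-1 = q n - x n.
Proof.
apply: (@mulfI _ (rho n)); first by rewrite gt_eqF// (lt_trans _ (rho1 n)).
rewrite divff; last by rewrite gt_eqF// (lt_trans _ (rho1 n)).
by rewrite /rho mulrC -subr_sqr qsqr addrK.
Qed.

Let r n := rho n ^+ 2.
Let r1 n : 1 < r n. Proof. by rewrite exprn_egt1. Qed.
Let rE n : r n = 1 + 2 * x n ^+ 2 + 2 * x n * q n.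
Proof. by rewrite /r /rho sqrrD qsqr; ring. Qed.
Let rVE n : (r n)^-1 = 1 + 2 * x n ^+ 2 - 2 * x n * q n.
Proof. by rewrite /r -exprVn rhoV sqrrB qsqr; ring. Qed.
Let rs n : (a / n.+1%:R) ^+ 2 = r n + (r n)^-1 - 2.
Proof. by rewrite rVE rE /x; field; rewrite nat1r. Qed.

Let cx : x n @[n --> \oo] --> (0:R).
Proof.
have -> : x = fun n => a / 2 * harmonic n.
  by apply/funext => n; rewrite /x /harmonic/=; field; rewrite nat1r.
rewrite -[X in _ --> X](mulr0 (a / 2)).
by apply: cvgM; [exact: cvg_cst|exact: cvg_harmonic].
Qed.

Let cx2 : x n ^+ 2 @[n --> \oo] --> (0:R).
Proof. by rewrite -[X in _ --> X](mulr0 0); under eq_fun do rewrite expr2; apply: cvgM. Qed.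

Let cq : q n @[n --> \oo] --> (1:R).
Proof.
rewrite -[X in _ --> X]sqrtr1 -[X in _ --> Num.sqrt X]addr0.
apply: continuous_cvg; first exact: sqrt_continuous.
by apply: cvgD => //; exact: cvg_cst.
Qed.

(** The numerators of both limits are combinations of r - 1 and 1 - 1/r. Multiplied by N, each tends
    to a, because 2 N x = a and q tends to 1. *)
Let cr1 : n.+1%:R * (r n - 1) @[n --> \oo] --> a.
Proof.
have -> : (fun n => n.+1%:R * (r n - 1)) = fun n => a * (x n + q n).
  by apply/funext => n; rewrite rE /x; field; rewrite nat1r.
rewrite -[X in _ --> X]mulr1 -[X in _ * X]add0r.
by apply: cvgM; [exact: cvg_cst|apply: cvgD].
Qed.

Let crV : n.+1%:R * (1 - (r n)^-1) @[n --> \oo] --> a.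
Proof.
have -> : (fun n => n.+1%:R * (1 - (r n)^-1)) = fun n => a * (- x n + q n).
  by apply/funext => n; rewrite rVE /x; field; rewrite nat1r.
rewrite -[X in _ --> X]mulr1 -[X in _ * X]add0r -[X in X + _]oppr0.
by apply: cvgM; [exact: cvg_cst|apply: cvgD => //; exact: cvgN].
Qed.

(** Squeeze exp (x - x^2) <= rho <= exp (x + x^2) and raise it to the power 2 N: the exponents
    become a - a x and a + a x, and x tends to 0. *)
Let crN : r n ^+ n.+1 @[n --> \oo] --> expR a.
Proof.
have cexp (s : R) : expR (a + s * (a * x n)) @[n --> \oo] --> expR a.
  apply: continuous_cvg; first exact: continuous_expR.
  rewrite -[X in _ --> X]addr0 -(mulr0 s) -(mulr0 a).
  by apply: cvgD; [exact: cvg_cst|apply: cvgM; [exact: cvg_cst|apply: cvgM => //; exact: cvg_cst]].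
have e n (s : R) : expR (a + s * (a * x n)) = expR (x n + s * x n ^+ 2) ^+ (2 * n.+1).
  rewrite -expRM_natl; congr expR; rewrite natrM /x.
  by field; rewrite nat1r.
apply: (squeeze_cvgr _ (cexp (-1)) (cexp 1)).
apply: nearW => n; rewrite !e /r -exprM.
have h1 : expR (x n + (-1) * x n ^+ 2) <= rho n.
  have xn := x0 n.
  have h : 1 - x n + x n ^+ 2 <= expR (- (x n + -1 * x n ^+ 2)).
    by rewrite (le_trans _ (expR_ge1Dx _))// le_eqVlt; apply/orP; left; apply/eqP; ring.
  have d : 0 < 1 - x n + x n ^+ 2 by nra.
  rewrite -[expR _]invrK -expRN (@le_trans _ _ (1 - x n + x n ^+ 2)^-1)//.
    by rewrite lef_pV2 ?posrE ?expR_gt0.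
  rewrite (@le_trans _ _ (1 + x n))//; last by rewrite /rho lerD2r.
  (* This is (1 + x) (1 - x + x^2) = 1 + x^3 >= 1. *)
  by rewrite -div1r ler_pdivrMr//; nra.
have h2 : rho n <= expR (x n + 1 * x n ^+ 2).
  have hq : q n <= 1 + x n ^+ 2.
    by rewrite -qsqr expr2 ler_peMr// (le_trans _ (q1 n)).
  by rewrite (le_trans _ (expR_ge1Dx _))// mul1r /rho [x n + _ in leRHS]addrC addrA lerD2r.
have rn : rho n \in Num.nneg by rewrite nnegrE ltW// (lt_trans _ (rho1 n)).
by apply/andP; split; apply: lerXn2r => //; rewrite nnegrE expR_ge0.
Qed.

Let crD : r n ^+ n.+1 - r n ^- n.+1 @[n --> \oo] --> expR a - expR (- a).
Proof.
rewrite expRN; apply: cvgB => //; apply: cvgV => //.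
by rewrite gt_eqF// expR_gt0.
Qed.

Let Ea : expR a - expR (- a) != 0.
Proof. by rewrite expRN gt_eqF// subr_inv_gt0// expR_gt1. Qed.

Lemma cvg_prod_pivot :
  n.+1%:R * \prod_(1 <= k < n.+1) pivot ((a / n.+1%:R) ^+ 2) k @[n --> \oo] -->
  a / sinh a.
Proof.
under eq_fun do rewrite rs prod_pivot_closed_form//.
have -> : a / sinh a = (a + a) / (expR a - expR (- a)) by rewrite /sinh; field.
rewrite (_ : (fun _ => _) = fun n => (n.+1%:R * (r n - 1) + n.+1%:R * (1 - (r n)^-1)) /
  (r n ^+ n.+1 - r n ^- n.+1)); last first.
  by apply/funext => n; rewrite -mulrDr addrA subrK mulrA.
by apply: cvgM; [exact: cvgD|apply: cvgV].
Qed.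

Lemma cvg_last_pivot :
  n.+1%:R * (1 - pivot ((a / n.+1%:R) ^+ 2) n) @[n --> \oo] --> a * coth a.
Proof.
under eq_fun do rewrite rs pivot_closed_form//.
have -> : a * coth a = (expR a * a + expR (- a) * a) / (expR a - expR (- a)).
  by rewrite /coth /cosh /sinh; field.
(* The numerator of 1 - p_n is r^N - r^-N - r^(N-1) + r^-(N-1), regrouped as r^N (1 - 1/r) + r^-N (r
   - 1). *)
rewrite (_ : (fun _ => _) = fun n => (r n ^+ n.+1 * (n.+1%:R * (1 - (r n)^-1)) +
  r n ^- n.+1 * (n.+1%:R * (r n - 1))) / (r n ^+ n.+1 - r n ^- n.+1)); last first.
  apply/funext => n.
  have : r n ^+ n.+1 - r n ^- n.+1 != 0 by rewrite gt_eqF// subr_inv_gt0// exprn_egt1.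
  have r0 : r n != 0 by rewrite gt_eqF// (lt_trans _ (r1 n)).
  have : r n ^+ n != 0 by rewrite expf_eq0 (negbTE r0) andbF.
  rewrite !exprS; move: (r n ^+ n) r0 => A r0 A0 D.
  have D' : (r n * A) ^+ 2 - 1 != 0.
    rewrite (_ : _ - _ = r n * A * (r n * A - (r n * A)^-1)).
      by apply: mulf_neq0 => //; apply: mulf_neq0.
    by field; rewrite r0 A0.
  by field; rewrite r0 A0 -expr2 D'.
apply: cvgM; last exact: cvgV.
apply: cvgD; apply: cvgM => //; rewrite expRN; apply: cvgV => //.
by rewrite gt_eqF// expR_gt0.
Qed.
End Limits.

Lemma sinhN (u : R) : sinh (- u) = - sinh u.
Proof. by rewrite /sinh opprK -mulNr opprB. Qed.

Lemma coshN (u : R) : cosh (- u) = cosh u.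
Proof. by rewrite /cosh opprK addrC. Qed.

Lemma cvg_prod_pivot_neq0 (u : R) : u != 0 ->
  n.+1%:R * \prod_(1 <= k < n.+1) pivot ((u / n.+1%:R) ^+ 2) k @[n --> \oo] -->
  u / sinh u.
Proof.
move=> u0; have [un|] := ltP u 0; last first.
  by rewrite le_eqVlt eq_sym (negbTE u0)/=; exact: cvg_prod_pivot.
under eq_fun do rewrite -sqrrN -mulNr.
by rewrite -[u / _]mulrNN -invrN -sinhN; apply: cvg_prod_pivot; rewrite oppr_gt0.
Qed.

Lemma cvg_last_pivot_neq0 (u : R) : u != 0 ->
  n.+1%:R * (1 - pivot ((u / n.+1%:R) ^+ 2) n) @[n --> \oo] --> u * coth u.
Proof.
move=> u0; have [un|] := ltP u 0; last first.
  by rewrite le_eqVlt eq_sym (negbTE u0)/=; exact: cvg_last_pivot.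
under eq_fun do rewrite -sqrrN -mulNr.
rewrite (_ : u * coth u = (- u) * coth (- u)); last first.
  by rewrite /coth sinhN coshN invrN mulrN mulrNN.
by apply: cvg_last_pivot; rewrite oppr_gt0.
Qed.
End PivotLimit.

(** * The heat weight and its cosine transform *)

Section HeatWeight.
Context {R : realType}.
Local Notation mu := (@lebesgue_measure R).
Local Notation RT := (measurableTypeR R).

Definition sinhw (u : R) := u / sinh u.
Definition cothw (u : R) := u * coth u.

Lemma sinhw0 : sinhw 0 = 0. Proof. by rewrite /sinhw mul0r. Qed.
Lemma cothw0 : cothw 0 = 0. Proof. by rewrite /cothw mul0r. Qed.

Lemma sinhwN (u : R) : sinhw (- u) = sinhw u.
Proof. by rewrite /sinhw sinhN invrN mulrNN. Qed.

Lemma cothwN (u : R) : cothw (- u) = cothw u.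
Proof. by rewrite /cothw /coth sinhN coshN invrN mulrN mulrNN. Qed.

Lemma sinh_gt0 (u : R) : 0 < u -> 0 < sinh u.
Proof.
by move=> u0; rewrite /sinh divr_gt0// subr_gt0 ltr_expR gtrN.
Qed.

Lemma sinhw_abs (u : R) : sinhw u = sinhw `|u|.
Proof. by have [u0|u0] := leP 0 u; [rewrite ger0_norm|rewrite ltr0_norm// sinhwN]. Qed.

Lemma cothw_abs (u : R) : cothw u = cothw `|u|.
Proof. by have [u0|u0] := leP 0 u; [rewrite ger0_norm|rewrite ltr0_norm// cothwN]. Qed.

Lemma sinhw_ge0 (u : R) : 0 <= sinhw u.
Proof.
rewrite sinhw_abs; have [->|u0] := eqVneq u 0; first by rewrite normr0 sinhw0.
by rewrite /sinhw divr_ge0// ltW// sinh_gt0// normr_gt0.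
Qed.

(** The discrete bound of [prod_pivot_bounds] passes to the limit. In the same way p_n <= n / (n +
    1), that is, (n + 1) (1 - p_n) >= 1, yields [cothw_ge1]. *)
Lemma sinhw_le1 (u : R) : sinhw u <= 1.
Proof.
have [->|u0] := eqVneq u 0; first by rewrite sinhw0.
apply: (cvgr_to_le (cvg_prod_pivot_neq0 u0)); apply: nearW => n.
by have /andP[] := prod_pivot_bounds n (sqr_ge0 (u / n.+1%:R)).
Qed.

Lemma cothw_ge1 (u : R) : u != 0 -> 1 <= cothw u.
Proof.
move=> u0; apply: (cvgr_to_ge (cvg_last_pivot_neq0 u0)); apply: nearW => n.
have /andP[_ pn] := pivot_bounds n (sqr_ge0 (u / n.+1%:R)).
rewrite mulrBr mulr1 lerBrDl -lerBrDr -natr1 addrK natr1.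
by rewrite mulrC -ler_pdivlMr.
Qed.

Lemma cothw_ge0 (u : R) : 0 <= cothw u.
Proof.
have [->|u0] := eqVneq u 0; first by rewrite cothw0.
by rewrite (le_trans _ (cothw_ge1 u0)).
Qed.

(** For u > 0 this amounts to (1 + 2 u) exp (- u) <= exp u, an instance of 1 + 2 u <= exp (2 u). *)
Lemma cothw_le (u : R) : cothw u <= 1 + `|u|.
Proof.
rewrite cothw_abs; have [->|u0] := eqVneq u 0; first by rewrite normr0 cothw0 addr0.
have : 0 < `|u| by rewrite normr_gt0.
move: `|u| => {u0} u u0; rewrite /cothw /coth.
have s0 := sinh_gt0 u0.
rewrite mulrA ler_pdivrMr//.
have e1 : 1 + 2 * u <= expR u ^+ 2.
  by rewrite -expRM_natl; exact: expR_ge1Dx.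
have e2 : expR (- u) * expR u = 1 by rewrite expRN mulVf// gt_eqF// expR_gt0.
have e0 := expR_gt0 (- u).
have : expR (- u) * (1 + 2 * u) <= expR u.
  apply: (le_trans (ler_wpM2l (ltW e0) e1)).
  by rewrite expr2 mulrA e2 mul1r.
rewrite /cosh /sinh; lra.
Qed.

(** With e = exp (u / 2) the claim reads u e^3 <= 2 (e^4 - 1). It follows from u <= 2 (e - 1) and
    the factorisation of e^4 - 1. *)
Lemma sinhw_le_exp (u : R) : sinhw u <= 4 * expR (- (2^-1 * `|u|)).
Proof.
rewrite sinhw_abs; have [->|u0] := eqVneq u 0.
  by rewrite normr0 sinhw0 mulr0 oppr0 expR0 mulr1.
have : 0 < `|u| by rewrite normr_gt0.
move: `|u| => {u0} u u0; rewrite /sinhw ler_pdivrMr ?sinh_gt0//.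
pose e := expR (2^-1 * u).
have e0 : 0 < e by exact: expR_gt0.
have e1 : 1 + 2^-1 * u <= e by exact: expR_ge1Dx.
have -> : sinh u = (e ^+ 2 - e ^- 2) / 2.
  by rewrite /sinh /e expRN -expRM_natl mulrA divff// mul1r.
rewrite expRN -/e.
have -> : 4 * e^-1 * ((e ^+ 2 - e ^- 2) / 2) = 2 * (e ^+ 4 - 1) / e ^+ 3.
  by field; rewrite gt_eqF.
rewrite ler_pdivlMr ?exprn_gt0//.
have e2 : 1 < e by lra.
have h1 : u <= 2 * (e - 1) by lra.
have h2 : u * e ^+ 3 <= 2 * (e - 1) * e ^+ 3 by rewrite ler_wpM2r// exprn_ge0// ltW.
have -> : e ^+ 4 - 1 = (e - 1) * (e ^+ 3 + e ^+ 2 + e + 1) by ring.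
apply: (le_trans h2); rewrite -mulrA ler_wpM2l// ler_wpM2l//; first lra.
have : 0 <= e ^+ 2 by exact: sqr_ge0.
move: (e ^+ 2) (e ^+ 3) => a b; lra.
Qed.

(** Dominates the weight together with a factor 1 + |u|, which pays for one derivative of the
    kernel: u in the vertical direction, u coth u in a horizontal one. The 16 is 4 from
    [sinhw_le_exp] times 4 from 1 + |u| <= 4 exp (|u| / 4). *)
Definition heat_majorant (u : R) := 16 * expR (- (4^-1 * `|u|)).

Lemma integrable_heat_majorant : mu.-integrable setT (EFin \o heat_majorant).
Proof. by apply: integrable_scale; apply: integrable_expRN_abs. Qed.

Lemma sinhw_majorant (u : R) : (1 + `|u|) * sinhw u <= heat_majorant u.
Proof.
have h1 : 1 + 4^-1 * `|u| <= expR (4^-1 * `|u|) := expR_ge1Dx _.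
have h2 : 1 + `|u| <= 4 * expR (4^-1 * `|u|).
  have := normr_ge0 u; lra.
apply: (le_trans (ler_pM _ _ h2 (sinhw_le_exp u))); rewrite ?sinhw_ge0 ?addr_ge0//.
rewrite mulrACA -expRD /heat_majorant.
have -> : 4^-1 * `|u| + - (2^-1 * `|u|) = - (4^-1 * `|u|) by field.
by rewrite -natrM.
Qed.

(** The approximants x / (x^2 + 1/(n+1)) are continuous and vanish at 0, so their limit respects the
    convention that the inverse of 0 is 0. *)
Lemma measurable_invr : measurable_fun [set: RT] (@GRing.inv R : RT -> R).
Proof.
pose f_ n (x : R) := x / (x ^+ 2 + n.+1%:R^-1).
have d n (x : R) : 0 < x ^+ 2 + n.+1%:R^-1 by rewrite ltr_wpDl ?sqr_ge0// invr_gt0.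
apply: (@measurable_fun_cvg _ _ _ _ f_) => [n|x _].
  apply: continuous_measurable_fun => x; apply: cvgM; first exact: cvg_id.
  apply: cvgV; first by rewrite gt_eqF.
  by apply: cvgD; [exact: exprn_continuous|exact: cvg_cst].
have [->|x0] := eqVneq x 0.
  by rewrite invr0 /f_; under eq_fun do rewrite mul0r; exact: cvg_cst.
rewrite (_ : x^-1 = x / (x ^+ 2 + 0)); last by rewrite addr0; field.
apply: cvgM; first exact: cvg_cst.
apply: cvgV; first by rewrite addr0 expf_neq0.
by apply: cvgD; [exact: cvg_cst|exact: cvg_harmonic].
Qed.

Lemma continuous_expRN : continuous (fun u : R => expR (- u)).
Proof.
move=> u; apply: continuous_comp; first exact: opp_continuous.
exact: continuous_expR.
Qed.

Lemma measurable_sinh : measurable_fun [set: RT] (@sinh R).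
Proof.
apply: continuous_measurable_fun => u; rewrite /sinh.
apply: cvgM; last exact: cvg_cst.
by apply: cvgB; [exact: continuous_expR|exact: continuous_expRN].
Qed.

Lemma measurable_cosh : measurable_fun [set: RT] (@cosh R).
Proof.
apply: continuous_measurable_fun => u; rewrite /cosh.
apply: cvgM; last exact: cvg_cst.
by apply: cvgD; [exact: continuous_expR|exact: continuous_expRN].
Qed.

Lemma measurable_sinhw : measurable_fun [set: RT] sinhw.
Proof.
apply: measurable_funM; first exact: measurable_id.
exact: measurableT_comp measurable_invr measurable_sinh.
Qed.

Lemma measurable_cothw : measurable_fun [set: RT] cothw.
Proof.
apply: measurable_funM; first exact: measurable_id.
apply: measurable_funM; first exact: measurable_cosh.
exact: measurableT_comp measurable_invr measurable_sinh.
Qed.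

(** The parameter [c] stands for r^2 / 4; up to a positive constant, [h] is the cosine transform of
    this weight. *)
Definition heat_weight (c u : R) := sinhw u * expR (- (c * cothw u)).

Lemma measurable_heat_weight c : measurable_fun [set: RT] (heat_weight c).
Proof.
apply: measurable_funM; first exact: measurable_sinhw.
apply: measurableT_comp; first exact: measurable_expR.
apply: measurable_funN; apply: measurable_funM; last exact: measurable_cothw.
exact: measurable_cst.
Qed.

Lemma heat_weight_ge0 c u : 0 <= heat_weight c u.
Proof. by rewrite mulr_ge0 ?expR_ge0 ?sinhw_ge0. Qed.

Lemma heat_weight_le_exp c u : 0 <= c -> heat_weight c u <= expR (- c).
Proof.
move=> c0; have [->|u0] := eqVneq u 0.
  by rewrite /heat_weight sinhw0 mul0r expR_ge0.
rewrite /heat_weight -[leRHS]mul1r ler_pM ?sinhw_ge0 ?expR_ge0 ?sinhw_le1//.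
by rewrite ler_expR lerN2 -[leLHS]mulr1 ler_wpM2l// cothw_ge1.
Qed.

Lemma heat_weight_le_sinhw c u : 0 <= c -> heat_weight c u <= sinhw u.
Proof.
move=> c0; rewrite /heat_weight -[leRHS]mulr1 ler_wpM2l ?sinhw_ge0//.
by rewrite -expR0 ler_expR oppr_le0 mulr_ge0// cothw_ge0.
Qed.

Lemma heat_weight_majorant c u : 0 <= c -> (1 + `|u|) * heat_weight c u <= heat_majorant u.
Proof.
move=> c0; apply: le_trans (sinhw_majorant u).
by rewrite ler_wpM2l ?heat_weight_le_sinhw// addr_ge0.
Qed.

Lemma heat_weight_le_majorant c u : 0 <= c -> heat_weight c u <= heat_majorant u.
Proof.
move=> c0; apply: le_trans (heat_weight_majorant u c0).
by rewrite ler_peMl ?heat_weight_ge0// lerDl.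
Qed.

Lemma integrable_heat_weight c : 0 <= c -> mu.-integrable setT (EFin \o heat_weight c).
Proof.
move=> c0; apply: (le_integrable _ _ _ integrable_heat_majorant) => //.
  by apply/measurable_EFinP; exact: measurable_heat_weight.
move=> u _ /=; rewrite lee_fin ger0_norm ?heat_weight_ge0//.
by rewrite (le_trans (heat_weight_le_majorant _ c0))// ler_norm.
Qed.

Lemma ge0_multiplier_heat_weight c : 0 <= c -> ge0_multiplier (heat_weight c).
Proof.
move=> c0.
pose P n u := n.+1%:R * \prod_(1 <= k < n.+1) pivot ((u / n.+1%:R) ^+ 2) k : R.
(* The exponent - c N (1 - p) has the wrong sign for a power series with nonnegative coefficients.
   Splitting off the constant exp (- c N) leaves exp (c N p), which [ge0_multiplier_expR] covers. *)
pose E n u := expR (- (c * n.+1%:R)) * expR (c * n.+1%:R * pivot ((u / n.+1%:R) ^+ 2) n) : R.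
have EE n u : E n u = expR (- (c * (n.+1%:R * (1 - pivot ((u / n.+1%:R) ^+ 2) n)))).
  by rewrite /E -expRD; congr expR; ring.
have E1 n u : 0 <= E n u <= 1.
  rewrite EE expR_ge0/= -[leRHS]expR0 ler_expR oppr_le0 mulr_ge0// mulr_ge0//.
  by rewrite subr_ge0 pivot_le1// sqr_ge0.
have P1 n (u : R) : 0 <= P n u <= 1.
  by apply: prod_pivot_bounds; exact: sqr_ge0.
apply: (@ge0_multiplier_lim _ (fun n u => P n u * E n u) _ 1).
- move=> n; apply: ge0_multiplierM; apply: ge0_multiplierM.
  + exact: ge0_multiplier_cst.
  + by apply: ge0_multiplier_prod => k; exact: ge0_multiplier_pivot.
  + by apply: ge0_multiplier_cst; exact: expR_ge0.
  + apply: (@ge0_multiplier_expR _ _ _ 1); first by rewrite mulr_ge0.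
      exact: ge0_multiplier_pivot.
    by move=> u; rewrite pivot_ge0 ?pivot_le1// sqr_ge0.
- move=> n u; have /andP[p0 p1] := P1 n u; have /andP[e0 e1] := E1 n u.
  by rewrite (ger0_norm (mulr_ge0 p0 e0)) mulr_ile1.
- exact: measurable_heat_weight.
- move=> u; rewrite ger0_norm ?heat_weight_ge0// (le_trans (heat_weight_le_sinhw u c0))//.
  exact: sinhw_le1.
- move=> u u0; apply: cvgM; first exact: cvg_prod_pivot_neq0.
  under eq_fun do rewrite EE.
  apply: continuous_cvg; first exact: continuous_expR.
  apply: cvgN; apply: cvgM; first exact: cvg_cst.
  exact: cvg_last_pivot_neq0.
Qed.

Definition heat_int (c z : R) := \int[mu]_u (cos (z * u) * heat_weight c u).

Lemma heat_int_ge0 c z : 0 <= c -> 0 <= heat_int c z.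
Proof.
move=> c0; rewrite /heat_int.
(* The weight is the multiplier applied to the constant 1, which is not integrable. The constant is
   therefore approximated by exp (- |u| / (n + 1)), whose cosine transform is nonnegative. *)
pose e (n : nat) (u : R) : R := expR (- (n.+1%:R^-1 * `|u|)).
have ce n : cos_transform_ge0 (e n).
  have n0 : 0 < n.+1%:R^-1 :> R by rewrite invr_gt0.
  split; first exact: integrable_expRN_abs.
  move=> z'; rewrite Rintegral_expRN_abs_cos// divr_ge0 ?mulr_ge0//.
  by rewrite addr_ge0// sqr_ge0.
have h : \int[mu]_u (cos (z * u) * (heat_weight c u * e n u)) @[n --> \oo] -->
    \int[mu]_u (cos (z * u) * heat_weight c u).
  apply: (@cvg_Rintegral_dominated _ _ _ (heat_weight c)).
  - move=> n; apply: measurable_funM; first exact: measurable_cosM.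
    apply: measurable_funM; first exact: measurable_heat_weight.
    by apply: continuous_measurable_fun; exact: continuous_expRN_abs.
  - apply: measurable_funM; first exact: measurable_cosM.
    exact: measurable_heat_weight.
  - move=> u u0; apply: cvgM; first exact: cvg_cst.
    rewrite -[X in _ --> X]mulr1; apply: cvgM; first exact: cvg_cst.
    rewrite -expR0; apply: continuous_cvg; first exact: continuous_expR.
    rewrite -oppr0 -(mul0r `|u|); apply: cvgN; apply: cvgM; last exact: cvg_cst.
    exact: cvg_harmonic.
  - exact: integrable_heat_weight.
  - move=> n u _; have w0 := heat_weight_ge0 c u.
    have e0 : 0 <= e n u by exact: expR_ge0.
    rewrite normrM -[leRHS]mul1r ler_pM ?norm_cos_le1//.
    rewrite (ger0_norm (mulr_ge0 w0 e0)) ler_piMr//.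
    by rewrite -[leRHS]expR0 ler_expR oppr_le0 mulr_ge0.
apply: (cvgr_to_ge h); apply: nearW => n.
by have [_ _ /(_ _ (ce n))[]] := ge0_multiplier_heat_weight c0.
Qed.

End HeatWeight.

Section ParametricIntegral.
Context {R : realType}.
Context d1 d2 (T1 : measurableType d1) (T2 : measurableType d2).
Variable m2 : {sigma_finite_measure set T2 -> \bar R}.

(** Tonelli gives measurability in the parameter for nonnegative integrands only. Adding the
    dominating function [D] makes the integrand nonnegative, and the integral of [D] is subtracted
    afterwards. *)
Lemma measurable_Rintegral_param (f : T1 * T2 -> R) (D : T2 -> R) :
  measurable_fun setT f -> m2.-integrable setT (EFin \o D) ->
  (forall x y, `|f (x, y)| <= D y) ->
  measurable_fun setT (fun x => \int[m2]_y f (x, y)).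
Proof.
move=> mf iD fD.
have /measurable_EFinP mD := measurable_int _ iD.
have fx x : m2.-integrable setT (EFin \o (fun y => f (x, y))).
  apply: (le_integrable _ _ _ iD) => //.
    by apply/measurable_EFinP; apply: measurableT_comp => //; exact: measurable_pair1.
  by move=> y _ /=; rewrite lee_fin (le_trans (fD _ _))// ler_norm.
have -> : (fun x => \int[m2]_y f (x, y)) =
    fun x => fine (\int[m2]_y (f (x, y) + D y)%:E)%E - \int[m2]_y D y.
  apply/funext => x; rewrite -/(Rintegral _ _ _) RintegralD//.
  by rewrite addrK.
apply: measurable_funB; last exact: measurable_cst.
apply: (measurableT_comp (@fine_measurable R setT measurableT)).
apply: (measurable_fun_fubini_tonelli_F (fun p : T1 * T2 => (f p + D p.2)%:E)).
- apply/measurable_EFinP; apply: measurable_funD => //.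
  exact: (measurableT_comp mD measurable_snd).
- move=> [x y]; rewrite lee_fin /=.
  have := fD x y; rewrite ler_norml => /andP[h _].
  by rewrite -lerBlDr sub0r.
Qed.
End ParametricIntegral.

(** * Total mass in the vertical variable *)

Section HeatIntegralMass.
Context {R : realType}.
Local Notation mu := (@lebesgue_measure R).
Local Notation RT := (measurableTypeR R).

Lemma integral_Cauchy (e : R) : 0 < e ->
  (\int[mu]_u (2 * e / (e ^+ 2 + u ^+ 2))%:E = (2 * pi)%:E)%E.
Proof.
move=> e0.
have d u : 0 < e ^+ 2 + u ^+ 2 by rewrite ltr_wpDr ?sqr_ge0// exprn_gt0.
pose F (u : R) := 2 * atan (u / e).
transitivity ((2 * (pi - F 0))%:E)%E; last by rewrite /F mul0r atan0 mulr0 subr0.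
apply: integralT_even.
- by move=> u; rewrite divr_ge0 ?(ltW (d _))// mulr_ge0// ltW.
- by move=> u /=; rewrite sqrrN.
- move=> u; apply: cvgM; first exact: cvg_cst.
  apply: cvgV; first by rewrite gt_eqF.
  by apply: cvgD; [exact: cvg_cst|exact: exprn_continuous].
- move=> u; apply: is_derive_eq.
  rewrite /GRing.scale/=; field.
  by rewrite gt_eqF// gt_eqF.
- rewrite (_ : pi = 2 * (pi / 2)); last by field.
  apply: cvgM; first exact: cvg_cst.
  apply: cvg_comp; last exact: cvgy_atan.
  apply/cvgryPge => A; near=> u.
  by rewrite ler_pdivlMr//; near: u; apply: nbhs_pinfty_ge; rewrite num_real.
Unshelve. all: by end_near.
Qed.

Lemma measurable_heat_int c : 0 <= c -> measurable_fun [set: RT] (heat_int c).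
Proof.
move=> c0.
apply: (@measurable_Rintegral_param _ _ _ _ _ mu (fun p : RT * RT => cos (p.1 * p.2) * heat_weight c p.2) heat_majorant).
- apply: measurable_funM; last exact: (measurableT_comp (measurable_heat_weight c) measurable_snd).
  apply: (@measurableT_comp _ _ _ _ _ _ (@cos R) _ (fun p : RT * RT => p.1 * p.2)).
    by apply: continuous_measurable_fun; exact: continuous_cos.
  exact: measurable_funM.
- exact: integrable_heat_majorant.
- move=> z u /=; rewrite normrM -[leRHS]mul1r ler_pM ?norm_cos_le1//.
  by rewrite ger0_norm ?heat_weight_ge0// heat_weight_le_majorant.
Qed.

(** Half of Fourier inversion at 0: damping in z and Fubini turn the left side into the integral of
    the weight against the Cauchy kernel 2 e / (e^2 + u^2), which has mass 2 pi, while the weight is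
    at most exp (- c). *)
Lemma integral_heat_int_expRN c e : 0 <= c -> 0 < e ->
  (\int[mu]_z (heat_int c z * expR (- (e * `|z|)))%:E <= (2 * pi * expR (- c))%:E)%E.
Proof.
move=> c0 e0.
have iw := @integrable_heat_weight R c c0.
have ie := integrable_expRN_abs e0.
pose F := fun p : RT * RT => cos (p.1 * p.2) * (expR (- (e * `|p.1|)) * heat_weight c p.2).
have mcc : measurable_fun [set: RT * RT] (fun p : RT * RT => cos (p.1 * p.2)).
  apply: (@measurableT_comp _ _ _ _ _ _ (@cos R) _ (fun p : RT * RT => p.1 * p.2)).
    by apply: continuous_measurable_fun; exact: continuous_cos.
  exact: measurable_funM.
have iF : (mu \x mu)%E.-integrable setT (EFin \o F).
  apply: (integrable_bddM mcc (fun p => norm_cos_le1 (p.1 * p.2))).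
  exact: (integrable_prodM ie iw).
have iF1 z : mu.-integrable setT (EFin \o (fun u => F (z, u))).
  rewrite (_ : (fun _ => _) = fun u => expR (- (e * `|z|)) * (cos (z * u) * heat_weight c u)); last first.
    by apply/funext => w; rewrite /F /=; ring.
  by apply: integrable_scale; exact: integrable_cosM.
have iF2 u : mu.-integrable setT (EFin \o (fun z => F (z, u))).
  rewrite (_ : (fun _ => _) = fun z => heat_weight c u * (cos (u * z) * expR (- (e * `|z|)))); last first.
    by apply/funext => z; rewrite /F /= (mulrC z u); ring.
  by apply: integrable_scale; exact: integrable_cosM.
have e1 z : heat_int c z * expR (- (e * `|z|)) = \int[mu]_u F (z, u).
  rewrite /heat_int -RintegralZr//; last exact: integrable_cosM.
  by apply: eq_Rintegral => u _; rewrite /F/=; ring.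
have e2 u : \int[mu]_z F (z, u) = heat_weight c u * (2 * e / (e ^+ 2 + u ^+ 2)).
  rewrite -(Rintegral_expRN_abs_cos _ e0) -RintegralZl//; last exact: integrable_cosM.
  by apply: eq_Rintegral => z _; rewrite /F/= (mulrC z u); ring.
under eq_integral do rewrite e1 -(EFin_Rintegral (iF1 _)).
rewrite (Fubini iF)/=.
under eq_integral do rewrite (EFin_Rintegral (iF2 _)) e2.
have q0 u : 0 <= 2 * e / (e ^+ 2 + u ^+ 2).
  by rewrite divr_ge0 ?mulr_ge0 ?addr_ge0 ?sqr_ge0// ltW.
have mq : measurable_fun [set: RT] (fun u => 2 * e / (e ^+ 2 + u ^+ 2)).
  by apply: measurable_funM; [exact: measurable_cst|exact: measurable_Laplace].
have -> : ((2 * pi * expR (- c))%:E =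
    \int[mu]_u (expR (- c) * (2 * e / (e ^+ 2 + u ^+ 2)))%:E)%E.
  under eq_integral do rewrite EFinM.
  rewrite ge0_integralZl_EFin ?expR_ge0//; last exact/measurable_EFinP.
    by rewrite integral_Cauchy// -EFinM mulrC.
  by move=> u _; rewrite lee_fin.
apply: ge0_le_integral => //.
- by move=> u _; rewrite lee_fin mulr_ge0 ?heat_weight_ge0.
- by apply/measurable_EFinP; apply: measurable_funM; first exact: measurable_heat_weight.
- by apply/measurable_EFinP; apply: measurable_funM; first exact: measurable_cst.
- by move=> u _; rewrite lee_fin ler_wpM2r// heat_weight_le_exp.
Qed.

(** The damping is removed by monotone convergence, which rests on [heat_int_ge0]. *)
Lemma integral_heat_int c : 0 <= c ->
  (\int[mu]_z (heat_int c z)%:E <= (2 * pi * expR (- c))%:E)%E.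
Proof.
move=> c0.
pose g (n : nat) (z : R) : \bar R := (heat_int c z * expR (- (n.+1%:R^-1 * `|z|)))%:E.
have g0 n z : (0 <= g n z)%E by rewrite lee_fin mulr_ge0 ?heat_int_ge0 ?expR_ge0.
have mg n : measurable_fun [set: RT] (g n).
  apply/measurable_EFinP; apply: measurable_funM; first exact: measurable_heat_int.
  by apply: continuous_measurable_fun; exact: continuous_expRN_abs.
have glim z : g n z @[n --> \oo] --> (heat_int c z)%:E.
  apply: cvg_EFin; first exact: nearW.
  rewrite /g /=; rewrite -[X in _ --> X]mulr1; apply: cvgM; first exact: cvg_cst.
  rewrite -[X in _ --> X]expR0; apply: continuous_cvg; first exact: continuous_expR.
  rewrite -oppr0 -(mul0r `|z|); apply: cvgN; apply: cvgM; last exact: cvg_cst.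
  exact: cvg_harmonic.
have := @cvg_monotone_convergence _ _ R mu setT measurableT g mg (fun n z _ => g0 n z).
under eq_integral do rewrite (cvg_lim _ (glim _))//.
move=> h; apply: (cvge_to_le (h _)).
  move=> z _ m n mn; rewrite lee_fin ler_wpM2l ?heat_int_ge0//.
  by rewrite ler_expR lerN2 ler_wpM2r// lef_pV2 ?posrE// ler_nat.
by apply: nearW => n; apply: integral_heat_int_expRN => //; rewrite invr_gt0.
Qed.

Lemma heat_int_bound c z : 0 <= c -> heat_int c z <= \int[mu]_u (@heat_majorant R u).
Proof.
move=> c0; rewrite /heat_int; apply: le_Rintegral => //.
- exact: integrable_cosM (integrable_heat_weight c0).
- exact: integrable_heat_majorant.
- move=> u _; rewrite (le_trans _ (heat_weight_le_majorant u c0))//.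
  by rewrite ler_piMl ?heat_weight_ge0// cos_le1.
Qed.
End HeatIntegralMass.

(** The scaling law is transferred to positive and negative parts separately. If one of them has
    infinite integral, both sides take the default value 0. *)
Lemma Rintegral_map (R : realType) d (T : measurableType d) (m : {measure set T -> \bar R})
    (phi : T -> T) (k : R) (G : T -> R) : 0 < k ->
  (forall g, measurable_fun setT g -> (forall x, 0 <= g x)%E ->
    \int[m]_x g (phi x) = k%:E * \int[m]_x g x)%E ->
  measurable_fun setT G ->
  \int[m]_x G (phi x) = k * \int[m]_x G x.
Proof.
move=> k0 hphi mG.
have mE : measurable_fun setT (EFin \o G) by apply/measurable_EFinP.
rewrite /Rintegral integralE [in RHS]integralE.
have p0 p : (0 <= (EFin \o G)^\+ p)%E by exact: funepos_ge0.
have n0 p : (0 <= (EFin \o G)^\- p)%E by exact: funeneg_ge0.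
have -> : (\int[m]_p (fun x => (G (phi x))%:E)^\+ p = k%:E * \int[m]_p (EFin \o G)^\+ p)%E.
  rewrite -(hphi _ (measurable_funepos mE) p0).
  by apply: eq_integral => p _; rewrite !funeposE.
have -> : (\int[m]_p (fun x => (G (phi x))%:E)^\- p = k%:E * \int[m]_p (EFin \o G)^\- p)%E.
  rewrite -(hphi _ (measurable_funeneg mE) n0).
  by apply: eq_integral => p _; rewrite !funenegE.
have ip : (0 <= \int[m]_p (EFin \o G)^\+ p)%E by exact: integral_ge0.
have inn : (0 <= \int[m]_p (EFin \o G)^\- p)%E by exact: integral_ge0.
move: (\int[m]_p (EFin \o G)^\+ p)%E (\int[m]_p (EFin \o G)^\- p)%E ip inn => x y.
case: x => [x| |]// _; case: y => [y| |]// _.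
- by rewrite -!EFinM -!EFinB /= mulrBr.
- by rewrite gt0_muley ?lte_fin// /= mulr0.
- by rewrite gt0_muley ?lte_fin// /= mulr0.
- by rewrite gt0_muley ?lte_fin// /= mulr0.
Qed.

(** * Lebesgue measure on R^3 *)

Section Affine.
Context {R : realType}.
Local Notation mu := (@lebesgue_measure R).
Local Notation RT := (measurableTypeR R).

Lemma measurable_affine (a b : R) : measurable_fun [set: RT] (fun x : RT => a * x + b : RT).
Proof.
apply: continuous_measurable_fun => x; apply: cvgD; last exact: cvg_cst.
by apply: cvgM; [exact: cvg_cst|exact: cvg_id].
Qed.

(** The pushforward of Lebesgue measure under x |-> a x + b, multiplied by a, gives half-open
    intervals their length, hence is Lebesgue measure by uniqueness. *)
Lemma ge0_integral_affine (a b : R) (g : RT -> \bar R) : 0 < a ->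
  measurable_fun [set: RT] g -> (forall x, 0 <= g x)%E ->
  (\int[mu]_x g (a * x + b)%R = (a^-1)%:E * \int[mu]_x g x)%E.
Proof.
move=> a0 mg g0.
pose phi x : RT := a * x + b.
have mphi : measurable_fun [set: RT] phi := measurable_affine a b.
pose a_ : {nonneg R} := NngNum (ltW a0).
pose nu_ : {measure set RT -> \bar R} :=
  mscale a_ (pushforward mu phi).
pose nu := nu_ mphi.
have nuE A : measurable A -> mu A = nu A.
  apply: lebesgue_measure_unique => _ [[u v] _ <-].
  transitivity (a%:E * mu (phi @^-1` `]u, v]%classic))%E => //.
  have -> : phi @^-1` `]u, v]%classic = `](u - b) / a, (v - b) / a]%classic.
    apply/seteqP; split => x /=; rewrite !in_itv/= /phi;
    by rewrite ltr_pdivrMr// ler_pdivlMr// ltrBlDr lerBrDr (mulrC x).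
  rewrite !lebesgue_measure_itv/= !lte_fin ltr_pM2r ?invr_gt0// ltrD2r.
  case: ifPn => _; last by rewrite mule0.
  by rewrite -!EFinD -EFinM; congr EFin; field; rewrite gt_eqF.
have -> : (\int[mu]_x g x = \int[nu]_x g x)%E.
  by apply: eq_measure_integral => A mA _; exact: nuE.
rewrite ge0_integral_mscale// ge0_integral_pushforward//.
by rewrite muleA -EFinM mulVf ?gt_eqF// mul1e preimage_setT.
Qed.

Lemma Rintegral_affine (a b : R) (G : RT -> R) : 0 < a ->
  measurable_fun [set: RT] G ->
  \int[mu]_x G (a * x + b) = a^-1 * \int[mu]_x G x.
Proof.
move=> a0; apply: Rintegral_map; first by rewrite invr_gt0.
by move=> g mg g0; exact: ge0_integral_affine.
Qed.
End Affine.

Section ProductMap.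
Context {R : realType}.
Context d1 d2 (T1 : measurableType d1) (T2 : measurableType d2).
Variable m1 : {sigma_finite_measure set T1 -> \bar R}.
Variable m2 : {sigma_finite_measure set T2 -> \bar R}.

Lemma ge0_integral_prod_map (phi1 : T1 -> T1) (phi2 : T2 -> T2) (k1 k2 : R)
    (G : T1 * T2 -> \bar R) : 0 <= k1 -> 0 <= k2 ->
  measurable_fun setT phi1 -> measurable_fun setT phi2 ->
  (forall g, measurable_fun setT g -> (forall x, 0 <= g x)%E ->
    \int[m1]_x g (phi1 x) = k1%:E * \int[m1]_x g x)%E ->
  (forall g, measurable_fun setT g -> (forall x, 0 <= g x)%E ->
    \int[m2]_x g (phi2 x) = k2%:E * \int[m2]_x g x)%E ->
  measurable_fun setT G -> (forall p, 0 <= G p)%E ->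
  (\int[m1 \x m2]_p G (phi1 p.1, phi2 p.2) = (k1 * k2)%:E * \int[m1 \x m2]_p G p)%E.
Proof.
move=> k10 k20 mphi1 mphi2 h1 h2 mG G0.
have mF := @measurable_fun_fubini_tonelli_F _ _ _ _ _ m2 G mG G0.
have F0 x : (0 <= fubini_F m2 G x)%E by exact: integral_ge0.
rewrite (fubini_tonelli1 (fun p => G (phi1 p.1, phi2 p.2)))//; last first.
  apply: measurableT_comp => //; apply: measurable_fun_pair.
    exact: (measurableT_comp mphi1 measurable_fst).
  exact: (measurableT_comp mphi2 measurable_snd).
rewrite fubini_tonelli1// /fubini_F/=.
under eq_integral => x _.
  rewrite (h2 (fun y => G (phi1 x, y)))//; last first.
    by apply: measurableT_comp => //; exact: measurable_pair1.
  rewrite -/(fubini_F m2 G (phi1 x)); over.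
rewrite ge0_integralZl_EFin//; last exact: measurableT_comp.
by rewrite h1// muleA -EFinM (mulrC k2).
Qed.
End ProductMap.

Section Lebesgue2.
Context {R : realType}.
Local Notation mu := (@lebesgue_measure R).
Local Notation RT := (measurableTypeR R).

(* The library's sigma-finiteness instance for products is shadowed by the one
   for subprobabilities, hence this alias for the plane Lebesgue measure. *)
Definition lebesgue2 : set (RT * RT) -> \bar R := (mu \x mu)%E.

HB.instance Definition _ := Measure.on lebesgue2.

Lemma lebesgue2_sigma_finite : sigma_finite setT lebesgue2.
Proof.
exists (fun n => `[- n%:R, n%:R]%classic `*` `[- n%:R, n%:R]%classic).
  apply/esym/seteqP; split=> // -[x y] _.
  have h := archi_boundP (addr_ge0 (normr_ge0 x) (normr_ge0 y)).
  exists (Num.bound (`|x| + `|y|)) => //=; rewrite !in_itv/= -!ler_norml.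
  by split; apply: le_trans (ltW h); rewrite ?lerDl ?lerDr.
move=> n; split; first exact: measurableX.
rewrite /lebesgue2 product_measure1E//= lebesgue_measure_itv/=.
by case: ifPn => _; rewrite ?mul0e// -EFinB -EFinM ltry.
Qed.

HB.instance Definition _ :=
  Measure_isSigmaFinite.Build _ _ _ lebesgue2 lebesgue2_sigma_finite.
End Lebesgue2.

Section R3.
Context {R : realType}.
Local Notation mu := (@lebesgue_measure R).
Local Notation RT := (measurableTypeR R).
Local Notation H := (RT * RT * RT)%type.
Local Notation mu3 := (lebesgue3 R).

Definition affine3 (a b : R) (c : H) (p : H) : H :=
  (a * p.1.1 + c.1.1, a * p.1.2 + c.1.2, b * p.2 + c.2).

Lemma measurable_affine3 a b c : measurable_fun [set: H] (affine3 a b c).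
Proof.
apply: measurable_fun_pair; first apply: measurable_fun_pair.
- apply: (measurableT_comp (measurable_affine _ _)).
  exact: (measurableT_comp measurable_fst measurable_fst).
- apply: (measurableT_comp (measurable_affine _ _)).
  exact: (measurableT_comp measurable_snd measurable_fst).
- apply: (measurableT_comp (measurable_affine _ _)); exact: measurable_snd.
Qed.

Lemma ge0_integral_affine3 (a b : R) (c : H) (G : H -> \bar R) : 0 < a -> 0 < b ->
  measurable_fun [set: H] G -> (forall p, 0 <= G p)%E ->
  (\int[mu3]_p G (affine3 a b c p) = ((a ^+ 2 * b)^-1)%:E * \int[mu3]_p G p)%E.
Proof.
move=> a0 b0 mG G0.
have iP (u : R) : 0 < u -> 0 <= u^-1 by move=> u0; rewrite invr_ge0 ltW.
have -> : (a ^+ 2 * b)^-1 = a^-1 * a^-1 * b^-1 by rewrite expr2 !invfM.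
apply: (@ge0_integral_prod_map _ _ _ _ _ lebesgue2 mu
   (fun q : RT * RT => (a * q.1 + c.1.1, a * q.2 + c.1.2)) (fun z : RT => b * z + c.2)) => //.
- by rewrite mulr_ge0 ?iP.
- exact: iP.
- by apply: measurable_fun_pair; apply: (measurableT_comp (measurable_affine _ _)).
- exact: measurable_affine.
- move=> g mg g0.
  apply: (@ge0_integral_prod_map _ _ _ _ _ mu mu
   (fun x : RT => a * x + c.1.1) (fun x : RT => a * x + c.1.2)) => //.
  + exact: iP.
  + exact: iP.
  + exact: measurable_affine.
  + exact: measurable_affine.
  + by move=> u mu_ u0; exact: ge0_integral_affine.
  + by move=> u mu_ u0; exact: ge0_integral_affine.
- by move=> u mu_ u0; exact: ge0_integral_affine.
Qed.

Lemma Rintegral_affine3 (a b : R) (c : H) (G : H -> R) : 0 < a -> 0 < b ->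
  measurable_fun [set: H] G ->
  \int[mu3]_p G (affine3 a b c p) = (a ^+ 2 * b)^-1 * \int[mu3]_p G p.
Proof.
move=> a0 b0; apply: Rintegral_map; first by rewrite invr_gt0 mulr_gt0// exprn_gt0.
by move=> g mg g0; exact: ge0_integral_affine3.
Qed.

Lemma measurable_fun_countable d (T : measurableType d) d' (U : measurableType d')
    (C : countType) (g : T -> C) (F : C -> U) :
  (forall k, measurable (g @^-1` [set k])) -> measurable_fun setT (F \o g).
Proof.
move=> mg _ B mB; rewrite setTI.
have -> : (F \o g) @^-1` B = \bigcup_m (if unpickle m is Some k then
    (if `[< B (F k) >] then g @^-1` [set k] else set0) else set0).
  apply/seteqP; split => [x /= Bx|x [m _] /=].
    by exists (pickle (g x)) => //; rewrite pickleK asboolT.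
  by case: (unpickle m) => [k|//]; case: asboolP => // Bk /= ->.
apply: bigcupT_measurable => m; case: (unpickle m) => [k|//].
by case: ifP.
Qed.

(** The sigma-algebra is the product one, so the function is approximated by its values at points
    rounded down to a grid of mesh 1/(n+1). Each approximant factors through a countable set of
    integer triples, with boxes as fibres. *)
Lemma measurable_continuous3 (f : heis R -> R) : continuous f ->
  measurable_fun [set: H] (f : H -> R).
Proof.
move=> cf.
pose fl (n : nat) (x : R) : int := Num.floor (x * n.+1%:R).
pose gr (n : nat) (i : int) : R := i%:~R / n.+1%:R.
pose rd (n : nat) (x : R) : R := gr n (fl n x).
pose f_ (n : nat) (p : H) : R := f (rd n p.1.1, rd n p.1.2, rd n p.2).
have n0 n : 0 < n.+1%:R :> R by [].
have rdb n x : x - n.+1%:R^-1 <= rd n x <= x.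
  have /andP[h1 h2] := real_floor_itv (num_real (x * n.+1%:R)).
  rewrite /rd /gr /fl ler_pdivrMr// h1 andbT ler_pdivlMr// mulrBl mulVf ?gt_eqF//.
  by rewrite lerBlDr ltW// -intrD1.
have crd x : rd n x @[n --> \oo] --> x.
  apply: (squeeze_cvgr (nearW _ (rdb ^~ x))); last exact: cvg_cst.
  rewrite -[X in _ --> X]subr0; apply: cvgB; [exact: cvg_cst|exact: cvg_harmonic].
apply: (@measurable_fun_cvg _ _ _ _ f_) => [n|p _]; last first.
  case: p => [[x y] z]; apply: continuous_cvg; first exact: cf.
  exact: (cvg_pair (cvg_pair (crd x) (crd y)) (crd z)).
apply: (@measurable_fun_countable _ _ _ _ (int * int * int)%type
  (fun p : H => (fl n p.1.1, fl n p.1.2, fl n p.2))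
  (fun k => f (gr n k.1.1, gr n k.1.2, gr n k.2))) => -[[i j] k].
have mfl m : measurable (fl n @^-1` [set m] : set RT).
  rewrite (_ : _ @^-1` _ = `[m%:~R / n.+1%:R, (m + 1)%:~R / n.+1%:R[%classic); first exact: measurable_itv.
  apply/seteqP; split => x /=; rewrite in_itv/= ler_pdivrMr// ltr_pdivlMr// -real_floor_eq ?num_real//;
    by move/eqP.
rewrite [X in measurable X](_ : _ = (fl n @^-1` [set i] `*` fl n @^-1` [set j]) `*` fl n @^-1` [set k]).
  exact: (measurableX (measurableX (mfl i) (mfl j)) (mfl k)).
by apply/seteqP; split=> -[[x y] z] /=; [case=> -> -> ->|case=> -[-> ->] ->].
Qed.
End R3.

(** * The heat kernel *)

Section HeatKernelBounds.
Context {R : realType}.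
Local Notation mu := (@lebesgue_measure R).
Local Notation RT := (measurableTypeR R).
Local Notation H := (RT * RT * RT)%type.
Local Notation mu3 := (lebesgue3 R).
Local Notation kappa := ((8 * pi ^+ 2)^-1 : R).

Lemma hnorm_sqr (p : heis R) : hnorm p ^+ 2 = p.1.1 ^+ 2 + p.1.2 ^+ 2.
Proof. by rewrite sqr_sqrtr// addr_ge0// sqr_ge0. Qed.

(** Substitution u = t l: one factor 1/t comes from dl, the other from the numerator of l / sinh (l
    t). *)
Lemma heat_kernelE (t : R) (p : heis R) : 0 < t ->
  heat_kernel t p = kappa * (t ^- 2 * heat_int (hnorm p ^+ 2 / 4 / t) (p.2 / t)).
Proof.
move=> t0; rewrite /heat_kernel; congr (_ * _).
rewrite /Cintegral /=.
pose G (u : RT) : R := cos (p.2 / t * u) * (t^-1 * heat_weight (hnorm p ^+ 2 / 4 / t) u).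
have mG : measurable_fun [set: RT] G.
  apply: measurable_funM; first exact: measurable_cosM.
  by apply: measurable_funM; [exact: measurable_cst|exact: measurable_heat_weight].
transitivity (\int[mu]_u G (t * u + 0)).
  apply: eq_Rintegral => u _; rewrite /G /expi /real_complex_def /= mulr0 subr0 addr0.
  have -> : u * p.2 = p.2 / t * (t * u) by field; rewrite gt_eqF.
  congr (_ * _); rewrite /heat_weight /sinhw /cothw (mulrC u t).
  have -> : hnorm p ^+ 2 / 4 / t * (t * u * coth (t * u)) =
    hnorm p ^+ 2 / 4 * (u * coth (t * u)) by field; rewrite gt_eqF.
  by rewrite !mulrA mulVf ?gt_eqF// mul1r.
rewrite Rintegral_affine// /G.
under eq_Rintegral do rewrite mulrCA.
rewrite RintegralZl//; last first.
  apply: integrable_cosM; apply: integrable_heat_weight.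
  by rewrite !divr_ge0 ?sqr_ge0// ltW.
by rewrite mulrA -invfM -expr2.
Qed.

Lemma hE (p : heis R) : h p = kappa * heat_int (hnorm p ^+ 2 / 4) p.2.
Proof. by rewrite /h heat_kernelE// expr1n !invr1 mul1r !mulr1. Qed.

Lemma heat_kernel_scale (rho : R) (p : heis R) : 0 < rho ->
  heat_kernel (rho ^+ 2) p =
  (rho ^+ 2 * rho ^+ 2)^-1 * h (p.1.1 / rho, p.1.2 / rho, p.2 / rho ^+ 2).
Proof.
move=> r0; rewrite heat_kernelE ?exprn_gt0// hE.
have -> : hnorm (p.1.1 / rho, p.1.2 / rho, p.2 / rho ^+ 2) ^+ 2 / 4 =
    hnorm p ^+ 2 / 4 / rho ^+ 2.
  by rewrite !hnorm_sqr/=; field; rewrite gt_eqF.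
rewrite (expr2 (rho ^+ 2)) -[(_, _, _).2]/(p.2 / rho ^+ 2).
by move: kappa (heat_int _ _) (_^-1) => k I x; rewrite mulrCA.
Qed.

Lemma kappa_gt0 : 0 < kappa.
Proof. by rewrite invr_gt0 mulr_gt0// exprn_gt0// pi_gt0. Qed.

Lemma h_ge0 (p : heis R) : 0 <= h p.
Proof. by rewrite hE mulr_ge0 ?(ltW kappa_gt0)// heat_int_ge0// divr_ge0// sqr_ge0. Qed.

Definition heat_mass : R := \int[mu]_u (@heat_majorant R u).

Lemma measurable_h : measurable_fun [set: H] (@h R : H -> R).
Proof.
have -> : (@h R : H -> R) = fun p : H => kappa * \int[mu]_u (cos (p.2 * u) * heat_weight (hnorm p ^+ 2 / 4) u).
  by apply/funext => p; rewrite hE.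
apply: measurable_funM; first exact: measurable_cst.
have m2 : measurable_fun [set: H * RT] (fun q : H * RT => q.1.2 * q.2).
  apply: measurable_funM; last exact: measurable_snd.
  exact: (measurableT_comp measurable_snd measurable_fst).
have m1 : measurable_fun [set: H * RT] (fun q : H * RT => hnorm q.1 ^+ 2 / 4).
  apply: measurable_funM; last exact: measurable_cst.
  under eq_fun do rewrite hnorm_sqr.
  apply: measurable_funD; apply: measurable_funX.
    exact: (measurableT_comp (measurableT_comp measurable_fst measurable_fst) measurable_fst).
  exact: (measurableT_comp (measurableT_comp measurable_snd measurable_fst) measurable_fst).
apply: (@measurable_Rintegral_param _ _ _ _ _ mu (fun q : H * RT =>
  cos (q.1.2 * q.2) * heat_weight (hnorm q.1 ^+ 2 / 4) q.2) heat_majorant).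
- apply: measurable_funM.
    by apply: (measurableT_comp _ m2); apply: continuous_measurable_fun; exact: continuous_cos.
  apply: measurable_funM.
    exact: (measurableT_comp measurable_sinhw measurable_snd).
  apply: (measurableT_comp (@measurable_expR R)); apply: measurable_funN.
  apply: measurable_funM => //.
  exact: (measurableT_comp measurable_cothw measurable_snd).
- exact: integrable_heat_majorant.
- move=> p u /=; have c0 : 0 <= hnorm p ^+ 2 / 4 by rewrite divr_ge0// sqr_ge0.
  rewrite normrM -[leRHS]mul1r ler_pM ?norm_cos_le1//.
  by rewrite ger0_norm ?heat_weight_ge0// heat_weight_le_majorant.
Qed.

Lemma integral_gauss4 : (\int[mu]_x (expR (- (x ^+ 2 / 4)))%:E = (2 * Num.sqrt pi)%:E)%E.
Proof.
have -> : (\int[mu]_x (expR (- (x ^+ 2 / 4)))%:E = \int[mu]_x (EFin \o @gauss_fun R) (2^-1 * x + 0)%R)%E.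
  apply: eq_integral => x _; rewrite /gauss_fun /=; congr (expR (- _))%:E.
  by field.
rewrite ge0_integral_affine//.
- by rewrite invrK integralT_gauss -EFinM.
- by apply/measurable_EFinP; exact: measurable_gauss_fun.
- by move=> x; rewrite lee_fin gauss_fun_ge0.
Qed.

Lemma integral_heat_intM (k c : R) : 0 <= k -> 0 <= c ->
  (\int[mu]_z (k * heat_int c z)%:E <= (k * (2 * pi * expR (- c)))%:E)%E.
Proof.
move=> k0 c0; under eq_integral do rewrite EFinM.
rewrite ge0_integralZl_EFin//; last 2 first.
- by move=> z _; rewrite lee_fin heat_int_ge0.
- by apply/measurable_EFinP; exact: measurable_heat_int.
rewrite EFinM; apply: lee_pmul => //.
  by apply: integral_ge0 => z _; rewrite lee_fin heat_int_ge0.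
exact: integral_heat_int.
Qed.

(** Integrating in z leaves at most kappa 2 pi exp (- r^2 / 4). The plane Gaussian has integral 4
    pi, and kappa = 1 / (8 pi^2) makes the product 1. *)
Lemma integral_h_le1 : (\int[mu3]_p (h p)%:E <= 1)%E.
Proof.
have mh : measurable_fun [set: H] (fun p : H => (h p)%:E) by apply/measurable_EFinP; exact: measurable_h.
have h0 (p : H) : (0 <= (h p)%:E)%E by rewrite lee_fin h_ge0.
rewrite (@fubini_tonelli1 _ _ _ _ _ lebesgue2 mu (fun p : H => (h p)%:E))//.
have meas := @measurable_fun_fubini_tonelli_F _ _ _ _ _ mu (fun p : H => (h p)%:E) mh h0.
pose g (x : R) := expR (- (x ^+ 2 / 4)).
have mg : measurable_fun [set: RT] g.
  apply: (measurableT_comp (@measurable_expR R)); apply: measurable_funN.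
  by apply: measurable_funM; [apply: measurable_funX; exact: measurable_id|exact: measurable_cst].
have mgg : measurable_fun [set: RT * RT] (fun q : RT * RT => g q.1 * g q.2).
  apply: measurable_funM.
    exact: (measurableT_comp mg measurable_fst).
  exact: (measurableT_comp mg measurable_snd).
have b0 : 0 <= kappa * (2 * pi) by rewrite mulr_ge0 ?(ltW kappa_gt0)// mulr_ge0// pi_ge0.
have g0 x : 0 <= g x by exact: expR_ge0.
apply: (@le_trans _ _ (\int[lebesgue2]_q (kappa * (2 * pi) * (g q.1 * g q.2))%:E)%E).
  apply: ge0_le_integral => //.
  - by move=> q _; exact: integral_ge0.
  - by apply/measurable_EFinP; apply: measurable_funM; first exact: measurable_cst.
  - move=> [x y] _; rewrite /fubini_F.
    have c0 : 0 <= hnorm (x, y, 0 : R) ^+ 2 / 4 by rewrite divr_ge0// sqr_ge0.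
    have e : g x * g y = expR (- (hnorm (x, y, 0 : R) ^+ 2 / 4)).
      by rewrite /g -expRD hnorm_sqr/= mulrDl opprD.
    rewrite e -mulrA; apply: le_trans (integral_heat_intM (ltW kappa_gt0) c0).
    by rewrite le_eqVlt; apply/orP; left; apply/eqP; apply: eq_integral => z _; rewrite hE.
have eg : (\int[lebesgue2]_q (g q.1 * g q.2)%:E = (4 * pi)%:E)%E.
  rewrite (@fubini_tonelli1 _ _ _ _ _ mu mu (fun q : RT * RT => (g q.1 * g q.2)%:E))//; last 2 first.
  - exact/measurable_EFinP.
  - by move=> q; rewrite lee_fin mulr_ge0.
  rewrite /fubini_F/=.
  have -> : (\int[mu]_x \int[mu]_y (g x * g y)%:E = \int[mu]_x ((2 * Num.sqrt pi)%:E * (g x)%:E))%E.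
    apply: eq_integral => x _; under eq_integral do rewrite EFinM.
    rewrite ge0_integralZl_EFin//; last 2 first.
    - by move=> y _; rewrite lee_fin.
    - exact/measurable_EFinP.
    by rewrite integral_gauss4 muleC.
  rewrite ge0_integralZl_EFin ?mulr_ge0 ?sqrtr_ge0//; last 2 first.
  - by move=> y _; rewrite lee_fin.
  - exact/measurable_EFinP.
  rewrite integral_gauss4 -EFinM mulrACA -[Num.sqrt _ * _]expr2 sqr_sqrtr ?pi_ge0//.
  by rewrite -natrM.
under eq_integral do rewrite EFinM.
rewrite ge0_integralZl_EFin//; last 2 first.
- by move=> q _; rewrite lee_fin mulr_ge0.
- exact/measurable_EFinP.
have e8 : 2 * pi * (4 * pi) = 8 * pi ^+ 2 :> R by ring.
by rewrite eg -EFinM lee_fin -mulrA e8 mulVf// mulf_neq0// expf_neq0// gt_eqF// pi_gt0.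
Qed.
End HeatKernelBounds.

(** * Derivatives and integration by parts *)

Section DerivativeAlongLine.
Context {R : realType}.

Lemma line_difference_quotient (V : normedModType R) (f : V -> R) (p v : V) (phi : R -> R) (a : R) :
  (forall s, f (s *: v + p) = phi (s + a)) ->
  (fun s : R => s^-1 *: ((f \o shift p) (s *: v) - f p)) =
  (fun s : R => s^-1 *: ((phi \o shift a) (s *: (1 : R)) - phi a)).
Proof.
move=> fphi; apply/funext => s.
have := fphi 0; rewrite scale0r !add0r /= => ->.
by rewrite fphi [s *: 1]mulr1.
Qed.

(** A directional derivative sees only the restriction to a line. This reduces the differentiation
    of [h] under the integral to one real variable. *)
Lemma derivable_line (V : normedModType R) (f : V -> R) (p v : V) (phi : R -> R) (a : R) :
  (forall s, f (s *: v + p) = phi (s + a)) ->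
  derivable f p v <-> derivable phi a 1.
Proof. by move=> fphi; rewrite /derivable (line_difference_quotient fphi). Qed.

Lemma derive_line (V : normedModType R) (f : V -> R) (p v : V) (phi : R -> R) (a : R) :
  (forall s, f (s *: v + p) = phi (s + a)) -> 'D_v f p = 'D_1 phi a.
Proof. by move=> fphi; rewrite /derive (line_difference_quotient fphi). Qed.

Lemma derive_line_bound (V : normedModType R) (f : V -> R) (p v : V) (phi : R -> R) (a k B : R) :
  0 <= k -> (forall s, f (s *: v + p) = k * phi (s + a)) ->
  derivable phi a 1 /\ `|'D_1 phi a| <= B ->
  derivable f p v /\ `|'D_v f p| <= k * B.
Proof.
move=> k0 fphi [dphi bphi].
have dk : is_derive a 1 (fun x : R => k * phi x) (k * 'D_1 phi a).
  by have := derivableP dphi => ?; exact: is_derive_eq.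
rewrite (derivable_line (phi := fun x : R => k * phi x) fphi).
rewrite (derive_line (phi := fun x : R => k * phi x) fphi).
case: dk => dk ->; split=> //; rewrite normrM ger0_norm//.
by rewrite ler_wpM2l.
Qed.
End DerivativeAlongLine.

Section MeasurableDerive.
Context {R : realType}.

Lemma cvg_difference_quotient_harmonic (f : R -> R) (a : R) : derivable f a 1 ->
  n.+1%:R * (f (n.+1%:R^-1 + a) - f a) @[n --> \oo] --> 'D_1 f a.
Proof.
move=> /cvgr_dnbhsP/(_ (@harmonic R)); rewrite -/(derive f a 1).
have h0 : (forall n, @harmonic R n != 0) /\ @harmonic R n @[n --> \oo] --> 0.
  by split=> [n|]; [rewrite gt_eqF// invr_gt0|exact: cvg_harmonic].
move=> /(_ h0); apply: cvg_trans; apply: near_eq_cvg; apply: nearW => n /=.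
by rewrite /harmonic/= invrK [_ *: 1]mulr1.
Qed.

Lemma measurable_derive1 d (T : measurableType d) (f : R -> T -> R) (a : R) :
  (forall s, measurable_fun setT (f s)) -> (forall y, derivable (f ^~ y) a 1) ->
  measurable_fun setT (fun y => 'D_1 (f ^~ y) a).
Proof.
move=> mf df.
apply: (@measurable_fun_cvg _ _ _ _
  (fun n y => n.+1%:R * (f (n.+1%:R^-1 + a) y - f a y))) => [n|y _].
  by apply: measurable_funM; [exact: measurable_cst|exact: measurable_funB].
exact: (cvg_difference_quotient_harmonic (df y)).
Qed.
End MeasurableDerive.

Lemma ord3_ind (P : 'I_3 -> Prop) : P 0 -> P 1 -> P 2 -> forall i, P i.
Proof.
by move=> P0 P1 P2 [[|[|[|//]]] i3];
  [move: P0|move: P1|move: P2]; congr P; apply/val_inj.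
Qed.

Lemma basis3_0 (R : realType) : basis3 R 0 = (1, 0, 0). Proof. by []. Qed.
Lemma basis3_1 (R : realType) : basis3 R 1 = (0, 1, 0). Proof. by []. Qed.
Lemma basis3_2 (R : realType) : basis3 R 2 = (0, 0, 1). Proof. by []. Qed.

Section HeatKernelDerivatives.
Context {R : realType}.
Local Notation mu := (@lebesgue_measure R).
Local Notation RT := (measurableTypeR R).
Local Notation kappa := ((8 * pi ^+ 2)^-1 : R).

Lemma heat_majorant_ge0 u : 0 <= @heat_majorant R u.
Proof. by rewrite mulr_ge0// expR_ge0. Qed.

Lemma derivable_bound_under_integral (f : R -> R -> R) (a C : R) : 0 <= C ->
  (forall x, mu.-integrable setT (EFin \o f x)) ->
  (forall x u, derivable (f ^~ u) x 1) ->
  (forall x u, x \in `]a - 1, a + 1[ -> `|'D_1 (f ^~ u) x| <= C * heat_majorant u) ->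
  derivable (fun x : R => \int[mu]_u f x u) a 1 /\
  `|'D_1 (fun x : R => \int[mu]_u f x u) a| <= C * heat_mass.
Proof.
move=> C0 fi fd fC.
have aI : `]a - 1, a + 1[%classic a by rewrite /= in_itv/= ltrBlDr ltrDl ltr01.
have iG : mu.-integrable setT (EFin \o (fun u => C * heat_majorant u)).
  by apply: integrable_scale; exact: integrable_heat_majorant.
have G0 u : 0 <= C * heat_majorant u by rewrite mulr_ge0 ?heat_majorant_ge0.
have fC' x u : `]a - 1, a + 1[%classic x -> setT u ->
    `|partial1of2 f x u| <= C * heat_majorant u.
  by move=> xI _; rewrite partial1of2E fC.
have fd' x u : `]a - 1, a + 1[%classic x -> setT u -> derivable (f ^~ u) x 1.
  by move=> _ _; exact: fd.
have fi' x : `]a - 1, a + 1[%classic x -> mu.-integrable setT (EFin \o f x).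
  by move=> _; exact: fi.
split; first exact: (derivable_under_integral measurableT aI fi' fd' G0 iG fC').
rewrite -derive1E (differentiation_under_integral measurableT aI fi' fd' G0 iG fC').
have md : measurable_fun [set: RT] (fun u => derive1 (f ^~ u) a).
  under eq_fun do rewrite derive1E.
  apply: measurable_derive1 => // s.
  by apply/measurable_EFinP; exact: measurable_int (fi s).
have dG u : `|derive1 (f ^~ u) a| <= C * heat_majorant u by exact: fC'.
have id : mu.-integrable setT (EFin \o (fun u => derive1 (f ^~ u) a)).
  apply: (le_integrable _ _ _ iG) => //; first exact/measurable_EFinP.
  by move=> u _ /=; rewrite lee_fin (le_trans (dG u))// ler_norm.
rewrite (le_trans (le_normr_Rintegral measurableT id))//.
rewrite /heat_mass -RintegralZl//; last exact: integrable_heat_majorant.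
by apply: le_Rintegral => //; exact: integrable_norm.
Qed.

Lemma is_derive_heat_weight_sqr (a u x : R) :
  is_derive x (1:R) (fun x : R => heat_weight ((x ^+ 2 + a) / 4) u)
    (- (x / 2) * (cothw u * heat_weight ((x ^+ 2 + a) / 4) u)).
Proof.
rewrite /heat_weight; apply: is_derive_eq.
by rewrite /GRing.scale /=; field.
Qed.

Lemma cothw_heat_weight_majorant (c u : R) : 0 <= c -> cothw u * heat_weight c u <= heat_majorant u.
Proof.
move=> c0; apply: le_trans (heat_weight_majorant u c0).
by rewrite ler_wpM2r ?heat_weight_ge0 ?cothw_le.
Qed.

(** Differentiation is in the coordinate x, not in c = (x^2 + a) / 4: every real x is allowed,
    whereas c = 0 lies on the boundary of the range where the weight is dominated. *)
Lemma derivable_heat_int_sqr (a z x : R) : 0 <= a ->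
  derivable (fun x : R => heat_int ((x ^+ 2 + a) / 4) z) x 1 /\
  `|'D_1 (fun x : R => heat_int ((x ^+ 2 + a) / 4) z) x| <= (`|x| + 1) * heat_mass.
Proof.
move=> a0.
have c0 y : 0 <= (y ^+ 2 + a) / 4 by rewrite divr_ge0// addr_ge0// sqr_ge0.
have dw (y u : R) : is_derive y (1:R) (fun y : R => cos (z * u) * heat_weight ((y ^+ 2 + a) / 4) u)
    (cos (z * u) * (- (y / 2) * (cothw u * heat_weight ((y ^+ 2 + a) / 4) u))).
  have := is_derive_heat_weight_sqr a u y => ?.
  exact: is_derive_eq.
apply: derivable_bound_under_integral.
- by rewrite addr_ge0.
- by move=> y; apply: integrable_cosM; exact: integrable_heat_weight.
- by move=> y u; case: (dw y u).
- move=> y u; rewrite in_itv/= => /andP[y1 y2].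
  case: (dw y u) => _ ->.
  rewrite normrM -[leRHS]mul1r ler_pM ?norm_cos_le1// normrM ler_pM//.
    rewrite normrN normrM (@ger0_norm _ 2^-1)//.
    have : `|y| <= `|x| + 1.
      rewrite ler_norml; have := ler_norm x; have := ler_norm (- x); rewrite normrN.
      move=> *; apply/andP; split; lra.
    have := normr_ge0 y; lra.
  by rewrite ger0_norm ?cothw_heat_weight_majorant// mulr_ge0 ?heat_weight_ge0 ?cothw_ge0.
Qed.

Lemma derivable_heat_int_z (c z : R) : 0 <= c ->
  derivable (heat_int c) z 1 /\ `|'D_1 (heat_int c) z| <= 1 * heat_mass.
Proof.
move=> c0.
have dw (y u : R) : is_derive y (1:R) (fun y : R => cos (y * u) * heat_weight c u)
    (- (u * sin (y * u)) * heat_weight c u).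
  by apply: is_derive_eq; rewrite /GRing.scale/=; ring.
pose f (y u : R) : R := cos (y * u) * heat_weight c u.
have i1 y : mu.-integrable setT (EFin \o f y).
  by apply: integrable_cosM; exact: integrable_heat_weight.
have i2 y u : derivable (f ^~ u) y 1 by case: (dw y u).
have i3 y u : y \in `]z - 1, z + 1[ -> `|'D_1 (f ^~ u) y| <= 1 * heat_majorant u.
  move=> _; case: (dw y u) => _ ->; rewrite mul1r.
  apply: le_trans (heat_weight_majorant u c0).
  rewrite normrM (ger0_norm (heat_weight_ge0 _ _)) ler_wpM2r ?heat_weight_ge0//.
  rewrite normrN normrM (@le_trans _ _ (`|u| * 1))//.
    by rewrite ler_wpM2l// norm_sin_le1.
  by rewrite mulr1 lerDr.
exact: (derivable_bound_under_integral ler01 i1 i2 i3).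
Qed.

Lemma h_heat_int : exists2 k : R, 0 < k &
  forall p : heis R, h p = k * heat_int (hnorm p ^+ 2 / 4) p.2.
Proof. by exists kappa; [exact: kappa_gt0|move=> p; exact: hE]. Qed.

Lemma h_partial : exists2 C : R, 0 <= C & forall (i : 'I_3) (p : heis R),
  [/\ 0 <= h p <= C, derivable (@h R) p (basis3 R i) &
   `|partial i (@h R) p| <= C * (1 + `|p|)].
Proof.
have [k k0 hk] := h_heat_int.
have m0 : 0 <= heat_mass :> R by apply: Rintegral_ge0 => u _; exact: heat_majorant_ge0.
have C0 : 0 <= k * heat_mass by rewrite mulr_ge0// ltW.
exists (k * heat_mass) => // i p.
have nx : `|p.1.1| <= `|p| by rewrite prod_normE le_max [`|p.1|]prod_normE le_max lexx.
have ny : `|p.1.2| <= `|p| by rewrite prod_normE le_max [`|p.1|]prod_normE le_max lexx orbT.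
suff [dh bh] : derivable (@h R) p (basis3 R i) /\
    `|'D_(basis3 R i) (@h R) p| <= k * ((`|p| + 1) * heat_mass).
  split=> //; last by rewrite (le_trans bh)// mulrAC mulrA (addrC 1) mulrAC.
  by rewrite h_ge0 /= hk ler_pM2l// heat_int_bound// divr_ge0// sqr_ge0.
have mono B : B <= `|p| -> (B + 1) * heat_mass <= (`|p| + 1) * heat_mass.
  by move=> Bp; rewrite ler_wpM2r// lerD2r.
move: i; apply: ord3_ind.
- apply: (@derive_line_bound _ _ _ _ _ (fun x : R => heat_int ((x ^+ 2 + p.1.2 ^+ 2) / 4) p.2) p.1.1).
  + exact: ltW.
  + by move=> s; rewrite hk hnorm_sqr /= !scaler0 [_ *: 1]mulr1 !add0r.
  + have [dh bh] := @derivable_heat_int_sqr (p.1.2 ^+ 2) p.2 p.1.1 (sqr_ge0 _).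
    by split=> //; apply: le_trans bh (mono _ nx).
- apply: (@derive_line_bound _ _ _ _ _ (fun x : R => heat_int ((x ^+ 2 + p.1.1 ^+ 2) / 4) p.2) p.1.2).
  + exact: ltW.
  + by move=> s; rewrite hk hnorm_sqr /= !scaler0 [_ *: 1]mulr1 !add0r addrC.
  + have [dh bh] := @derivable_heat_int_sqr (p.1.1 ^+ 2) p.2 p.1.2 (sqr_ge0 _).
    by split=> //; apply: le_trans bh (mono _ ny).
- apply: (@derive_line_bound _ _ _ _ _ (heat_int (hnorm p ^+ 2 / 4)) p.2).
  + exact: ltW.
  + by move=> s; rewrite hk !hnorm_sqr /= !scaler0 [_ *: 1]mulr1 !add0r.
  + have c0 : 0 <= hnorm p ^+ 2 / 4 by rewrite divr_ge0// sqr_ge0.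
    have [dh bh] := derivable_heat_int_z p.2 c0.
    by split=> //; apply: le_trans bh _; rewrite ler_wpM2r// lerDr.
Qed.
End HeatKernelDerivatives.

Section BoundedSupport.
Context {R : realType}.
Local Notation mu := (@lebesgue_measure R).
Local Notation RT := (measurableTypeR R).
Local Notation H := (RT * RT * RT)%type.
Local Notation mu3 := (lebesgue3 R).

Lemma norm_heis_le (M : R) (p : heis R) :
  (`|p| <= M) = [&& `|p.1.1| <= M, `|p.1.2| <= M & `|p.2| <= M].
Proof. by rewrite prod_normE ge_max [`|p.1|]prod_normE ge_max andbA. Qed.

Lemma integrable_bounded_support (g : H -> R) (C M : R) :
  measurable_fun [set: H] g -> (forall p, `|g p| <= C) ->
  (forall p : heis R, M < `|p| -> g p = 0) -> mu3.-integrable setT (EFin \o g).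
Proof.
move=> mg gC gM.
pose I : set RT := `[- M, M]%classic.
pose B : set H := (I `*` I) `*` I.
have mI : measurable I by exact: measurable_itv.
have mII : measurable (I `*` I) by exact: measurableX.
have mB : measurable B by exact: measurableX.
have fI : (mu I < +oo)%E.
  by rewrite /I lebesgue_measure_itv/=; case: ifPn => _; rewrite -?EFinB ltry.
have I_fin : mu I \is a fin_num by rewrite ge0_fin_numE.
have fII : (lebesgue2 (I `*` I) < +oo)%E.
  by rewrite /lebesgue2 product_measure1E// lte_mul_pinfty.
have fB : (mu3 B < +oo)%E.
  have -> : mu3 B = (lebesgue2 (I `*` I) * mu I)%E.
    exact: (@product_measure1E _ _ _ _ _ lebesgue2 mu).
  by apply: lte_mul_pinfty => //; rewrite ge0_fin_numE.
have iB : mu3.-integrable B (EFin \o cst C).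
  apply: measurable_bounded_integrable => //.
  exact: bounded_cst.
have out p : ~ B p -> g p = 0.
  move=> Bp; apply: gM; rewrite ltNge; apply/negP.
  rewrite norm_heis_le => /and3P[h1 h2 h3]; apply: Bp.
  by rewrite /B /I/= !in_itv/= -!ler_norml.
have -> : EFin \o g = (EFin \o g) \_ B.
  apply/funext => p; rewrite /patch; case: ifPn => //; rewrite notin_setE => /out /= ->//.
apply/(integrable_mkcond _ mB); apply: (le_integrable mB _ _ iB).
  by apply/measurable_EFinP; apply: measurable_funTS.
by move=> p _ /=; rewrite lee_fin (le_trans (gC p))// ler_norm.
Qed.

Lemma derive_eq0_outside (f : heis R -> R) (M : R) (p v : heis R) :
  (forall p, M < `|p| -> f p = 0) -> M < `|p| -> 'D_v f p = 0.
Proof.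
move=> fM Mp; have [->|v0] := eqVneq v 0; first exact: derive0.
rewrite (_ : 0 = 'D_v (cst 0) p); last by rewrite derive_cst.
apply: near_eq_derive => //.
have cn : `|q| @[q --> p] --> `|p| by exact: norm_continuous.
near=> q; rewrite fM//; near: q.
exact: (cvgr_gt _ cn _ Mp).
Unshelve. all: by end_near.
Qed.

Lemma shift3E (c p : heis R) : c + p = affine3 1 1 c p.
Proof.
move: c p => [[a b] d] [[x y] z]; rewrite /affine3 /= !mul1r.
by rewrite (addrC x) (addrC y) (addrC z).
Qed.

Lemma measurable_shift3 (c : heis R) : measurable_fun [set: H] ((fun p : heis R => c + p) : H -> H).
Proof.
have -> : ((fun p : heis R => c + p) : H -> H) = affine3 1 1 c.
  by apply/funext => p; rewrite shift3E.
exact: measurable_affine3.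
Qed.

Lemma measurable_derive3 (f : heis R -> R) (v : heis R) : measurable_fun [set: H] (f : H -> R) ->
  (forall p, derivable f p v) -> measurable_fun [set: H] ((fun p => 'D_v f p) : H -> R).
Proof.
move=> mf df.
pose F (s : R) (p : H) : R := f (s *: v + p).
have Fl p : forall s, f (s *: v + p) = F (s + 0) p by move=> s; rewrite addr0.
have -> : ((fun p => 'D_v f p) : H -> R) = fun p => 'D_1 (F ^~ p) 0.
  by apply/funext => p; rewrite (derive_line (phi := F ^~ p) (Fl p)).
apply: measurable_derive1 => [s|p]; last by apply: (proj1 (derivable_line (phi := F ^~ p) (Fl p))).
by apply: (measurableT_comp mf); exact: measurable_shift3.
Qed.

Lemma derive_under_integral3 (Phi : R -> H -> R) (k : H -> R) (C K M : R) :
  measurable_fun [set: H] k -> (forall q, `|k q| <= K) ->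
  (forall s, measurable_fun [set: H] (Phi s)) ->
  (forall s q, derivable (Phi ^~ q) s 1) ->
  (forall s q, `|s| < 1 -> `|Phi s q| <= C) ->
  (forall s q, `|s| < 1 -> `|'D_1 (Phi ^~ q) s| <= C) ->
  (forall s (q : heis R), `|s| < 1 -> M < `|q| -> Phi s q = 0) ->
  (forall s (q : heis R), `|s| < 1 -> M < `|q| -> 'D_1 (Phi ^~ q) s = 0) ->
  derivable (fun s => \int[mu3]_q (Phi s q * k q)) 0 1 /\
  'D_1 (fun s => \int[mu3]_q (Phi s q * k q)) 0 = \int[mu3]_q ('D_1 (Phi ^~ q) 0 * k q).
Proof.
move=> mk kK mP dP PC DC PM DM.
have C0 : 0 <= C by rewrite (le_trans _ (PC 0 (0, 0, 0) _))// normr0.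
have K0 : 0 <= K by rewrite (le_trans _ (kK (0, 0, 0))).
pose f (s : R) (q : H) := Phi s q * k q.
pose G (q : H) : R := if `|q : heis R| <= M then C * K else 0.
have I0 : `](-1), 1[%classic (0 : R) by rewrite /= in_itv/= oppr_lt0 ltr01.
have II (s : R) : `](-1), 1[%classic s -> `|s| < 1 by rewrite /= in_itv/= ltr_norml.
have fi s : `](-1), 1[%classic s -> mu3.-integrable setT (EFin \o f s).
  move=> /II s1; apply: (@integrable_bounded_support _ (C * K) M).
  - exact: measurable_funM.
  - by move=> q; rewrite normrM ler_pM// PC.
  - by move=> q Mq; rewrite /f PM// mul0r.
have df s q : `](-1), 1[%classic s -> setT q -> derivable (f ^~ q) s 1.
  by move=> _ _; apply: derivableM.
have G0 q : 0 <= G q by rewrite /G; case: ifP => // _; exact: mulr_ge0.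
have mG : measurable_fun [set: H] G.
  apply: measurable_fun_ifT; [|exact: measurable_cst|exact: measurable_cst].
  apply: measurable_fun_ler; last exact: measurable_cst.
  by apply: measurable_continuous3; exact: norm_continuous.
have iG : mu3.-integrable setT (EFin \o G).
  apply: (@integrable_bounded_support _ (C * K) M) => //.
  - by move=> q; rewrite ger0_norm// /G; case: ifP => // _; exact: mulr_ge0.
  - by move=> q; rewrite /G ltNge; case: ifP.
have Df s q : 'D_1 (f ^~ q) s = 'D_1 (Phi ^~ q) s * k q.
  by rewrite (deriveMr (k q) (dP s q)) mulrC.
have fG s q : `](-1), 1[%classic s -> setT q -> `|partial1of2 f s q| <= G q.
  move=> /II s1 _; rewrite partial1of2E Df /G; case: ifPn => [qM|].
    by rewrite normrM ler_pM// DC.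
  by rewrite -ltNge => qM; rewrite DM// mul0r normr0.
split.
  exact: (derivable_under_integral measurableT I0 fi df G0 iG fG).
rewrite -derive1E (differentiation_under_integral measurableT I0 fi df G0 iG fG).
by apply: eq_Rintegral => q _; rewrite partial1of2E Df.
Qed.

(** By translation invariance the integral of G (s v + p) in p is independent of s; its derivative
    at s = 0 is the integral of the directional derivative. *)
Lemma integral_derive_eq0 (G : heis R -> R) (v : heis R) (C M : R) :
  measurable_fun [set: H] (G : H -> R) -> (forall p, derivable G p v) ->
  (forall p, `|G p| <= C) -> (forall p, `|'D_v G p| <= C) ->
  (forall p, M < `|p| -> G p = 0) ->
  \int[mu3]_p ('D_v G p) = 0.
Proof.
move=> mG dG GC DC GM.
pose F (s : R) (p : H) : R := G (s *: v + p).
have Fl s0 p : forall s, G (s *: v + (s0 *: v + p)) = F (s + s0) p.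
  by move=> s; rewrite /F scalerDl addrA.
have DF s p : 'D_1 (F ^~ p) s = 'D_v G (s *: v + p) by rewrite (derive_line (phi := F ^~ p) (Fl s p)).
have Mv s (p : heis R) : `|s| < 1 -> M + `|v| < `|p| -> M < `|s *: v + p|.
  move=> s1; rewrite -ltrBrDr => Mp; apply: (lt_le_trans Mp).
  rewrite [s *: v + p]addrC; apply: le_trans (lerB_normD _ _).
  by rewrite lerD2l lerN2 normrZ ler_piMl// ltW.
have [] := @derive_under_integral3 F (cst 1) C 1 (M + `|v|).
- exact: measurable_cst.
- by move=> q; rewrite normr1.
- by move=> s; apply: (measurableT_comp mG); exact: measurable_shift3.
- by move=> s q; apply: (proj1 (derivable_line (phi := F ^~ q) (Fl s q))).
- by move=> s q _; exact: GC.
- by move=> s q _; rewrite DF.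
- by move=> s q s1 /(Mv _ _ s1); exact: GM.
- by move=> s q s1 /(Mv _ _ s1) h; rewrite DF; exact: derive_eq0_outside h.
move=> _.
have -> : (fun s => \int[mu3]_q (F s q * cst 1 q)) = cst (\int[mu3]_q G q).
  apply/funext => s.
  have := @Rintegral_affine3 R 1 1 (s *: v) G ltr01 ltr01 mG.
  rewrite expr1n mulr1 invr1 mul1r /= => <-.
  by apply: eq_Rintegral => p _; rewrite /F /= mulr1 shift3E.
rewrite derive_cst => /esym; under eq_Rintegral do rewrite mulr1 DF scale0r add0r.
by [].
Qed.
End BoundedSupport.

(** * Symmetry of second derivatives *)

Section Schwarz.
Context {R : realType} {V : normedModType R}.
Implicit Types (f : V -> R) (p u v : V).

Let line_derive f u q x : (forall p, derivable f p u) ->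
  is_derive x (1 : R) (fun x : R => f (x *: u + q)) ('D_u f (x *: u + q)).
Proof.
move=> df.
have fl s : f (s *: u + (x *: u + q)) = f ((s + x) *: u + q) by rewrite scalerDl addrA.
apply: DeriveDef; first by apply: (proj1 (derivable_line (phi := fun x : R => f (x *: u + q)) fl)).
by rewrite (derive_line (phi := fun x : R => f (x *: u + q)) fl).
Qed.

Lemma second_difference f p u v (s : R) : 0 < s ->
  (forall p, derivable f p u) -> (forall p, derivable ('D_u f) p v) ->
  exists x y : R, [/\ 0 < x < s, 0 < y < s &
   f (s *: u + (s *: v + p)) - f (s *: u + p) - (f (s *: v + p) - f p) =
    s ^+ 2 * 'D_v ('D_u f) (y *: v + (x *: u + p))].
Proof.
move=> s0 du dvu.
have d1 x : is_derive x (1 : R) (fun x : R => f (x *: u + (s *: v + p)) - f (x *: u + p))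
    ('D_u f (x *: u + (s *: v + p)) - 'D_u f (x *: u + p)).
  have := line_derive (s *: v + p) x du; have := line_derive p x du => ? ?.
  exact: is_derive_eq.
have cont (g g' : R -> R) : (forall x : R, is_derive x 1 g (g' x)) -> {within `[0, s], continuous g}.
  by move=> dg; apply: continuous_subspaceT; exact: continuous_is_derive dg.
have [x xI ex] := MVT s0 (fun x _ => d1 x) (cont _ _ d1).
have d2 y : is_derive y (1 : R) (fun y : R => 'D_u f (y *: v + (x *: u + p)))
    ('D_v ('D_u f) (y *: v + (x *: u + p))).
  exact: line_derive.
have [y yI ey] := MVT s0 (fun y _ => d2 y) (cont _ _ d2).
exists x, y; split; rewrite -?in_itv//=.
move: ex ey; rewrite !scale0r !add0r !subr0 => -> ey.
by rewrite addrCA ey; ring.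
Qed.

(** The second difference over a parallelogram is symmetric in u and v. At scale 1/(n+1) it equals,
    up to the same factor, either mixed derivative at points tending to p. *)
Lemma derive_commute f p u v :
  (forall p, derivable f p u) -> (forall p, derivable f p v) ->
  (forall p, derivable ('D_u f) p v) -> (forall p, derivable ('D_v f) p u) ->
  continuous ('D_v ('D_u f)) -> continuous ('D_u ('D_v f)) ->
  'D_v ('D_u f) p = 'D_u ('D_v f) p.
Proof.
move=> du dv dvu duv cvu cuv.
have s0 n : 0 < n.+1%:R^-1 :> R by rewrite invr_gt0.
have small (x_ y_ : nat -> R) (a b : V) : (forall n, 0 < x_ n < n.+1%:R^-1) ->
    (forall n, 0 < y_ n < n.+1%:R^-1) -> y_ n *: b + (x_ n *: a + p) @[n --> \oo] --> p.
  move=> xs ys.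
  have c0 (w : nat -> R) : (forall n, 0 < w n < n.+1%:R^-1) -> w n @[n --> \oo] --> (0 : R).
    move=> ws; apply: (squeeze_cvgr _ (cvg_cst 0) cvg_harmonic).
    by apply: nearW => n; have /andP[h1 h2] := ws n; rewrite !ltW.
  rewrite -[X in _ --> X]add0r -[X in _ --> _ + X]add0r.
  rewrite -[X in _ --> X + _](scale0r b) -[X in _ --> _ + (X + _)](scale0r a).
  apply: cvgD; first by apply: cvgZr_tmp; exact: c0.
  by apply: cvgD; [apply: cvgZr_tmp; exact: c0|exact: cvg_cst].
have /choice[x1 /choice[y1 h1]] n := second_difference p (s0 n) du dvu.
have /choice[x2 /choice[y2 h2]] n := second_difference p (s0 n) dv duv.
have c1 : 'D_v ('D_u f) (y1 n *: v + (x1 n *: u + p)) @[n --> \oo] --> 'D_v ('D_u f) p.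
  have sm : y1 n *: v + (x1 n *: u + p) @[n --> \oo] --> p.
    by apply: small => n; have [] := h1 n.
  exact: (cvg_comp _ _ sm (cvu p)).
have c2 : 'D_u ('D_v f) (y2 n *: u + (x2 n *: v + p)) @[n --> \oo] --> 'D_u ('D_v f) p.
  have sm : y2 n *: u + (x2 n *: v + p) @[n --> \oo] --> p.
    by apply: small => n; have [] := h2 n.
  exact: (cvg_comp _ _ sm (cuv p)).
have e n : 'D_v ('D_u f) (y1 n *: v + (x1 n *: u + p)) =
    'D_u ('D_v f) (y2 n *: u + (x2 n *: v + p)).
  have [_ _ e1] := h1 n; have [_ _ e2] := h2 n.
  apply: (@mulfI _ (n.+1%:R^-1 ^+ 2)); first by rewrite expf_neq0 ?gt_eqF.
  apply: (etrans (esym e1)); apply: etrans e2; rewrite (addrCA (_ *: u)).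
  by move: (f (_ + (_ + _))) (f (_ *: u + p)) (f (_ *: v + p)) (f p) => a b c d; ring.
apply: (cvg_unique (@Rhausdorff R) c1).
by rewrite (funext e).
Qed.
End Schwarz.

(** * Test functions and the heat semigroup *)

Section TestFunctions.
Context {R : realType}.

Lemma derive_basis3 (g : heis R -> R) (p w : heis R) : differentiable g p ->
  'D_w g p = w.1.1 * partial 0 g p + w.1.2 * partial 1 g p + w.2 * partial 2 g p.
Proof.
move=> dg; rewrite /partial !deriveE//.
have -> : w = w.1.1 *: basis3 R 0 + w.1.2 *: basis3 R 1 + w.2 *: basis3 R 2.
  by case: w => [[a b] c]; rewrite basis3_0 basis3_1 basis3_2 /=; congr (_, _, _);
    rewrite /GRing.scale/= ?/GRing.scale/=; ring.
rewrite !linearD !linearZ /=.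
by rewrite basis3_0 basis3_1 basis3_2 /= !scaler0 ![_ *: 1]mulr1 !addr0 !add0r.
Qed.

Lemma derive_eq0_open (g : heis R -> R) (K : set (heis R)) (p v : heis R) :
  closed K -> (forall p, ~ K p -> g p = 0) -> ~ K p -> 'D_v g p = 0.
Proof.
move=> cK gK Kp; have [->|v0] := eqVneq v 0; first exact: derive0.
rewrite (_ : 0 = 'D_v (cst 0) p); last by rewrite derive_cst.
apply: near_eq_derive => //.
near=> q; rewrite gK//; near: q.
by apply: open_nbhs_nbhs; split; [exact: closed_openC|].
Unshelve. all: by end_near.
Qed.

Section Support.
Variable f : heis R -> R.
Hypotheses (sf : smooth f) (cf : compactly_supported f).

Lemma smooth_eq0 (s : seq 'I_3) p : ~ closure [set p | f p != 0] p -> foldr (@partial R) f s p = 0.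
Proof.
elim: s p => [|i s ih] p Kp /=.
  by apply/eqP/negP => /negP fp; apply: Kp; exact: subset_closure.
exact: (@derive_eq0_open _ (closure [set p | f p != 0]) p (basis3 R i) (@closed_closure _ _) ih Kp).
Qed.

Lemma smooth_support : exists2 M : R, 0 <= M &
  forall (s : seq 'I_3) p, M < `|p| -> foldr (@partial R) f s p = 0.
Proof.
have [M [Mr hM]] := compact_bounded cf.
exists (`|M| + 1) => [|s p Mp]; first by rewrite addr_ge0.
apply: smooth_eq0 => Kp; move: Mp; rewrite ltNge => /negP; apply.
by apply: (hM _ _ _ Kp); rewrite (le_lt_trans (ler_norm M))// ltrDl.
Qed.

Lemma smooth_continuous (s : seq 'I_3) : continuous (foldr (@partial R) f s).
Proof. by move=> p; exact: differentiable_continuous. Qed.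

Lemma smooth_bounded (s : seq 'I_3) : exists2 C : R, 0 <= C & forall p, `|foldr (@partial R) f s p| <= C.
Proof.
have cK : compact (foldr (@partial R) f s @` closure [set p | f p != 0]).
  by apply: continuous_compact cf; apply: continuous_subspaceT; exact: smooth_continuous.
have [M [Mr hM]] := compact_bounded cK.
exists (`|M| + 1) => [|p]; first by rewrite addr_ge0.
have [Kp|Kp] := pselect (closure [set p | f p != 0] p).
  by apply: (hM (`|M| + 1)); [rewrite (le_lt_trans (ler_norm M))// ltrDl|exists p].
by rewrite smooth_eq0// normr0 addr_ge0.
Qed.

Lemma smooth_partial_commute (i j : 'I_3) (s : seq 'I_3) p :
  partial i (partial j (foldr (@partial R) f s)) p = partial j (partial i (foldr (@partial R) f s)) p.
Proof.
apply: derive_commute.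
- by move=> q; apply: diff_derivable; exact: (sf s q).
- by move=> q; apply: diff_derivable; exact: (sf s q).
- by move=> q; apply: diff_derivable; exact: (sf (j :: s) q).
- by move=> q; apply: diff_derivable; exact: (sf (i :: s) q).
- exact: (@smooth_continuous (i :: j :: s)).
- exact: (@smooth_continuous (j :: i :: s)).
Qed.
End Support.

(** Right multiplication by a fixed point is affine, so a left factor moving on a line traces a
    line. Its direction depends on [r]: this is how the right-invariant fields enter. *)
Lemma hmul_line_left (s : R) (w p r : heis R) :
  hmul (s *: w + p) r =
  s *: (w.1.1, w.1.2, w.2 + (w.1.1 * r.1.2 - w.1.2 * r.1.1) / 2) + hmul p r.
Proof.
case: w p r => [[a b] c] [[x y] z] [[x' y'] z'] /=.
by congr (_, _, _); rewrite /GRing.scale/= /GRing.scale/=; field.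
Qed.

Definition dilation (rho : R) (q : heis R) : heis R :=
  (rho * q.1.1, rho * q.1.2, rho ^+ 2 * q.2).

(** Here the direction does not depend on [q], so derivatives in [q] of f (p . dilation rho q) have
    constant coefficients. *)
Lemma hmul_line_right (rho s : R) (v p q : heis R) :
  hmul p (dilation rho (s *: v + q)) =
  s *: (rho * v.1.1, rho * v.1.2, rho ^+ 2 * v.2 + rho * (p.1.1 * v.1.2 - p.1.2 * v.1.1) / 2)
    + hmul p (dilation rho q).
Proof.
case: v p q => [[a b] c] [[x y] z] [[x' y'] z']; rewrite /dilation /=.
by congr (_, _, _); rewrite /GRing.scale/= /GRing.scale/=; field.
Qed.

(** Makes the support in [q] of f (p . dilation rho q) bounded, uniformly for [p] in a ball, as is
    needed when [p] moves along a line. The horizontal coordinates are bounded first; they control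
    the bilinear term in the vertical one. *)
Lemma hmul_dilation_bound (rho P M : R) (p q : heis R) : 0 < rho -> `|p| <= P ->
  `|hmul p (dilation rho q)| <= M ->
  `|q| <= (M + P) / rho + (M + P + P * (M + P)) / rho ^+ 2.
Proof.
move=> r0; have r2 : 0 < rho ^+ 2 by rewrite exprn_gt0.
rewrite !norm_heis_le; case: p q => [[x y] z] [[x' y'] z'] /=.
move=> /and3P[px py pz] /and3P[mx my mz].
have P0 : 0 <= P := le_trans (normr_ge0 _) px.
have M0 : 0 <= M := le_trans (normr_ge0 _) mx.
have MP0 : 0 <= M + P by rewrite addr_ge0.
have a1 : `|rho * x'| <= M + P.
  by rewrite (_ : rho * x' = (x + rho * x') - x) ?(le_trans (ler_normB _ _)) ?lerD//; ring.
have a2 : `|rho * y'| <= M + P.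
  by rewrite (_ : rho * y' = (y + rho * y') - y) ?(le_trans (ler_normB _ _)) ?lerD//; ring.
have a3 : `|rho ^+ 2 * z'| <= M + P + P * (M + P).
  rewrite (_ : rho ^+ 2 * z' = (z + rho ^+ 2 * z' + (x * (rho * y') - y * (rho * x')) / 2) - z
     - (x * (rho * y') - y * (rho * x')) / 2); last by ring.
  rewrite (le_trans (ler_normB _ _))// lerD//.
    by rewrite (le_trans (ler_normB _ _))// lerD.
  rewrite normrM (@ger0_norm _ 2^-1)// ler_pdivrMr//.
  rewrite (le_trans (ler_normB _ _))// !normrM.
  have := ler_pM (normr_ge0 x) (normr_ge0 (rho * y')) px a2.
  have := ler_pM (normr_ge0 y) (normr_ge0 (rho * x')) py a1.
  rewrite !normrM; lra.
have N1 : 0 <= (M + P) / rho by rewrite divr_ge0// ltW.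
have N2 : 0 <= (M + P + P * (M + P)) / rho ^+ 2.
  by rewrite divr_ge0 ?(ltW r2)// addr_ge0// mulr_ge0.
move: a1 a2 a3; rewrite (normrM rho x') (normrM rho y') (normrM (rho ^+ 2) z') (gtr0_norm r0) (gtr0_norm r2) => a1 a2 a3.
apply/and3P; split.
- by rewrite (@le_trans _ _ ((M + P) / rho)) ?lerDl// ler_pdivlMr// mulrC.
- by rewrite (@le_trans _ _ ((M + P) / rho)) ?lerDl// ler_pdivlMr// mulrC.
- by rewrite (@le_trans _ _ ((M + P + P * (M + P)) / rho ^+ 2)) ?lerDr// ler_pdivlMr// mulrC.
Qed.
End TestFunctions.

(** * A calculus for integrability and vanishing divergences *)

Section LocallyBounded.
Context {R : realType}.
Local Notation RT := (measurableTypeR R).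
Local Notation H := (RT * RT * RT)%type.
Local Notation mu3 := (lebesgue3 R).
Implicit Types (k g : heis R -> R) (v : heis R).

Definition locbdd k := measurable_fun [set: H] (k : H -> R) /\
  forall M, exists2 B : R, 0 <= B & forall p, `|p| <= M -> `|k p| <= B.

Definition bounded_support k := exists M, forall p, M < `|p| -> k p = 0.

(** Only the single direction [v] is required because [h] is known to be differentiable only along
    the basis vectors. Closure under sums and products gives the integrability of the long
    expressions below from their shape, once one factor has bounded support. *)
Definition locbdd1 v k :=
  [/\ locbdd k, forall p, derivable k p v & locbdd ('D_v k)].

Lemma locbdd_bounded k C : measurable_fun [set: H] (k : H -> R) ->
  (forall p, `|k p| <= C) -> locbdd k.
Proof. by move=> mk kC; split=> // M; exists `|C| => // p _; rewrite (le_trans (kC p))// ler_norm. Qed.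

Lemma locbdd_cst (c : R) : locbdd (fun=> c).
Proof. by apply: (@locbdd_bounded _ `|c|) => //; exact: measurable_cst. Qed.

Lemma locbddD k g : locbdd k -> locbdd g -> locbdd (fun p => k p + g p).
Proof.
move=> [mk bk] [mg bg]; split=> [|M]; first exact: measurable_funD.
have [B1 B10 h1] := bk M; have [B2 B20 h2] := bg M.
exists (B1 + B2) => [|p pM]; first exact: addr_ge0.
by rewrite (le_trans (ler_normD _ _))// lerD ?h1 ?h2.
Qed.

Lemma locbddM k g : locbdd k -> locbdd g -> locbdd (fun p => k p * g p).
Proof.
move=> [mk bk] [mg bg]; split=> [|M]; first exact: measurable_funM.
have [B1 B10 h1] := bk M; have [B2 B20 h2] := bg M.
exists (B1 * B2) => [|p pM]; first exact: mulr_ge0.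
by rewrite normrM ler_pM ?h1 ?h2.
Qed.

Lemma locbddN k : locbdd k -> locbdd (fun p => - k p).
Proof.
move=> hk; have := locbddM (locbdd_cst (-1)) hk.
by under eq_fun do rewrite mulN1r.
Qed.

Lemma measurable_p1 : measurable_fun [set: H] (fun p : H => p.1.1).
Proof. exact: (measurableT_comp measurable_fst measurable_fst). Qed.

Lemma measurable_p2 : measurable_fun [set: H] (fun p : H => p.1.2).
Proof. exact: (measurableT_comp measurable_snd measurable_fst). Qed.

Lemma measurable_p3 : measurable_fun [set: H] (fun p : H => p.2).
Proof. exact: measurable_snd. Qed.

Lemma locbdd_p1 : locbdd (fun p => p.1.1).
Proof.
split=> [|M]; first exact: measurable_p1.
by exists `|M| => // p; rewrite norm_heis_le => /and3P[h _ _]; rewrite (le_trans h)// ler_norm.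
Qed.

Lemma locbdd_p2 : locbdd (fun p => p.1.2).
Proof.
split=> [|M]; first exact: measurable_p2.
by exists `|M| => // p; rewrite norm_heis_le => /and3P[_ h _]; rewrite (le_trans h)// ler_norm.
Qed.

Lemma integrable_locbdd k : locbdd k -> bounded_support k ->
  mu3.-integrable setT (EFin \o (k : H -> R)).
Proof.
move=> [mk bk] [M kM]; have [B B0 h] := bk M.
apply: (@integrable_bounded_support _ _ B M) => // p.
by have [/h//|/kM ->] := leP `|p| M; rewrite normr0.
Qed.

Lemma bounded_supportMl k g : bounded_support g -> bounded_support (fun p => k p * g p).
Proof. by move=> [M hM]; exists M => p /hM ->; rewrite mulr0. Qed.

Lemma bounded_supportMr k g : bounded_support k -> bounded_support (fun p => k p * g p).
Proof. by move=> [M hM]; exists M => p /hM ->; rewrite mul0r. Qed.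

Lemma bounded_supportD k g : bounded_support k -> bounded_support g ->
  bounded_support (fun p => k p + g p).
Proof.
move=> [M1 h1] [M2 h2]; exists (Num.max M1 M2) => p; rewrite gt_max => /andP[p1 p2].
by rewrite h1// h2// addr0.
Qed.

Lemma bounded_support_derive k v : bounded_support k -> bounded_support ('D_v k).
Proof. by move=> [M hM]; exists M => p; exact: derive_eq0_outside. Qed.

Lemma locbdd1M v k g : locbdd1 v k -> locbdd1 v g -> locbdd1 v (fun p => k p * g p).
Proof.
move=> [bk dk bdk] [bg dg bdg]; split.
- exact: locbddM.
- by move=> p; apply: derivableM.
- have -> : 'D_v (fun p => k p * g p) = (fun p => k p * 'D_v g p + g p * 'D_v k p).
    by apply/funext => p; rewrite deriveM.
  by apply: locbddD; apply: locbddM.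
Qed.

Lemma locbdd1D v k g : locbdd1 v k -> locbdd1 v g -> locbdd1 v (fun p => k p + g p).
Proof.
move=> [bk dk bdk] [bg dg bdg]; split.
- exact: locbddD.
- by move=> p; apply: derivableD.
- have -> : 'D_v (fun p => k p + g p) = (fun p => 'D_v k p + 'D_v g p).
    by apply/funext => p; rewrite deriveD.
  exact: locbddD.
Qed.

Lemma locbdd1_cst v (c : R) : locbdd1 v (fun=> c).
Proof.
split; [exact: locbdd_cst|by move=> p; exact: derivable_cst|].
rewrite (_ : 'D_v _ = fun=> 0); first exact: locbdd_cst.
by apply/funext => p; exact: derive_cst.
Qed.

Lemma derive_p1 v p : derivable (fun p : heis R => p.1.1) p v /\ 'D_v (fun p : heis R => p.1.1) p = v.1.1.
Proof.
pose phi (x : R) : R := x * v.1.1 + p.1.1.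
have fl : forall s, (fun p : heis R => p.1.1) (s *: v + p) = phi (s + 0).
  by move=> s; rewrite addr0.
have d : is_derive (0 : R) 1 phi v.1.1.
  by apply: is_derive_eq; rewrite /GRing.scale/=; ring.
split; first by apply: (proj2 (derivable_line (f := fun p : heis R => p.1.1) (phi := phi) fl)); case: d.
by rewrite (derive_line (f := fun p : heis R => p.1.1) (phi := phi) fl); case: d.
Qed.

Lemma derive_p2 v p : derivable (fun p : heis R => p.1.2) p v /\ 'D_v (fun p : heis R => p.1.2) p = v.1.2.
Proof.
pose phi (x : R) : R := x * v.1.2 + p.1.2.
have fl : forall s, (fun p : heis R => p.1.2) (s *: v + p) = phi (s + 0).
  by move=> s; rewrite addr0.
have d : is_derive (0 : R) 1 phi v.1.2.
  by apply: is_derive_eq; rewrite /GRing.scale/=; ring.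
split; first by apply: (proj2 (derivable_line (f := fun p : heis R => p.1.2) (phi := phi) fl)); case: d.
by rewrite (derive_line (f := fun p : heis R => p.1.2) (phi := phi) fl); case: d.
Qed.

Lemma locbdd1_p1 v : locbdd1 v (fun p => p.1.1).
Proof.
split; [exact: locbdd_p1|by move=> p; have [] := derive_p1 v p|].
rewrite (_ : 'D_v _ = fun=> v.1.1); first exact: locbdd_cst.
by apply/funext => p; have [] := derive_p1 v p.
Qed.

Lemma locbdd1_p2 v : locbdd1 v (fun p => p.1.2).
Proof.
split; [exact: locbdd_p2|by move=> p; have [] := derive_p2 v p|].
rewrite (_ : 'D_v _ = fun=> v.1.2); first exact: locbdd_cst.
by apply/funext => p; have [] := derive_p2 v p.
Qed.

Lemma locbdd1_h i : locbdd1 (basis3 R i) (@h R).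
Proof.
have [C C0 hC] := @h_partial R.
have dh p : derivable (@h R) p (basis3 R i) by have [] := hC i p.
split=> //.
  apply: (@locbdd_bounded _ C); first exact: measurable_h.
  by move=> p; have [/andP[h0 h1] _ _] := hC i p; rewrite ger0_norm.
split; first by apply: measurable_derive3 => //; exact: measurable_h.
move=> M; exists (C * (1 + `|M|)) => [|p pM]; first by rewrite mulr_ge0// addr_ge0.
have [_ _ b] := hC i p; apply: (le_trans b).
by rewrite ler_wpM2l// lerD2l (le_trans pM)// ler_norm.
Qed.

Lemma integral_locbdd1 v k : locbdd1 v k -> bounded_support k ->
  \int[mu3]_p ('D_v k p) = 0.
Proof.
move=> [[mk bk] dk [mdk bdk]] [M kM].
have [B1 B10 h1] := bk M; have [B2 B20 h2] := bdk M.
apply: (@integral_derive_eq0 _ _ _ (B1 + B2) M) => // p.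
- have [/h1 h|/kM ->] := leP `|p| M; last by rewrite normr0 addr_ge0.
  by rewrite (le_trans h)// lerDl.
- have [/h2 h|pM] := leP `|p| M; first by rewrite (le_trans h)// lerDr.
  by rewrite (derive_eq0_outside v kM pM)// normr0 addr_ge0.
Qed.
End LocallyBounded.

Section Semigroup.
Context {R : realType}.
Local Notation RT := (measurableTypeR R).
Local Notation H := (RT * RT * RT)%type.
Local Notation mu3 := (lebesgue3 R).

Lemma measurable_dilation (rho : R) : measurable_fun [set: H] (dilation rho : H -> H).
Proof.
apply: measurable_fun_pair; first apply: measurable_fun_pair.
- by apply: measurable_funM; [exact: measurable_cst|exact: measurable_p1].
- by apply: measurable_funM; [exact: measurable_cst|exact: measurable_p2].
- by apply: measurable_funM; [exact: measurable_cst|exact: measurable_p3].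
Qed.

Lemma measurable_hmul (p : heis R) : measurable_fun [set: H] (hmul p : H -> H).
Proof.
have -> : (hmul p : H -> H) = fun q : H => (p.1.1 + q.1.1, p.1.2 + q.1.2,
    p.2 + q.2 + (p.1.1 * q.1.2 - p.1.2 * q.1.1) / 2) :> H.
  by apply/funext => -[[x y] z]; case: p => [[a b] c].
have c0 c : measurable_fun [set: H] (fun _ : H => c : R) by exact: measurable_cst.
apply: measurable_fun_pair; first apply: measurable_fun_pair.
- by apply: measurable_funD => //; exact: measurable_p1.
- by apply: measurable_funD => //; exact: measurable_p2.
- apply: measurable_funD.
    by apply: measurable_funD => //; exact: measurable_p3.
  apply: measurable_funM => //; apply: measurable_funB; apply: measurable_funM => //.
    exact: measurable_p2.
  exact: measurable_p1.
Qed.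

Lemma dilationV (rho : R) (q : heis R) :
  dilation rho^-1 q = (q.1.1 / rho, q.1.2 / rho, q.2 / rho ^+ 2).
Proof. by rewrite /dilation exprVn; congr (_, _, _); rewrite mulrC. Qed.

Lemma dilationVK (rho : R) (q : heis R) : 0 < rho -> dilation rho^-1 (dilation rho q) = q.
Proof.
move=> r0; case: q => [[x y] z]; rewrite /dilation /= exprVn.
by rewrite !mulKf ?expf_neq0 ?gt_eqF.
Qed.

Lemma measurable_heat_kernel (rho : R) : 0 < rho ->
  measurable_fun [set: H] (heat_kernel (rho ^+ 2) : H -> R).
Proof.
move=> r0.
have -> : (heat_kernel (rho ^+ 2) : H -> R) =
    fun q : H => (rho ^+ 2 * rho ^+ 2)^-1 * h (dilation rho^-1 q).
  apply/funext => q; rewrite dilationV.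
  exact: heat_kernel_scale.
apply: measurable_funM; first exact: measurable_cst.
by apply: (measurableT_comp (@measurable_h R)); exact: measurable_dilation.
Qed.

(** The Jacobian rho^4 of the dilation cancels the factor of [heat_kernel_scale]. *)
Lemma heat_semigroup_dilation (rho : R) (g : heis R -> R) (p : heis R) : 0 < rho ->
  measurable_fun [set: H] (g : H -> R) ->
  mu3.-integrable setT (EFin \o (fun q : H => g (hmul p (dilation rho q)) * h q)) ->
  heat_semigroup (rho ^+ 2) g p = \int[mu3]_q (g (hmul p (dilation rho q)) * h q).
Proof.
move=> r0 mg ig; rewrite /heat_semigroup sqrf_eq0 (gt_eqF r0).
have r2 : 0 < rho ^+ 2 by rewrite exprn_gt0.
pose G (q : H) : R := g (hmul p q) * heat_kernel (rho ^+ 2) q.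
have mG : measurable_fun [set: H] G.
  apply: measurable_funM; last exact: measurable_heat_kernel.
  exact: (measurableT_comp mg (measurable_hmul p)).
have k0 : (rho ^+ 2 * rho ^+ 2)^-1 != 0 by rewrite invr_eq0 mulf_neq0// gt_eqF.
apply: (mulfI k0); rewrite -[LHS](@Rintegral_affine3 R rho (rho ^+ 2) (0, 0, 0) G r0 r2 mG).
rewrite -RintegralZl//; apply: eq_Rintegral => q _.
have -> : affine3 rho (rho ^+ 2) (0, 0, 0) q = dilation rho q.
  by rewrite /affine3 /dilation /= !addr0.
rewrite /G (heat_kernel_scale _ r0) -dilationV (dilationVK _ r0).
exact: mulrCA.
Qed.

Section SmoothFunctions.
Variables (f : heis R -> R) (rho : R) (p : heis R).
Hypotheses (sf : smooth f) (cf : compactly_supported f) (r0 : 0 < rho).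

Let m (q : heis R) := hmul p (dilation rho q).

Lemma bounded_support_comp (g : heis R -> R) : bounded_support g ->
  bounded_support (fun q => g (m q)).
Proof.
move=> [M hM]; exists ((M + `|p|) / rho + (M + `|p| + `|p| * (M + `|p|)) / rho ^+ 2) => q hq.
apply: hM; rewrite ltNge; apply/negP => mM.
by have := hmul_dilation_bound r0 (lexx `|p|) mM; rewrite leNgt hq.
Qed.

Lemma smooth_bounded_support (s : seq 'I_3) : bounded_support (foldr (@partial R) f s).
Proof. by have [M _ hM] := smooth_support cf; exists M => q; exact: hM. Qed.

Lemma measurable_smooth (s : seq 'I_3) : measurable_fun [set: H] (foldr (@partial R) f s : H -> R).
Proof. by apply: measurable_continuous3; exact: smooth_continuous. Qed.

Lemma locbdd_smooth_comp (s : seq 'I_3) : locbdd (fun q => foldr (@partial R) f s (m q)).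
Proof.
have [C C0 hC] := smooth_bounded sf cf s.
apply: (@locbdd_bounded _ _ C) => //.
apply: (measurableT_comp (measurable_smooth s)).
exact: (measurableT_comp (measurable_hmul p) (measurable_dilation rho)).
Qed.

Lemma locbdd_h : locbdd (@h R).
Proof. by have [] := @locbdd1_h R 0. Qed.

Lemma heat_semigroup_smooth (s : seq 'I_3) :
  heat_semigroup (rho ^+ 2) (foldr (@partial R) f s) p =
  \int[mu3]_q (foldr (@partial R) f s (m q) * h q).
Proof.
apply: heat_semigroup_dilation => //; first exact: measurable_smooth.
apply: (integrable_locbdd (locbddM (locbdd_smooth_comp s) locbdd_h)).
exact: (bounded_supportMr _ (bounded_support_comp (smooth_bounded_support s))).
Qed.
End SmoothFunctions.

Definition left_direction (rho : R) (v q : heis R) : heis R :=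
  (v.1.1, v.1.2, v.2 + (v.1.1 * (rho * q.1.2) - v.1.2 * (rho * q.1.1)) / 2).

Lemma derive_heat_semigroup (f : heis R -> R) (rho : R) (p v : heis R) :
  smooth f -> compactly_supported f -> 0 < rho ->
  'D_v (heat_semigroup (rho ^+ 2) f) p =
  \int[mu3]_q ('D_(left_direction rho v q) f (hmul p (dilation rho q)) * h q).
Proof.
move=> sf cf r0.
pose Phi (s : R) (q : H) : R := f (hmul (s *: v + p) (dilation rho q)).
pose F (s : R) := \int[mu3]_q (Phi s q * h q).
have Fl : forall s, heat_semigroup (rho ^+ 2) f (s *: v + p) = F (s + 0).
  by move=> s; rewrite addr0 (heat_semigroup_smooth (s *: v + p) sf cf r0 [::]).
have Pl s0 q : forall s, f (s *: left_direction rho v q + hmul (s0 *: v + p) (dilation rho q)) =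
    Phi (s + s0) q.
  by move=> s; rewrite /Phi scalerDl -addrA (hmul_line_left s).
have df q : differentiable f q := sf [::] q.
have DP s q : 'D_1 (Phi ^~ q) s = 'D_(left_direction rho v q) f (hmul (s *: v + p) (dilation rho q)).
  by rewrite (derive_line (phi := Phi ^~ q) (Pl s q)).
have [M M0 hM] := smooth_support cf.
have [C C0 hC] := smooth_bounded sf cf [::].
have [C1 C10 hC1] := smooth_bounded sf cf [:: 0].
have [C2 C20 hC2] := smooth_bounded sf cf [:: 1].
have [C3 C30 hC3] := smooth_bounded sf cf [:: 2].
have [K K0 hK] := @h_partial R.
(* [P] bounds |s v + p| for |s| < 1, and [M'] is the resulting radius in [q] of the support. On that
   ball, [D] below bounds the derivative through its three coordinates. *)
pose P := `|p| + `|v|.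
pose M' := (M + P) / rho + (M + P + P * (M + P)) / rho ^+ 2.
have out s (q : heis R) : `|s| < 1 -> M' < `|q| -> M < `|hmul (s *: v + p) (dilation rho q)|.
  move=> s1; rewrite !ltNge; apply: contra => hq.
  apply: (hmul_dilation_bound r0 _ hq); rewrite /P addrC.
  by rewrite (le_trans (ler_normD _ _))// lerD2l normrZ ler_piMl// ltW.
have P0 : 0 <= P by rewrite addr_ge0.
have M'0 : 0 <= M' by rewrite addr_ge0// divr_ge0 ?addr_ge0 ?mulr_ge0 ?addr_ge0 ?exprn_ge0// ltW.
have rM0 : 0 <= rho * M' by rewrite mulr_ge0// ltW.
pose D := `|v| * C1 + `|v| * C2 + (`|v| + `|v| * (rho * M')) * C3.
have D0 : 0 <= D.
  by rewrite /D; repeat first [assumption | exact: normr_ge0 | apply: addr_ge0 | apply: mulr_ge0].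
have [] := @derive_under_integral3 R Phi (@h R) (C + D) K M'.
- exact: measurable_h.
- by move=> q; have [/andP[h0 h1] _ _] := hK 0 q; rewrite ger0_norm.
- move=> s; apply: (measurableT_comp (measurable_smooth sf [::])).
  exact: (measurableT_comp (measurable_hmul _) (measurable_dilation rho)).
- move=> s q; apply: (proj1 (derivable_line (phi := Phi ^~ q) (Pl s q))).
  exact: diff_derivable.
- by move=> s q _; apply: (le_trans (hC _)); rewrite lerDl.
- move=> s q s1; rewrite DP; have [qM|qM] := leP `|q : heis R| M'; last first.
    by rewrite (derive_eq0_outside _ (hM [::]) (out _ _ s1 qM)) normr0 addr_ge0.
  rewrite derive_basis3// /left_direction /=.
  move: (lexx `|v|) qM; rewrite (norm_heis_le _ v) (norm_heis_le _ q).
  move=> /and3P[v1 v2 v3] /and3P[q1 q2 _].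
  apply: (@le_trans _ _ D); last by rewrite lerDr.
  rewrite (le_trans (ler_normD _ _))// lerD//.
    rewrite (le_trans (ler_normD _ _))// lerD// normrM ler_pM//.
      exact: hC1.
    exact: hC2.
  rewrite normrM ler_pM//; last exact: hC3.
  rewrite (le_trans (ler_normD _ _))// lerD//.
  rewrite normrM (@ger0_norm _ 2^-1)// ler_pdivrMr// (le_trans (ler_normB _ _))//.
  by rewrite mulr_natr mulr2n lerD// normrM ler_pM// normrM (gtr0_norm r0) ler_wpM2l// ltW.
- by move=> s q s1 /(out _ _ s1); exact: (hM [::]).
- move=> s q s1 /(out _ _ s1) h'; rewrite DP.
  by apply: derive_eq0_outside h'; exact: (hM [::]).
move=> _; rewrite (derive_line (phi := F) Fl) => ->.
by apply: eq_Rintegral => q _; rewrite DP scale0r add0r.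
Qed.
End Semigroup.

(** * The commutation formula *)

Section Commutation.
Context {R : realType}.
Local Notation RT := (measurableTypeR R).
Local Notation H := (RT * RT * RT)%type.
Local Notation mu3 := (lebesgue3 R).
Variables (f : heis R -> R) (rho : R) (p : heis R).
Hypotheses (sf : smooth f) (cf : compactly_supported f) (r0 : 0 < rho).

Let m (q : heis R) := hmul p (dilation rho q).
Let F (s : seq 'I_3) (q : heis R) : R := foldr (@partial R) f s (m q).

Definition right_direction (v : heis R) : heis R :=
  (rho * v.1.1, rho * v.1.2, rho ^+ 2 * v.2 + rho * (p.1.1 * v.1.2 - p.1.2 * v.1.1) / 2).

Let locF s : locbdd (F s). Proof. exact: locbdd_smooth_comp. Qed.

Let suppF s : bounded_support (F s).
Proof. exact: bounded_support_comp (smooth_bounded_support cf s). Qed.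

Let derF s v q : derivable (F s) q v /\
  'D_v (F s) q = (right_direction v).1.1 * F (0 :: s) q +
    (right_direction v).1.2 * F (1 :: s) q + (right_direction v).2 * F (2 :: s) q.
Proof.
have d : differentiable (foldr (@partial R) f s) (m q) := sf s (m q).
pose phi (x : R) : R := foldr (@partial R) f s (x *: right_direction v + m q).
have fl1 : forall x, F s (x *: v + q) = phi (x + 0).
  by move=> x; rewrite addr0 /F /m hmul_line_right.
have fl2 : forall x, foldr (@partial R) f s (x *: right_direction v + m q) = phi (x + 0).
  by move=> x; rewrite addr0.
split.
  apply: (proj2 (derivable_line (phi := phi) fl1)).
  apply: (proj1 (derivable_line (phi := phi) fl2)).
  exact: diff_derivable.
rewrite (derive_line (phi := phi) fl1) -(derive_line (phi := phi) fl2).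
exact: derive_basis3.
Qed.

Let loc1F s v : locbdd1 v (F s).
Proof.
split; [exact: locF|by move=> q; have [] := derF s v q|].
have -> : 'D_v (F s) = fun q => (right_direction v).1.1 * F (0 :: s) q +
    (right_direction v).1.2 * F (1 :: s) q + (right_direction v).2 * F (2 :: s) q.
  by apply/funext => q; have [] := derF s v q.
by apply: locbddD; [apply: locbddD|]; apply: locbddM; (exact: locbdd_cst || exact: locF).
Qed.

Let u1 (q : heis R) : R := F [:: 0] q - (p.1.2 + rho * q.1.2) / 2 * F [:: 2] q.
Let u2 (q : heis R) : R := F [:: 1] q + (p.1.1 + rho * q.1.1) / 2 * F [:: 2] q.

Lemma u1E q : u1 q = fieldX f (m q).
Proof. by rewrite /fieldX /u1 /F /m; case: p q => [[x y] z] [[x' y'] z']. Qed.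

Lemma u2E q : u2 q = fieldY f (m q).
Proof. by rewrite /fieldY /u2 /F /m; case: p q => [[x y] z] [[x' y'] z']. Qed.

Let loc1u1 v : locbdd1 v u1.
Proof.
have -> : u1 = fun q => F [:: 0] q + (- 2^-1 * (p.1.2 + rho * q.1.2)) * F [:: 2] q.
  by apply/funext => q; rewrite /u1; field.
apply: locbdd1D => //; apply: locbdd1M => //; apply: locbdd1M; first exact: locbdd1_cst.
apply: locbdd1D; first exact: locbdd1_cst.
by apply: locbdd1M; [exact: locbdd1_cst|exact: locbdd1_p2].
Qed.

Let loc1u2 v : locbdd1 v u2.
Proof.
have -> : u2 = fun q => F [:: 1] q + (2^-1 * (p.1.1 + rho * q.1.1)) * F [:: 2] q.
  by apply/funext => q; rewrite /u2; field.
apply: locbdd1D => //; apply: locbdd1M => //; apply: locbdd1M; first exact: locbdd1_cst.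
apply: locbdd1D; first exact: locbdd1_cst.
by apply: locbdd1M; [exact: locbdd1_cst|exact: locbdd1_p1].
Qed.

Let suppu1 : bounded_support u1.
Proof.
have -> : u1 = fun q => F [:: 0] q + (- 2^-1 * (p.1.2 + rho * q.1.2)) * F [:: 2] q.
  by apply/funext => q; rewrite /u1; field.
by apply: bounded_supportD => //; apply: bounded_supportMl.
Qed.

Let suppu2 : bounded_support u2.
Proof.
have -> : u2 = fun q => F [:: 1] q + (2^-1 * (p.1.1 + rho * q.1.1)) * F [:: 2] q.
  by apply/funext => q; rewrite /u2; field.
by apply: bounded_supportD => //; apply: bounded_supportMl.
Qed.

Variables a b : R.

Let kap (q : heis R) : R := (a * q.1.2 - b * q.1.1) * h q.

Let loc1kap i : locbdd1 (basis3 R i) kap.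
Proof.
apply: locbdd1M; last exact: locbdd1_h.
have -> : (fun q : heis R => a * q.1.2 - b * q.1.1) = fun q => a * q.1.2 + (- b) * q.1.1.
  by apply/funext => q; rewrite mulNr.
apply: locbdd1D; apply: locbdd1M; (exact: locbdd1_cst || exact: locbdd1_p1 || exact: locbdd1_p2).
Qed.

(* Ii comes from differentiating under the integral, through the
   right-invariant fields; it differs from Ji by a divergence. *)
Let Ii (q : heis R) : R := (a * (u1 q + rho * q.1.2 * F [:: 2] q) +
   b * (u2 q - rho * q.1.1 * F [:: 2] q)) * h q.
Let Ji (q : heis R) : R := 2 * (a * u1 q + b * u2 q) * h q +
   (a * q.1.2 - b * q.1.1) * (u1 q * fieldY (@h R) q - u2 q * fieldX (@h R) q).
(** These are the components of a divergence: X (kap u2) is the derivative of [G1] in x minus that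
    of [G2] in z, and Y (kap u1) is the derivative of [G3] in y plus that of [G4] in z. *)
Let G1 (q : heis R) : R := kap q * u2 q.
Let G2 (q : heis R) : R := 2^-1 * q.1.2 * kap q * u2 q.
Let G3 (q : heis R) : R := kap q * u1 q.
Let G4 (q : heis R) : R := 2^-1 * q.1.1 * kap q * u1 q.

(** [Ii] is (a u1 + b u2) h plus kap times rho Z f at m q, and rho Z f there is X u2 - Y u1. By the
    product rule, what remains besides the divergence is u1 Y kap - u2 X kap. Since X and Y send a y
    - b x to - b and a, this contains a second copy of (a u1 + b u2) h. *)
Lemma commutation_identity q : Ii q = Ji q +
  ('D_(basis3 R 0) G1 q - 'D_(basis3 R 2) G2 q - ('D_(basis3 R 1) G3 q + 'D_(basis3 R 2) G4 q)).
Proof.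
have dF s i : is_derive q (basis3 R i) (F s) ((right_direction (basis3 R i)).1.1 * F (0 :: s) q +
    (right_direction (basis3 R i)).1.2 * F (1 :: s) q + (right_direction (basis3 R i)).2 * F (2 :: s) q).
  by have [? ?] := derF s (basis3 R i) q; apply: DeriveDef.
have dh i : is_derive q (basis3 R i) (@h R) (partial i (@h R) q).
  have [C _ hC] := @h_partial R; have [_ dh _] := hC i q.
  by apply: DeriveDef.
have dp1 i : is_derive q (basis3 R i) (fun q : heis R => q.1.1) (basis3 R i).1.1.
  by have [? ?] := derive_p1 (basis3 R i) q; apply: DeriveDef.
have dp2 i : is_derive q (basis3 R i) (fun q : heis R => q.1.2) (basis3 R i).1.2.
  by have [? ?] := derive_p2 (basis3 R i) q; apply: DeriveDef.
have sw i j : F [:: i; j] q = F [:: j; i] q by exact: (smooth_partial_commute sf i j [::]).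
rewrite /G1 /G2 /G3 /G4 /kap /u1 /u2 !derive_val.
rewrite /GRing.scale/= /right_direction /=.
(* Ordering the second partial derivatives cancels them in X u2 - Y u1, which is the relation [X, Y]
   = Z. A polynomial identity remains. *)
rewrite (sw 1 0) (sw 2 0) (sw 2 1) /Ii /Ji /u1 /u2 /fieldX /fieldY.
move: (F [:: 0] q) (F [:: 1] q) (F [:: 2] q) (F [:: 0; 0] q) (F [:: 0; 1] q)
  (F [:: 0; 2] q) (F [:: 1; 1] q) (F [:: 1; 2] q) (F [:: 2; 2] q).
move: (partial 0 (@h R) q) (partial 1 (@h R) q) (partial 2 (@h R) q) (h q).
move: q.1.1 q.1.2 p.1.1 p.1.2 => *.
rewrite !(mulr0, mulr1, addr0, add0r, sub0r, subr0, mul0r).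
by field.
Qed.

Let loc1G1 : locbdd1 (basis3 R 0) G1. Proof. exact: locbdd1M. Qed.

Let loc1q1kap i : locbdd1 (basis3 R i) (fun q => 2^-1 * q.1.1 * kap q).
Proof.
by apply: locbdd1M => //; apply: locbdd1M; [exact: locbdd1_cst|exact: locbdd1_p1].
Qed.

Let loc1q2kap i : locbdd1 (basis3 R i) (fun q => 2^-1 * q.1.2 * kap q).
Proof.
by apply: locbdd1M => //; apply: locbdd1M; [exact: locbdd1_cst|exact: locbdd1_p2].
Qed.

Let loc1G2 : locbdd1 (basis3 R 2) G2. Proof. exact: locbdd1M. Qed.
Let loc1G3 : locbdd1 (basis3 R 1) G3. Proof. exact: locbdd1M. Qed.
Let loc1G4 : locbdd1 (basis3 R 2) G4. Proof. exact: locbdd1M. Qed.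

Let suppG1 : bounded_support G1. Proof. exact: bounded_supportMl. Qed.
Let suppG2 : bounded_support G2. Proof. exact: bounded_supportMl. Qed.
Let suppG3 : bounded_support G3. Proof. exact: bounded_supportMl. Qed.
Let suppG4 : bounded_support G4. Proof. exact: bounded_supportMl. Qed.

Let intD v k : locbdd1 v k -> bounded_support k ->
  mu3.-integrable setT (EFin \o ('D_v k : H -> R)).
Proof. by move=> [_ _ l] /(bounded_support_derive v) s; exact: integrable_locbdd l s. Qed.

Lemma locbdd_partial_h i : locbdd (partial i (@h R)).
Proof. by have [_ _] := @locbdd1_h R i. Qed.

Lemma locbdd_fieldX_h : locbdd (fieldX (@h R)).
Proof.
have -> : fieldX (@h R) = fun q => partial 0 (@h R) q + (- 2^-1 * q.1.2) * partial 2 (@h R) q.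
  by apply/funext => q; rewrite /fieldX; move: (partial 0 _ q) (partial 2 _ q) => *; field.
apply: locbddD; first exact: locbdd_partial_h.
apply: locbddM; last exact: locbdd_partial_h.
by apply: locbddM; [exact: locbdd_cst|exact: locbdd_p2].
Qed.

Lemma locbdd_fieldY_h : locbdd (fieldY (@h R)).
Proof.
have -> : fieldY (@h R) = fun q => partial 1 (@h R) q + (2^-1 * q.1.1) * partial 2 (@h R) q.
  by apply/funext => q; rewrite /fieldY; move: (partial 1 _ q) (partial 2 _ q) => *; field.
apply: locbddD; first exact: locbdd_partial_h.
apply: locbddM; last exact: locbdd_partial_h.
by apply: locbddM; [exact: locbdd_cst|exact: locbdd_p1].
Qed.

Let locu1 : locbdd u1. Proof. by have [] := loc1u1 0. Qed.
Let locu2 : locbdd u2. Proof. by have [] := loc1u2 0. Qed.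

Lemma integrable_commutator : mu3.-integrable setT (EFin \o (Ji : H -> R)).
Proof.
have lab : locbdd (fun q : heis R => a * q.1.2 + (- b) * q.1.1).
  by apply: locbddD; apply: locbddM; (exact: locbdd_cst || exact: locbdd_p1 || exact: locbdd_p2).
have -> : (Ji : H -> R) = fun q => 2 * (a * u1 q + b * u2 q) * h q +
    (a * q.1.2 + (- b) * q.1.1) * (u1 q * fieldY (@h R) q + (- fieldX (@h R) q) * u2 q).
  apply/funext => q; rewrite /Ji; move: (fieldX _ q) (fieldY _ q) (u1 q) (u2 q) (h q) => *; ring.
apply: integrable_locbdd.
- apply: locbddD.
    apply: locbddM; last exact: locbdd_h.
    apply: locbddM; first exact: locbdd_cst.
    by apply: locbddD; apply: locbddM => //; exact: locbdd_cst.
  apply: locbddM => //; apply: locbddD.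
    by apply: locbddM => //; exact: locbdd_fieldY_h.
  by apply: locbddM => //; apply: locbddN; exact: locbdd_fieldX_h.
- apply: bounded_supportD.
    apply: bounded_supportMr; apply: bounded_supportMl.
    by apply: bounded_supportD; apply: bounded_supportMl.
  apply: bounded_supportMl; apply: bounded_supportD.
    exact: bounded_supportMr.
  exact: bounded_supportMl.
Qed.

Lemma integral_commutation : \int[mu3]_q Ii q = \int[mu3]_q Ji q.
Proof.
have i1 := intD loc1G1 suppG1; have i2 := intD loc1G2 suppG2.
have i3 := intD loc1G3 suppG3; have i4 := intD loc1G4 suppG4.
have iJ := integrable_commutator.
have e1 := integral_locbdd1 loc1G1 suppG1; have e2 := integral_locbdd1 loc1G2 suppG2.
have e3 := integral_locbdd1 loc1G3 suppG3; have e4 := integral_locbdd1 loc1G4 suppG4.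
have -> : (fun q : H => Ii q) = fun q : H => Ji q + (('D_(basis3 R 0) G1 q - 'D_(basis3 R 2) G2 q) -
    ('D_(basis3 R 1) G3 q + 'D_(basis3 R 2) G4 q)).
  by apply/funext => q; exact: commutation_identity.
have i34 := integrable_addr i3 i4.
have i12 : mu3.-integrable setT (EFin \o (fun q : H => 'D_(basis3 R 0) G1 q - 'D_(basis3 R 2) G2 q)).
  exact: (integrableB measurableT i1 i2).
rewrite (RintegralD measurableT iJ (integrableB measurableT i12 i34)).
rewrite (RintegralB measurableT i12 i34) (RintegralB measurableT i1 i2) (RintegralD measurableT i3 i4).
by rewrite e1 e2 e3 e4 subrr addr0 subrr addr0.
Qed.

Lemma gradient_heat_semigroup :
  a * fieldX (heat_semigroup (rho ^+ 2) f) p + b * fieldY (heat_semigroup (rho ^+ 2) f) p =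
  \int[mu3]_q Ji q.
Proof.
rewrite -integral_commutation.
pose K s (q : H) : R := F s q * h q.
have iK g s : locbdd g -> mu3.-integrable setT (EFin \o (fun q : H => g q * K s q)).
  move=> lg; apply: integrable_locbdd.
    by apply: locbddM => //; apply: locbddM => //; exact: locbdd_h.
  by apply: bounded_supportMl; apply: bounded_supportMr.
pose T i (q : H) : R := (basis3 R i).1.1 * K [:: 0] q + (basis3 R i).1.2 * K [:: 1] q +
      (left_direction rho (basis3 R i) q).2 * K [:: 2] q.
have alg (x y z A B C D : R) :
  (x * A + y * B + z * C) * D = x * (A * D) + y * (B * D) + z * (C * D) by ring.
have dP i : partial i (heat_semigroup (rho ^+ 2) f) p = \int[mu3]_q T i q.
  rewrite /partial derive_heat_semigroup//; apply: eq_Rintegral => q _.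
  have d : differentiable f (hmul p (dilation rho q)) := sf [::] _.
  by rewrite (derive_basis3 _ d) /T /K /F /= alg.
have lld i : locbdd (fun q : heis R => (left_direction rho (basis3 R i) q).2).
  rewrite /left_direction /=.
  have -> : (fun q : heis R => (basis3 R i).2 + ((basis3 R i).1.1 * (rho * q.1.2) - (basis3 R i).1.2 * (rho * q.1.1)) / 2) =
    fun q => (basis3 R i).2 + ((basis3 R i).1.1 * rho / 2 * q.1.2 + (- (basis3 R i).1.2 * rho / 2) * q.1.1).
    by apply/funext => q; move: (basis3 R i).2 (basis3 R i).1.2 (basis3 R i).1.1 => *; field.
  apply: locbddD; first exact: locbdd_cst.
  by apply: locbddD; apply: locbddM; (exact: locbdd_cst || exact: locbdd_p1 || exact: locbdd_p2).
have iT i : mu3.-integrable setT (EFin \o T i).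
  apply: integrable_addr; last exact: iK.
  by apply: integrable_addr; apply: iK; exact: locbdd_cst.
(* [T i] is the integrand of the i-th partial derivative of the semigroup. The coefficient (b x - a
   y) / 2 of [T 2] is the vertical part of a X + b Y at p. *)
have -> : (fun q : H => Ii q) = fun q : H => a * T 0 q +
    ((b * p.1.1 / 2 - a * p.1.2 / 2) * T 2 q + b * T 1 q).
  apply/funext => q; rewrite /Ii /T /left_direction /K basis3_0 basis3_1 basis3_2 /= /u1 /u2.
  move: (F [:: 0] q) (F [:: 1] q) (F [:: 2] q) (h q) => *.
  by rewrite !(mulr0, mulr1, addr0, add0r, sub0r, subr0, mul0r); field.
have iaT := integrable_scale a (iT 0); have ibT := integrable_scale b (iT 1).
have icT := integrable_scale (b * p.1.1 / 2 - a * p.1.2 / 2) (iT 2).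
rewrite (RintegralD measurableT iaT (integrable_addr icT ibT)) (RintegralD measurableT icT ibT).
rewrite !RintegralZl//; [|exact: iT..].
rewrite /fieldX /fieldY !dP.
move: (\int[mu3]_q T 0 q) (\int[mu3]_q T 1 q) (\int[mu3]_q T 2 q) => *.
by field.
Qed.

Definition gradient_integrand (q : heis R) : R :=
  2 * (a * fieldX f (m q) + b * fieldY f (m q)) * h q +
  (a * q.1.2 - b * q.1.1) *
    (fieldX f (m q) * fieldY (@h R) q - fieldY f (m q) * fieldX (@h R) q).

Let JiE : Ji = gradient_integrand.
Proof. by apply/funext => q; rewrite /Ji u1E u2E. Qed.

Lemma integrable_gradient_integrand :
  mu3.-integrable setT (EFin \o (gradient_integrand : H -> R)).
Proof. by rewrite -JiE; exact: integrable_commutator. Qed.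

Lemma integral_gradient_integrand :
  a * fieldX (heat_semigroup (rho ^+ 2) f) p + b * fieldY (heat_semigroup (rho ^+ 2) f) p =
  \int[mu3]_q gradient_integrand q.
Proof. by rewrite gradient_heat_semigroup; apply: eq_Rintegral => q _; rewrite -JiE. Qed.

Lemma integrable_Gamma_comp :
  mu3.-integrable setT (EFin \o (fun q : H => Gamma f (m q) * h q)).
Proof.
have -> : (fun q : H => Gamma f (m q) * h q) = fun q => (u1 q * u1 q + u2 q * u2 q) * h q.
  by apply/funext => q; rewrite /Gamma -u1E -u2E !expr2.
apply: integrable_locbdd.
  by apply: locbddM; [apply: locbddD; apply: locbddM|exact: locbdd_h].
by apply: bounded_supportMr; apply: bounded_supportD; apply: bounded_supportMl.
Qed.
End Commutation.

Lemma measurable_Gamma (R : realType) (f : heis R -> R) : smooth f ->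
  measurable_fun [set: measurableTypeR R * measurableTypeR R * measurableTypeR R] (Gamma f).
Proof.
move=> sf.
have mp i := measurable_smooth sf [:: i].
apply: measurable_funD; apply: measurable_funX.
- apply: measurable_funB; first exact: mp.
  apply: measurable_funM; last exact: mp.
  by apply: measurable_funM; [exact: measurable_p2|exact: measurable_cst].
- apply: measurable_funD; first exact: mp.
  apply: measurable_funM; last exact: mp.
  by apply: measurable_funM; [exact: measurable_p1|exact: measurable_cst].
Qed.

(** * The gradient bound *)

Section Conclusion.
Context {R : realType}.
Local Notation RT := (measurableTypeR R).
Local Notation H := (RT * RT * RT)%type.
Local Notation mu3 := (lebesgue3 R).

Lemma derivable_h i (q : heis R) : derivable (@h R) q (basis3 R i).
Proof. by have [C _ hC] := @h_partial R; have [] := hC i q. Qed.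

Lemma partial_h_eq0 i (q : heis R) : h q = 0 -> partial i (@h R) q = 0.
Proof.
move=> hq.
pose phi (s : R) : R := h (s *: basis3 R i + q).
have fl s0 : forall s, h (s *: basis3 R i + (s0 *: basis3 R i + q)) = phi (s + s0).
  by move=> s; rewrite /phi scalerDl addrA.
have dphi s : derivable phi s 1.
  by apply: (proj1 (derivable_line (phi := phi) (fl s))); exact: derivable_h.
have e0 : 0 *: basis3 R i + q = q by rewrite scale0r add0r.
rewrite /partial -{1}e0 (derive_line (phi := phi) (fl 0)).
have p0 : phi 0 = 0 by rewrite /phi e0.
have I0 : (0 : R) \in `](-1), 1[ by rewrite in_itv/= oppr_lt0 ltr01.
have [_ ->//] := @derive1_at_min R phi (-1) 1 0 (ltW (lt_trans (ltrN10 R) ltr01))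
  (fun t _ => dphi t) I0 (fun t _ => eq_ind_r (fun z => z <= phi t) (h_ge0 _) p0).
Qed.

Lemma partial_ln_h i (q : heis R) : 0 < h q ->
  partial i (fun q : heis R => ln (h q)) q = partial i (@h R) q / h q.
Proof.
move=> hq.
pose phi (s : R) : R := h (s *: basis3 R i + q).
have fl : forall s, h (s *: basis3 R i + q) = phi (s + 0) by move=> s; rewrite addr0.
have fl2 : forall s, ln (h (s *: basis3 R i + q)) = (@ln R \o phi) (s + 0) by move=> s; rewrite addr0.
have dphi : derivable phi 0 1.
  by apply: (proj1 (derivable_line (phi := phi) fl)); exact: derivable_h.
have p0 : phi 0 = h q by rewrite /phi scale0r add0r.
rewrite /partial (derive_line (f := fun q : heis R => ln (h q)) (phi := @ln R \o phi) fl2) (derive_line (phi := phi) fl).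
have dl : is_derive (phi 0) 1 (@ln R) (phi 0)^-1 by apply: is_derive1_ln; rewrite p0.
have dp := derivableP dphi.
have [_ e] := is_derive1_comp dl dp.
by rewrite e p0 mulrC.
Qed.

Definition entropy_density (q : heis R) : R :=
  hnorm q ^+ 2 * Gamma (fun q : heis R => ln (h q)) q * h q.

(** Removes the logarithm also where [h] vanishes: on the left the factor [h q] is 0, on the right
    its inverse is 0 by convention. *)
Lemma entropy_densityE q : entropy_density q =
  hnorm q ^+ 2 * (fieldX (@h R) q ^+ 2 + fieldY (@h R) q ^+ 2) * (h q)^-1.
Proof.
rewrite /entropy_density; have := h_ge0 q; rewrite le_eqVlt => /predU1P[h0|h0].
  by rewrite -h0 invr0 !mulr0.
rewrite /Gamma /fieldX /fieldY !partial_ln_h//.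
have : h q != 0 by rewrite gt_eqF.
move: (h q) (partial 0 (@h R) q) (partial 1 (@h R) q) (partial 2 (@h R) q) => *.
by field.
Qed.

Lemma entropy_density_ge0 q : 0 <= entropy_density q.
Proof.
rewrite entropy_densityE mulr_ge0 ?invr_ge0 ?h_ge0//.
by rewrite mulr_ge0 ?sqr_ge0// addr_ge0// sqr_ge0.
Qed.

Lemma measurable_entropy_density : measurable_fun [set: H] (entropy_density : H -> R).
Proof.
have -> : (entropy_density : H -> R) = fun q : H => (q.1.1 ^+ 2 + q.1.2 ^+ 2) *
    (fieldX (@h R) q ^+ 2 + fieldY (@h R) q ^+ 2) * (h q)^-1.
  by apply/funext => q; rewrite entropy_densityE hnorm_sqr.
apply: measurable_funM; last first.
  exact: (measurableT_comp measurable_invr (@measurable_h R)).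
apply: measurable_funM; apply: measurable_funD; apply: measurable_funX.
- exact: measurable_p1.
- exact: measurable_p2.
- by have [] := @locbdd_fieldX_h R.
- by have [] := @locbdd_fieldY_h R.
Qed.

(** Put c = a y - b x, v = (2 a, 2 b) and w = c (Y/k, - X/k). The left side is k times the scalar
    product of (U, V) with v + w. AM-GM, the parallelogram law for v + w and v - w, and Lagrange's
    identity c^2 + (a x + b y)^2 = (a^2 + b^2) (x^2 + y^2) provide the squares displayed in the
    proof. *)
Lemma gradient_integrand_AMGM (a b U V X Y x y k s : R) : 0 < k -> 0 < s ->
  2 * (a * U + b * V) * k + (a * y - b * x) * (U * Y - V * X) <=
  s * (a ^+ 2 + b ^+ 2) * (4 * k + (x ^+ 2 + y ^+ 2) * (X ^+ 2 + Y ^+ 2) / k) +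
  (U ^+ 2 + V ^+ 2) * k / (2 * s).
Proof.
move=> k0 s0; rewrite -subr_ge0.
pose xi := X / k; pose eta := Y / k; pose c := a * y - b * x.
have -> : s * (a ^+ 2 + b ^+ 2) * (4 * k + (x ^+ 2 + y ^+ 2) * (X ^+ 2 + Y ^+ 2) / k) +
  (U ^+ 2 + V ^+ 2) * k / (2 * s) -
  (2 * (a * U + b * V) * k + (a * y - b * x) * (U * Y - V * X)) =
  k / (2 * s) * ((s * (2 * a + c * eta) - U) ^+ 2 + (s * (2 * b - c * xi) - V) ^+ 2 +
    s ^+ 2 * ((2 * a - c * eta) ^+ 2 + (2 * b + c * xi) ^+ 2 +
      2 * (a * x + b * y) ^+ 2 * (xi ^+ 2 + eta ^+ 2))).
  by rewrite /c /xi /eta; field; rewrite !gt_eqF.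
rewrite mulr_ge0 ?divr_ge0 ?mulr_ge0 ?(ltW k0) ?(ltW s0)//.
by repeat first [apply: addr_ge0 | exact: sqr_ge0 | apply: mulr_ge0 | exact: ler0n].
Qed.

Lemma integrable_h : mu3.-integrable setT (EFin \o (@h R : H -> R)).
Proof.
apply/integrableP; split; first by apply/measurable_EFinP; exact: measurable_h.
under eq_integral do rewrite /= ger0_norm ?h_ge0//.
exact: (le_lt_trans (@integral_h_le1 R) (ltry _)).
Qed.

Lemma constA_ge0 : (0 <= constA R)%E.
Proof. by apply: integral_ge0 => q _; rewrite lee_fin; exact: entropy_density_ge0. Qed.

Section GradientBound.
Variables (f : heis R -> R) (rho : R) (p : heis R).
Hypotheses (sf : smooth f) (cf : compactly_supported f) (r0 : 0 < rho).

Let m (q : heis R) := hmul p (dilation rho q).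
Let a := fieldX (heat_semigroup (rho ^+ 2) f) p.
Let b := fieldY (heat_semigroup (rho ^+ 2) f) p.
Let g := Gamma (heat_semigroup (rho ^+ 2) f) p.
Let J := gradient_integrand f rho p a b.
Let D (q : heis R) := Gamma f (m q) * h q.

(** The coefficients [a] and [b] are the components of the gradient itself, so the linear
    combination is its squared norm. *)
Let gE : g = \int[mu3]_q J q.
Proof.
rewrite -(integral_gradient_integrand p sf cf r0) /g /Gamma -/a -/b.
by rewrite !expr2.
Qed.

Let D_ge0 q : 0 <= D q.
Proof. by rewrite mulr_ge0 ?h_ge0// addr_ge0// sqr_ge0. Qed.

(** If [Gamma f] vanishes at m q then U = V = 0; otherwise h q = 0, and the gradient of [h] vanishes
    at this minimum. This covers both the zeros of [h] in [J_le] and the case of infinite A. *)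
Let J_eq0 q : D q = 0 -> J q = 0.
Proof.
move=> /eqP; rewrite /J /gradient_integrand mulf_eq0 => /orP[|/eqP hq].
  rewrite /Gamma paddr_eq0 ?sqr_ge0// !sqrf_eq0 => /andP[/eqP -> /eqP ->].
  by rewrite !(mulr0, mul0r, addr0, subr0).
have -> : fieldX (@h R) q = 0 by rewrite /fieldX !partial_h_eq0// mulr0 subr0.
have -> : fieldY (@h R) q = 0 by rewrite /fieldY !partial_h_eq0// mulr0 addr0.
by rewrite hq !(mulr0, mul0r, addr0, subr0).
Qed.

Let J_le s q : 0 < s ->
  J q <= s * g * (4 * h q + entropy_density q) + (2 * s)^-1 * D q.
Proof.
move=> s0; have g0 : 0 <= g by rewrite addr_ge0// sqr_ge0.
have := h_ge0 q; rewrite le_eqVlt => /predU1P[h0|h0].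
  rewrite J_eq0 ?/D -?h0 ?mulr0//.
  by rewrite add0r addr0 mulr_ge0 ?entropy_density_ge0// mulr_ge0// ltW.
rewrite entropy_densityE hnorm_sqr [X in _ <= _ + X]mulrC.
exact: gradient_integrand_AMGM.
Qed.

Let iJ : mu3.-integrable setT (EFin \o (J : H -> R)).
Proof. exact: integrable_gradient_integrand. Qed.

Let iD : mu3.-integrable setT (EFin \o (D : H -> R)).
Proof. exact: integrable_Gamma_comp. Qed.

(** A nonnegative [D] with zero integral vanishes almost everywhere, and then so does [J]. *)
Lemma Rintegral_J_eq0 : \int[mu3]_q D q = 0 -> \int[mu3]_q J q = 0.
Proof.
move=> D0; have mD := measurable_int mu3 iD; have mJ := measurable_int mu3 iJ.
have [+ _] := ae_eq_integral_abs mu3 measurableT mD.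
have -> : (\int[mu3]_q `|(EFin \o D) q| = 0)%E.
  under eq_integral do rewrite /= ger0_norm ?D_ge0//.
  by rewrite (EFin_Rintegral iD) D0.
move=> /(_ erefl) aeD.
have aeJ : ae_eq mu3 setT (EFin \o (J : H -> R)) (cst 0%E).
  by apply: filterS aeD => q qD /qD /= [] /J_eq0 ->.
by rewrite /Rintegral (@ae_eq_integral _ _ _ mu3 setT (cst 0%E) _ measurableT mJ _ aeJ)// integral0.
Qed.

Lemma Gamma_heat_semigroup_le :
  ((Gamma (heat_semigroup (rho ^+ 2) f) p)%:E <=
    2%:E * (constA R + 4%:E) * (heat_semigroup (rho ^+ 2) (Gamma f) p)%:E)%E.
Proof.
rewrite (heat_semigroup_dilation r0 (measurable_Gamma sf) iD) -/g.
have g0 : 0 <= g by rewrite addr_ge0// sqr_ge0.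
have C0 : 0 <= \int[mu3]_q D q by apply: Rintegral_ge0 => q _; exact: D_ge0.
have := constA_ge0; case AE : (constA R) => [A| |]// A0; last first.
  (* For A = +oo the right side is +oo unless the semigroup term is 0. In that case it is 0, and the
     gradient has to vanish. *)
  rewrite addye// gt0_muley ?lte_fin//.
  have [C1|C1] := ltP 0 (\int[mu3]_q D q).
    by rewrite gt0_mulye ?lte_fin// leey.
  have {}C1 : \int[mu3]_q D q = 0 by apply/eqP; rewrite eq_le C0 C1.
  rewrite C1 mule0 lee_fin gE le_eqVlt; apply/orP; left; apply/eqP.
  exact: Rintegral_J_eq0.
rewrite -EFinD -!EFinM lee_fin.
have A40 : 0 < A + 4 by rewrite ltr_wpDl.
pose s := (2 * (A + 4))^-1.
have s0 : 0 < s by rewrite invr_gt0 mulr_gt0.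
have iE : mu3.-integrable setT (EFin \o (entropy_density : H -> R)).
  apply/integrableP; split; first by apply/measurable_EFinP; exact: measurable_entropy_density.
  under eq_integral do rewrite /= ger0_norm ?entropy_density_ge0//.
  by rewrite [ltLHS](_ : _ = constA R)// AE ltry.
have EA : \int[mu3]_q entropy_density q = A.
  by rewrite /Rintegral [X in fine X](_ : _ = constA R)// AE.
have h1 : \int[mu3]_q h q <= 1.
  by rewrite -lee_fin -(EFin_Rintegral integrable_h); exact: integral_h_le1.
have i4h := integrable_scale 4 integrable_h.
have iK := integrable_scale (s * g) (integrable_addr i4h iE).
have iDs := integrable_scale (2 * s)^-1 iD.
have := le_Rintegral measurableT iJ (integrable_addr iK iDs) (fun q _ => J_le q s0).
rewrite (RintegralD measurableT iK iDs) (RintegralZl _ measurableT (integrable_addr i4h iE)).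
rewrite (RintegralZl _ measurableT iD) (RintegralD measurableT i4h iE).
rewrite (RintegralZl _ measurableT integrable_h) EA -gE => le1.
(* The choice of [s] lets the left side absorb this half of g; doubling the remaining coefficient 1
   / (2 s) = A + 4 gives 2 (A + 4). *)
have le2 : s * g * (4 * \int[mu3]_q h q + A) <= g / 2.
  have -> : g / 2 = s * g * (4 + A) by rewrite /s; field; rewrite gt_eqF.
  by rewrite ler_wpM2l ?mulr_ge0 ?(ltW s0)// lerD2r -[leRHS]mulr1 ler_wpM2l//.
have e2 : (2 * s)^-1 = A + 4 by rewrite /s; field; rewrite gt_eqF.
move: le1 le2; rewrite e2; move: (_ * (_ + A)) (\int[mu3]_q D q) => u v le1 le2.
lra.
Qed.
End GradientBound.
End Conclusion.

Theorem theorem4p1 (R : realType) (t : R) (f : heis R -> R) (p : heis R) :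
  0 <= t -> smooth f -> compactly_supported f ->
  ((Gamma (heat_semigroup t f) p)%:E <=
    2%:E * (constA R + 4%:E) * (heat_semigroup t (Gamma f) p)%:E)%E.
Proof.
move=> t0 sf cf; move: t0; rewrite le_eqVlt => /predU1P[<-|t0].
  have e g : heat_semigroup 0 g = g :> (heis R -> R).
    by apply/funext => q; rewrite /heat_semigroup eqxx.
  have G0 : 0 <= Gamma f p by rewrite addr_ge0// sqr_ge0.
  rewrite !e -[leLHS]mul1e; apply: lee_wpmul2r; rewrite ?lee_fin//.
  (* At t = 0 the semigroup is the identity, and the constant is at least 8. *)
  have A4 : (4%:E <= constA R + 4%:E)%E by rewrite leeDr// constA_ge0.
  apply: (@le_trans _ _ (2%:E * 4%:E)%E); last by rewrite lee_wpmul2l ?lee_fin.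
  by rewrite -EFinM lee_fin -natrM ler1n.
have -> : t = Num.sqrt t ^+ 2 by rewrite sqr_sqrtr// ltW.
apply: Gamma_heat_semigroup_le => //.
by rewrite sqrtr_gt0.
Qed.
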